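(* Let $\mathbf Y$ be a finite dimensional Hilbert space, $g:\mathbf Y\to[-\infty,\infty]$ and $(\bar u,\bar y)\in\mathrm{gph}\,\partial g$. Assume that there is a neighborhood $U$ of $\bar u$ such that $g$ is reliably $\mathcal C^2$-decomposable at any $u\in U\cap\mathrm{dom}\,g$. Then the following properties are equivalent: (a) $g$ is strictly twice epi-differentiable at $u$ for $y$ for any pair $(u,y)\in\mathrm{gph}\,\partial g$ close to $(\bar u,\bar y)$; (b) $\partial g$ is strictly proto-differentiable at $u$ for $y$ for any pair $(u,y)\in\mathrm{gph}\,\partial g$ close to $(\bar u,\bar y)$; (c) $\bar y\in\mathrm{ri}\,\partial g(\bar u)$.
   Context: Set limits are in the Painlevé–Kuratowski sense. For a set $\Omega$ and $x\in\Omega$: $T_\Omega(x)=\limsup_{t\searrow0}\frac{\Omega-x}{t}$ (tangent cone), $\widehat T_\Omega(x)=\liminf_{x'\to x,\,x'\in\Omega,\,t\searrow0}\frac{\Omega-x'}{t}$ (regular tangent cone), $\widetilde T_\Omega(x)=\limsup_{x'\to x,\,x'\in\Omega,\,t\searrow0}\frac{\Omega-x'}{t}$ (paratingent cone). The regular normal cone is the polar $\widehat N_\Omega(x)=T_\Omega(x)^*$; the limiting normal cone $N_\Omega(\bar x)$ consists of limits of $v^k\in\widehat N_\Omega(x^k)$ with $x^k\to\bar x$, $x^k\in\Omega$. For $f$ with $f(\bar x)$ finite, $\partial f(\bar x)=\{v\mid(v,-1)\in N_{\mathrm{epi}f}(\bar x,f(\bar x))\}$. $\mathrm{ri}$ denotes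 relative interior; $\mathrm{dom}\,g=\{u\mid g(u)<\infty\}$. $g$ is $\mathcal C^2$-decomposable at $u$ if $g(u)$ is finite and there are an open neighborhood $\mathcal O\subset\mathbf Y$ of $u$, a finite dimensional Hilbert space $\mathbf Z$, a proper, lower semicontinuous, sublinear function $\vartheta:\mathbf Z\to[-\infty,\infty]$ and a $\mathcal C^2$-smooth mapping $\Xi:\mathcal O\to\mathbf Z$ with $\Xi(u)=0$ such that $g(u')=g(u)+\vartheta(\Xi(u'))$ for all $u'\in\mathcal O$. It is reliably $\mathcal C^2$-decomposable at $u$ if, in addition, the nondegeneracy condition $\mathrm{par}\{\partial\vartheta(\Xi(u))\}\cap\ker\nabla\Xi(u)^*=\{0\}$ holds, where $\mathrm{par}\,C$ is the linear subspace parallel to the affine hull of $C$. A set-valued mapping $F$ is strictly proto-differentiable at $x$ for $y\in F(x)$ if $\widehat T_{\mathrm{gph}F}(x,y)=\widetilde T_{\mathrm{gph}F}(x,y)$. With $\Delta_t^2f(x,v)(w)=\frac{f(x+tw)-f(x)-t\langle v,w\rangle}{\frac12t^2}$, $f$ is strictly twice epi-differentiable at $\bar x$ for $\bar v\in\partial f(\bar x)$ if the functions $\Delta_t^2f(x,v)$ epi-converge (i.e. their epigraphs converge) to a function as $t\searrow0$, $(x,v)\to(\bar x,\bar v)$ with $f(x)\to f(\bar x)$ and $(x,v)\in\mathrm{gph}\,\partial f$. *)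

(* Defs.v *)
From HB Require Import structures.
From mathcomp Require Import all_boot all_order all_algebra.
From mathcomp Require Import all_classical all_reals all_analysis.

Set Implicit Arguments.
Unset Strict Implicit.
Unset Printing Implicit Defensive.

Import Order.TTheory GRing.Theory Num.Theory.
Import numFieldNormedType.Exports.

Local Open Scope classical_set_scope.
Local Open Scope ring_scope.

(* Finite dimensional real Hilbert spaces: finite dimensionality comes from
   [Vector], and completeness of the norm is then automatic. *)
HB.mixin Record NormedModule_isHilbert (R : realType) V of NormedModule R V := {
  dotp : {dot V for (@idfun R)};
  dotp_norm : forall x : V, dotp x x = `|x| ^+ 2
}.

#[short(type="finHilbertType")]
HB.structure Definition FinHilbert (R : realType) :=
  {V of NormedModule R V & Vector R V & NormedModule_isHilbert R V}.

(* The product [Y * R] of mathcomp-analysis carries the max norm, which induces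
   the right topology but is not Hilbertian. Polars are therefore taken with
   respect to an explicit form, which on [Y * R] is the following one. *)
Definition dotpR (R : realType) (Y : finHilbertType R) (p q : Y * R) : R :=
  dotp p.1 q.1 + p.2 * q.2.

(* Painleve-Kuratowski outer and inner limits of the sets [C i] along [F]. *)
Definition PK_limsup (I : Type) (T : topologicalType) (F : set_system I)
    (C : I -> set T) : set T :=
  [set w | forall V, nbhs w V ->
    forall A, F A -> exists2 i, A i & C i `&` V !=set0].

Definition PK_liminf (I : Type) (T : topologicalType) (F : set_system I)
    (C : I -> set T) : set T :=
  [set w | forall V, nbhs w V -> \forall i \near F, C i `&` V !=set0].

Section Cones.
Context {R : realType} {X : normedModType R}.
Implicit Types (Omega C : set X) (x : X).

Definition difference_quotient Omega x (t : R) : set X :=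
  [set t^-1 *: (z - x) | z in Omega].

Definition tangent_cone Omega x : set X :=
  PK_limsup (0 : R)^'+ (difference_quotient Omega x).

(* The base point [x'] may equal [x]. *)
Definition moving_base Omega x : set_system (X * R) :=
  filter_prod (within Omega (nbhs x)) (0 : R)^'+.

Definition regular_tangent_cone Omega x : set X :=
  PK_liminf (moving_base Omega x)
    (fun p => difference_quotient Omega p.1 p.2).

Definition paratingent_cone Omega x : set X :=
  PK_limsup (moving_base Omega x)
    (fun p => difference_quotient Omega p.1 p.2).

Definition polar (ip : X -> X -> R) C : set X :=
  [set v | forall w, C w -> ip v w <= 0].

Definition regular_normal_cone (ip : X -> X -> R) Omega x : set X :=
  polar ip (tangent_cone Omega x).

Definition limiting_normal_cone (ip : X -> X -> R) Omega x : set X :=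
  [set v | exists xs vs : nat -> X,
    [/\ forall k, Omega (xs k) /\ regular_normal_cone ip Omega (xs k) (vs k),
        xs k @[k --> \oo] --> x & vs k @[k --> \oo] --> v]].

Definition affine_set C : Prop :=
  forall x y (t : R), C x -> C y -> C ((1 - t) *: x + t *: y).

Definition aff C : set X := smallest affine_set C.

Definition par C : set X := [set p.1 - p.2 | p in aff C `*` aff C].

Definition ri C : set X :=
  [set x | aff C x /\ exists2 V, nbhs x V & V `&` aff C `<=` C].

End Cones.

Definition gph (X Y : Type) (F : X -> set Y) : set (X * Y) :=
  [set p | F p.1 p.2].

Definition strictly_proto_differentiable (R : realType) (X Y : normedModType R)
    (F : X -> set Y) (x : X) (y : Y) : Prop :=
  regular_tangent_cone (gph F) (x, y) = paratingent_cone (gph F) (x, y).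

Section ExtendedRealFunctions.
Context {R : realType} {Y : finHilbertType R}.
Implicit Types (f : Y -> \bar R) (x v w : Y).

Definition dom f : set Y := [set x | (f x < +oo)%E].

Definition epi f : set (Y * R) := [set p | (f p.1 <= p.2%:E)%E].

(* Empty at points where [f] is not finite. *)
Definition subdiff f x : set Y :=
  [set v | f x \is a fin_num /\
    limiting_normal_cone (@dotpR R Y) (epi f) (x, fine (f x)) (v, -1)].

Definition proper_fun f : Prop := (forall x, (-oo < f x)%E) /\ dom f !=set0.

Definition sublinear f : Prop :=
  [/\ dom f 0,
      forall x (a : R), 0 < a -> f (a *: x) = (a%:E * f x)%E
    & forall x y, (f (x + y)%R <= f x + f y)%E].

(* When [f x] is finite, the subtractions below are unambiguous. *)
Definition second_diff_quotient f x v (t : R) (w : Y) : \bar R :=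
  ((f (x + t *: w)%R - f x - (t * dotp v w)%:E) * ((2^-1 * t ^+ 2)^-1)%:E)%E.

(* (x', v') --> (x, v) with f x' --> f x and (x', v') in gph (subdiff f). *)
Definition attentive_nbhs f x v : set_system (Y * Y) :=
  [set A | exists2 B, nbhs (x, v, f x) B &
    forall p, gph (subdiff f) p -> B (p, f p.1) -> A p].

Definition strictly_twice_epi_differentiable f x v : Prop :=
  exists h : Y -> \bar R,
    let F := filter_prod (0 : R)^'+ (attentive_nbhs f x v) in
    let E (q : R * (Y * Y)) :=
      epi (second_diff_quotient f q.2.1 q.2.2 q.1) in
    PK_limsup F E = epi h /\ PK_liminf F E = epi h.

End ExtendedRealFunctions.

(* Continuous differentiability of order [k] on an open set [O]. As [Y] is
   finite dimensional, continuity and differentiability of [x |-> 'd f x] as a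
   map into linear operators are tested on each vector [v] separately. *)
Fixpoint smooth_on (R : realType) (Y Z : normedModType R) (k : nat) (O : set Y)
    (f : Y -> Z) : Prop :=
  match k with
  | 0 => forall x, O x -> {for x, continuous f}
  | k'.+1 => (forall x, O x -> differentiable f x) /\
             forall v, smooth_on k' O (fun x => 'd f x v : Z)
  end.

Section Decomposable.
Context {R : realType}.

Definition adjoint (Y Z : finHilbertType R) (A : Y -> Z) (z : Z) : Y :=
  get [set y | forall w, dotp y w = dotp z (A w)].

Definition C2_decomposition (Y Z : finHilbertType R) (g : Y -> \bar R) (u : Y)
    (O : set Y) (theta : Z -> \bar R) (Xi : Y -> Z) : Prop :=
  [/\ g u \is a fin_num,
      open O /\ O u,
      [/\ proper_fun theta, lower_semicontinuous theta & sublinear theta],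
      smooth_on 2 O Xi /\ Xi u = 0
    & forall u', O u' -> g u' = (g u + theta (Xi u'))%E].

Definition nondegenerate (Y Z : finHilbertType R) (u : Y)
    (theta : Z -> \bar R) (Xi : Y -> Z) : Prop :=
  par (subdiff theta (Xi u)) `&` [set z | adjoint ('d Xi u) z = 0] = [set 0].

Definition reliably_C2_decomposable (Y : finHilbertType R) (g : Y -> \bar R)
    (u : Y) : Prop :=
  exists (Z : finHilbertType R) (O : set Y) (theta : Z -> \bar R) (Xi : Y -> Z),
    C2_decomposition g u O theta Xi /\ nondegenerate u theta Xi.

End Decomposable.

Lemma adjointP (R : realType) (Y Z : finHilbertType R) (A : {linear Y -> Z})
    (z : Z) (w : Y) : dotp (adjoint A z) w = dotp z (A w).
Proof.
have dotpZ (V : finHilbertType R) (x y : V) (a : R) :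
    dotp x (a *: y) = a * dotp x y by rewrite linearZr.
pose e := vbasis {:Y}; pose n := \dim {:Y}.
pose L (y : Y) : 'rV[R]_n := \row_i dotp y (tnth e i).
have Llin : linear L.
  move=> a x y; apply/rowP => i; rewrite !mxE.
  by rewrite linearDl linearZl_LR.
pose LL := GRing.isLinear.Build _ _ _ _ L Llin.
pose L' : {linear Y -> 'rV[R]_n} := HB.pack L LL.
have Einj : lker (linfun L') == 0%VS.
  apply/lker0P => x y; rewrite !lfunE /= => /rowP Lxy.
  apply/subr0_eq/eqP; rewrite -normr_eq0 -sqrf_eq0 -dotp_norm.
  rewrite {2}(coord_vbasis (memvf (x - y))) linear_sumr big1// => i _.
  rewrite linearZr/= linearBl.
  have := Lxy i; rewrite !mxE !(tnth_nth 0) /e => /eqP.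
  by rewrite -subr_eq0 => /eqP ->; rewrite mulr0.
have /vspaceP/(_ (\row_i dotp z (A (tnth e i)))) : limg (linfun L') = fullv.
  apply/eqP; rewrite eqEdim subvf /= limg_dim_eq ?(eqP Einj) ?capv0//.
  by rewrite dimvf /dim /= mul1n.
rewrite memvf => /memv_imgP[y _]; rewrite lfunE /= => Ly.
have ex : exists y, forall w, dotp y w = dotp z (A w).
  exists y => {}w; rewrite (coord_vbasis (memvf w)) !linear_sum.
  apply: eq_bigr => i _; transitivity (coord e i w * dotp y e`_i).
    exact: dotpZ.
  rewrite [in RHS]linearZ; transitivity (coord e i w * dotp z (A e`_i)).
    by congr (_ * _); have /rowP/(_ i) := Ly; rewrite !mxE !(tnth_nth 0).
  exact/esym/dotpZ.
exact: (getPex ex).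
Qed.

(* Main.v *)
From HB Require Import structures.
Require Import Defs.
From mathcomp Require Import all_boot all_order all_algebra.
From mathcomp Require Import all_classical all_reals all_analysis.
From mathcomp Require Import ring lra.

(** Near [ubar] one has [g u = g ubar + theta (Xi u)]. The sublinear function
    [theta] is the support function of the convex set [C] of its linear minorants;
    let [U] be the subspace parallel to [C] and [P] the orthogonal projection
    onto [U]. On the orthogonal of [U] all elements of [C] agree with [theta]
    ([thetaD_orth], which rests on proximal points), so that only [P (Xi u)]
    enters in a nonsmooth way. Nondegeneracy means that the derivative of
    [P \o Xi] is onto [U] ([framed_of_reliable]); hence equations in [P (Xi u)]
    can be solved near [ubar] with linear error bounds ([regular_solve]). The
    chain rule follows: the subgradients of [g] at [u] are the vectors
    [('d Xi u)^* z] with [z] in [C] exact at [Xi u] ([subdiff_of_minorant],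
    [minorant_of_subdiff]), and the multiplier [z] depends on the subgradient in a
    Lipschitz way ([adj_lower]).

    Let [z0] be the multiplier of [ybar]. Condition (c) says that [z0] lies in
    the relative interior of [C], that is,
    [theta x >= <z0, x> + e * |P x|] for some [e > 0] ([ri_of_interior],
    [interior_of_ri]). In that case every point [(u, y)] of the graph close to
    [(ubar, ybar)] satisfies [P (Xi u) = 0] and has an interior multiplier
    ([subdiff_graph_near]): the graph is locally a smooth manifold, and (c) holds
    at all nearby points of the graph. Strict twice epi-differentiability and
    strict proto-differentiability are then proved at such points from uniform
    second order expansions of [Xi], with corrections that keep the moving points
    on the zero set of [P \o Xi] ([strictly_twice_epi_of_interior],
    [strictly_proto_of_interior]).

    Conversely, if [z0] is not in the relative interior of [C], there is a
    nonzero [x] in [U] with [theta x = <z0, x>]. Along curves with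
    [P (Xi _) = t *: x] the second order quotients at [(ubar, ybar)] stay
    bounded, whereas at [ubar] for subgradients with interior multipliers close
    to [z0] they blow up, so (a) fails
    ([interior_of_strictly_twice_epi]). Similarly the vertical vector
    [(0, - ('d Xi ubar)^* x)] is paratingent to the graph; if it were regularly
    tangent, then starting from points of the curve one would reach pairs that
    contradict the monotonicity of the subdifferential of [theta], so (b) fails
    ([interior_of_strictly_proto]). *)

Set Implicit Arguments.
Unset Strict Implicit.
Unset Printing Implicit Defensive.

Import Order.TTheory GRing.Theory Num.Theory.
Import numFieldNormedType.Exports.

Local Open Scope classical_set_scope.
Local Open Scope ring_scope.

(** * Inner products and compactness in finite dimension *)

Section DotTheory.
Context {R : realType} {V : finHilbertType R}.
Implicit Types (x y z : V) (a : R).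

Lemma dotC x y : dotp x y = dotp y x.
Proof. by rewrite hermC /= expr0 mul1r. Qed.

Lemma dotDl x y z : dotp (x + y) z = dotp x z + dotp y z.
Proof. by rewrite linearDl. Qed.

Lemma dotDr x y z : dotp z (x + y) = dotp z x + dotp z y.
Proof. by rewrite dotC dotDl !(dotC z). Qed.

Lemma dotZl a x y : dotp (a *: x) y = a * dotp x y.
Proof. by rewrite linearZl_LR. Qed.

Lemma dotZr a x y : dotp x (a *: y) = a * dotp x y.
Proof. by rewrite dotC dotZl dotC. Qed.

Lemma dotNl x y : dotp (- x) y = - dotp x y.
Proof. by rewrite -scaleN1r dotZl mulN1r. Qed.

Lemma dotNr x y : dotp x (- y) = - dotp x y.
Proof. by rewrite dotC dotNl dotC. Qed.

Lemma dotBl x y z : dotp (x - y) z = dotp x z - dotp y z.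
Proof. by rewrite dotDl dotNl. Qed.

Lemma dotBr x y z : dotp z (x - y) = dotp z x - dotp z y.
Proof. by rewrite dotDr dotNr. Qed.

Lemma dot0l x : dotp 0 x = 0.
Proof. by rewrite -(scale0r 0) dotZl mul0r. Qed.

Lemma dot0r x : dotp x 0 = 0.
Proof. by rewrite dotC dot0l. Qed.

Definition dotE := (dotDl, dotDr, dotBl, dotBr, dotNl, dotNr, dotZl, dotZr,
  dot0l, dot0r).

Lemma dot_eq0 x : dotp x x = 0 -> x = 0.
Proof.
by rewrite dotp_norm => /eqP; rewrite sqrf_eq0 normr_eq0 => /eqP.
Qed.

Lemma dot_inj x y : (forall z, dotp x z = dotp y z) -> x = y.
Proof.
by move=> xy; apply/eqP; rewrite -subr_eq0; apply/eqP/dot_eq0; rewrite dotBl xy subrr.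
Qed.

Lemma normr_dot x y : `|dotp x y| <= `|x| * `|y|.
Proof.
have [->|y0] := eqVneq y 0; first by rewrite dot0r !normr0 mulr0.
rewrite -(@ler_pXn2r _ 2)// ?nnegrE ?mulr_ge0//.
rewrite exprMn -!dotp_norm -normrX ger0_norm ?sqr_ge0//.
have yy : 0 < dotp y y by rewrite dotp_norm exprn_gt0// normr_gt0.
have : 0 <= dotp (dotp y y *: x - dotp x y *: y) (dotp y y *: x - dotp x y *: y).
  by rewrite dotp_norm sqr_ge0.
(* The square of a multiple of the component of [x] orthogonal to [y]. *)
have -> : dotp (dotp y y *: x - dotp x y *: y) (dotp y y *: x - dotp x y *: y)
    = dotp y y * (dotp x x * dotp y y - dotp x y ^+ 2).
  by rewrite !dotE (dotC y x); ring.
by rewrite pmulr_rge0// subr_ge0.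
Qed.

Lemma dot_le_norm x y : dotp x y <= `|x| * `|y|.
Proof. exact: le_trans (ler_norm _) (normr_dot x y). Qed.

Lemma dot_ge_norm x y : - (`|x| * `|y|) <= dotp x y.
Proof. by have := normr_dot x y; rewrite ler_norml => /andP[]. Qed.

Lemma norm_le_dot x (c : R) : 0 <= c -> (forall y, dotp x y <= c * `|y|) ->
  `|x| <= c.
Proof.
move=> c0 /(_ x); rewrite dotp_norm expr2; have [->|x0] := eqVneq x 0.
  by rewrite normr0.
by rewrite ler_pM2r// normr_gt0.
Qed.

(** Adjoints exist, so it is enough to see [l] as the component along a fixed
    vector [e] of the rank one operator [w |-> l w *: e]. *)
Lemma riesz (l : {linear V -> R^o}) : exists p : V, forall w, l w = dotp p w.
Proof.
have [[e e0]|noe] := pselect (exists e : V, e != 0); last first.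
  exists 0 => w; have -> : w = 0.
    by apply/eqP/negPn/negP => w0; apply: noe; exists w.
  by rewrite linear0 dot0l.
pose A (w : V) : V := l w *: e.
have Alin : linear A.
  by move=> a x y; rewrite /A linearP/= scalerDl scalerA.
pose AL : {linear V -> V} := HB.pack A (GRing.isLinear.Build _ _ _ _ A Alin).
exists (adjoint AL ((`|e| ^+ 2)^-1 *: e)) => w.
rewrite adjointP dotZl /= dotZr dotp_norm mulrCA mulVf ?mulr1//.
by rewrite sqrf_eq0 normr_eq0.
Qed.

(** Norm estimates for linear maps and compactness of balls both come from the
    fact that coordinates are inner products with fixed vectors. *)
Lemma coord_bounded : exists2 K : R, 0 <= K &
  forall i x, `|coord (vbasis {:V}) i x| <= K * `|x|.
Proof.
have H i : exists p : V, forall w, coord (vbasis {:V}) i w = dotp p w.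
  by have [p hp] := riesz (coord (vbasis {:V}) i); exists p.
have [p hp] := choice H.
exists (\sum_i `|p i|); first exact: sumr_ge0.
move=> i x; rewrite hp (le_trans (normr_dot _ _))// ler_wpM2r//.
by rewrite (bigD1 i)//= lerDl sumr_ge0.
Qed.

Lemma linear_bounded (W : normedModType R) (f : V -> W) : linear f ->
  exists2 K : R, 0 <= K & forall x, `|f x| <= K * `|x|.
Proof.
move=> flin; pose F : {linear V -> W} := HB.pack f (GRing.isLinear.Build _ _ _ _ f flin).
have [K K0 HK] := coord_bounded.
exists (K * \sum_(i < \dim {:V}) `|f (vbasis {:V})`_i|).
  by rewrite mulr_ge0// sumr_ge0.
move=> x; rewrite -[f]/(F : V -> W) {1}(coord_vbasis (memvf x)) linear_sum.
rewrite (le_trans (ler_norm_sum _ _ _))// mulrAC mulr_sumr ler_sum// => i _.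
by rewrite linearZ/= normrZ ler_wpM2r.
Qed.

(** [A] is the continuous image of the set of coordinates of its points, which
    is closed and bounded in a space of row vectors. *)
Lemma compact_of_bounded (A : set V) (M : R) : closed A ->
  (forall x, A x -> `|x| <= M) -> compact A.
Proof.
move=> clA bA; pose n := \dim {:V}; pose e := vbasis {:V}.
pose T (a : 'rV[R]_n) : V := \sum_i a 0 i *: e`_i.
have Tlin : linear T.
  move=> k a b; rewrite /T scaler_sumr -big_split/=; apply: eq_bigr => i _.
  by rewrite !mxE scalerDl scalerA.
pose TL : {linear 'rV[R]_n -> V} := HB.pack T (GRing.isLinear.Build _ _ _ _ T Tlin).
have entry (a : 'rV[R]_n) i : `|a 0 i| <= `|a|.
  rewrite [leRHS]/Num.Def.normr /= mx_normrE; apply/bigmax_geP; right => /=.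
  by exists (0, i).
have Tc : continuous T.
  apply: (linear_bounded_continuous TL).1; apply/linear_boundedP.
  near=> r => a; rewrite /= (le_trans (ler_norm_sum _ _ _))//.
  apply: (@le_trans _ _ ((\sum_(i < n) `|e`_i|) * `|a|)).
    by rewrite mulr_suml ler_sum// => i _; rewrite normrZ mulrC ler_wpM2l.
  rewrite ler_wpM2r//; near: r; apply: nbhs_pinfty_ge; rewrite num_real//.
have [K K0 HK] := coord_bounded.
pose B := T @^-1` A `&` [set a | `|a| <= K * M].
have -> : A = T @` B.
  apply/seteqP; split => [x Ax|_ [a [Aa _] <-]//].
  exists (\row_i coord e i x).
    have Tx : T (\row_i coord e i x) = x.
      rewrite {2}(coord_vbasis (memvf x)) /T; apply: eq_bigr => i _.
      by rewrite mxE.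
    split; rewrite /= ?Tx//.
    rewrite [leLHS]/Num.Def.normr /= mx_normrE; apply/bigmax_leP; split => /=.
      by rewrite mulr_ge0// (le_trans _ (bA x Ax)).
    by move=> [i j] _; rewrite mxE (le_trans (HK _ _))// ler_wpM2l// bA.
  rewrite /T {2}(coord_vbasis (memvf x)); apply: eq_bigr => i _.
  by rewrite mxE.
apply: continuous_compact; first exact: continuous_subspaceT.
apply: bounded_closed_compact.
  exists (K * M); split; first exact: num_real.
  by move=> r Kr a [_ /= /le_trans]; apply; exact: ltW.
apply: closedI; first by apply: closed_comp => // a _; exact: Tc.
have -> : [set a : 'rV[R]_n | `|a| <= K * M] = closed_ball_ Num.Def.normr 0 (K * M).
  by apply/seteqP; split => a; rewrite /closed_ball_ /= sub0r normrN.
exact: closed_closed_ball_.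
Unshelve. all: by end_near. Qed.

Lemma compact_norm_le (M : R) : compact [set x : V | `|x| <= M].
Proof.
apply: (@compact_of_bounded _ M) => //.
have -> : [set x : V | `|x| <= M] = closed_ball_ Num.Def.normr 0 M.
  by apply/seteqP; split => a; rewrite /closed_ball_ /= sub0r normrN.
exact: closed_closed_ball_.
Qed.

End DotTheory.

(** * Semicontinuous minimisation, projections and perturbed identities *)

(** Compactness in the form used throughout: directed families of closed sets
    replace both infima and finite subcovers. *)
Lemma compact_directed (T : topologicalType) (I : Type) (K : set T)
    (D : set I) (C : I -> set T) : compact K -> D !=set0 ->
  (forall i, D i -> closed (C i)) ->
  (forall i j, D i -> D j -> exists2 k, D k & C k `<=` C i `&` C j) ->
  (forall i, D i -> K `&` C i !=set0) ->
  exists2 x, K x & forall i, D i -> C i x.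
Proof.
move=> cK D0 clC dir ne; pose F := filter_from D (fun i => K `&` C i).
have FF : ProperFilter F.
  apply: filter_from_proper => [|i /ne//].
  apply: filter_from_filter => // i j Di Dj.
  have [k Dk kij] := dir _ _ Di Dj; exists k => // x [Kx /kij[]].
  by move=> ? ?.
have FK : F K by have [i Di] := D0; exists i => // x [].
have [x [Kx xF]] := cK F FF FK; exists x => // i Di.
apply: (clC i Di) => A Ax.
have FC : F (C i) by exists i => // y [].
by have [y [Cy Ay]] := xF _ _ FC Ax; exists y.
Qed.

Lemma lsc_sublevel_closed (T : topologicalType) (R : realType)
    (f : T -> \bar R) (c : \bar R) :
  lower_semicontinuous f -> closed [set x | (f x <= c)%E].
Proof.
move=> lf; rewrite -[X in closed X]setCK; apply: open_closedC.
rewrite openE => x /= /negP; rewrite -ltNge => cx.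
have [a ca ax] : exists2 a : R, (c <= a%:E)%E & (a%:E < f x)%E.
  case: c cx => [c cx||]; [by exists c|by rewrite ltNge leey|].
  case: (f x) => [r _|_|//].
    by exists (r - 1); rewrite ?leNye// lte_fin ltrBlDr ltrDl.
  by exists 0; rewrite ?leNye ?ltry.
have [A xA Aa] := lf x a ax; apply: filterS xA => y /Aa ay /=.
by apply/negP; rewrite -ltNge (le_lt_trans ca).
Qed.

(** The sublevel sets of the values of [f] on [K] form a chain, so that no
    reference to an infimum is needed. *)
Lemma lsc_compact_min (T : topologicalType) (R : realType) (K : set T)
    (f : T -> \bar R) : compact K -> K !=set0 -> lower_semicontinuous f ->
  exists2 p, K p & forall x, K x -> (f p <= f x)%E.
Proof.
move=> cK K0 lf.
have [|||p Kp pm] := @compact_directed T T K K (fun x => [set y | (f y <= f x)%E]) cK K0.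
- by move=> x _; exact: lsc_sublevel_closed.
- move=> x y Kx Ky; have [xy|yx] := leP (f x) (f y).
    by exists x => // z /= zx; split => //; exact: le_trans xy.
  by exists y => // z /= zy; split => //; rewrite (le_trans zy)// ltW.
- by move=> x Kx; exists x; split => /=.
- by exists p.
Qed.

Lemma lscD (T : topologicalType) (R : realType) (f : T -> \bar R) (q : T -> R) :
  lower_semicontinuous f -> continuous q ->
  lower_semicontinuous (fun x => f x + (q x)%:E)%E.
Proof.
move=> lf cq x a ax.
have [b ab bx] : exists2 b : R, a - q x < b & (b%:E < f x)%E.
  case: (f x) ax => [r|_|].
  - rewrite -EFinD lte_fin => arq; exists ((a - q x + r) / 2).
      by rewrite ltr_pdivlMr//; lra.
    by rewrite lte_fin ltr_pdivrMr//; lra.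
  - by exists (a - q x + 1); rewrite ?ltry// ltrDl.
  - by rewrite addNye.
have [A xA Ab] := lf x b bx.
have qx : a - b < q x by lra.
exists (A `&` [set y | a - b < q y]).
  apply: filterI => //; apply: (cq x [set z | a - b < z]).
  exact: lt_nbhsr.
move=> y [/Ab bfy /= qy]; case: (f y) bfy => [r|_|//].
  by rewrite -EFinD !lte_fin => ?; lra.
by rewrite addye// ltry.
Qed.

Section LinearAlgebra.
Context {R : realType}.

(** Gram-Schmidt: a projection is extended by one vector [d] by adding the
    component along [r = d - P d]. *)
Lemma orth_proj (V : finHilbertType R) (U : {vspace V}) :
  exists P : {linear V -> V}, [/\ forall x, P x \in U,
    forall x, x \in U -> P x = x & forall x y, dotp (P x) y = dotp x (P y)].
Proof.
suff H (X : seq V) : exists P : {linear V -> V}, [/\ forall x, P x \in <<X>>%VS,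
    forall x, x \in <<X>>%VS -> P x = x & forall x y, dotp (P x) y = dotp x (P y)].
  by have := H (vbasis U); rewrite (span_basis (vbasisP U)).
elim: X => [|d X [P [PU PK Psym]]].
  exists (\0 : {linear V -> V}); split => [x|x|x y]; rewrite ?mem0v//.
    by rewrite span_nil memv0 => /eqP ->.
  by rewrite dot0l dot0r.
have [r rE] : exists r, r = d - P d by exists (d - P d).
have rorth y : y \in <<X>>%VS -> dotp r y = 0.
  by move=> ys; rewrite rE dotBl Psym (PK y ys) subrr.
have rd : dotp r d = `|r| ^+ 2.
  by rewrite -dotp_norm {3}rE dotBr (rorth (P d))// subr0.
pose Q (x : V) : V := P x + (dotp r x / `|r| ^+ 2) *: r.
have Qlin : linear Q.
  move=> a x y; rewrite /Q linearP/= dotDr dotZr !mulrDl scalerDl [a *: (_ + _)]scalerDr.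
  by rewrite -mulrA -scalerA addrACA.
exists (HB.pack Q (GRing.isLinear.Build _ _ _ _ Q Qlin) : {linear V -> V}).
have ss x : x \in <<X>>%VS -> x \in <<(d :: X)>>%VS.
  by move=> xs; rewrite span_cons; apply: (subvP (addvSr _ _)).
have ds : d \in <<(d :: X)>>%VS by apply: memv_span; rewrite mem_head.
split => /= [x|x|x y].
- rewrite /Q rE; apply: memvD (ss _ (PU x)) (memvZ _ (memvB ds (ss _ (PU d)))).
- rewrite span_cons => /memv_addP[_ /vlineP[k ->] [y ys ->]].
  rewrite /Q linearD linearZ/= (PK y ys) dotDr dotZr (rorth y)// addr0 rd.
  have [r0|r0] := eqVneq r 0.
    rewrite r0 scaler0 addr0; congr (k *: _ + y).
    by apply/esym/eqP; rewrite -subr_eq0 -rE r0.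
  rewrite mulfK ?sqrf_eq0 ?normr_eq0// addrAC -scalerDr rE.
  by rewrite (addrC (P d)) subrK.
- by rewrite /Q !dotE Psym (dotC x r); ring.
Qed.

Lemma linear_section (Y Z : finHilbertType R) (f : {linear Y -> Z}) :
  exists B : {linear Z -> Y}, forall z, (exists w, f w = z) -> f (B z) = z.
Proof.
exists ((linfun f)^-1)%VF => _ [w <-].
have := @limg_lfunVK _ _ _ (linfun f); rewrite /prop_in1 => H.
have := H (f w); rewrite !lfunE /= => -> //.
by rewrite -[f w](lfunE f) memv_img ?memvf.
Qed.

(** Stated for functions, so that surjectivity of an operator can be read off
    a quadratic form. *)
Lemma linear_inj_surj (V : finHilbertType R) (T : {linear V -> V}) :
  (forall x, T x = 0 -> x = 0) -> forall y, exists x, T x = y.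
Proof.
move=> Tinj y.
have k0 : lker (linfun T) == 0%VS.
  rewrite -subv0; apply/subvP => x; rewrite memv_ker lfunE/= => /eqP/Tinj ->.
  by rewrite mem0v.
have : y \in limg (linfun T).
  suff -> : limg (linfun T) = fullv by rewrite memvf.
  by apply/eqP; rewrite eqEdim subvf /= limg_dim_eq ?(eqP k0) ?capv0.
by case/memv_imgP => x _; rewrite lfunE /= => ->; exists x.
Qed.

End LinearAlgebra.

(** Minimising [|G eta - xi|] over a closed ball gives an interior minimiser;
    moving it along the residual would decrease the residual by half. *)
Lemma perturbed_identity_solve (R : realType) (V : finHilbertType R)
    (G : V -> V) (rho : R) (xi : V) :
  (forall a b, `|a| <= rho -> `|b| <= rho ->
     `|G a - G b - (a - b)| <= 2^-1 * `|a - b|) ->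
  4 * `|xi - G 0| < rho ->
  exists2 a, `|a| <= 2 * `|xi - G 0| & G a = xi.
Proof.
move=> Glip xirho; pose A := [set a : V | `|a| <= rho].
have rho0 : 0 < rho by rewrite (le_lt_trans _ xirho)// mulr_ge0.
have A0 : A 0 by rewrite /A /= normr0 ltW.
have cA : compact A := @compact_norm_le _ _ rho.
have expand a b : A a -> A b -> `|a - b| <= 2 * `|G a - G b|.
  move=> Aa Ab; have := Glip a b Aa Ab.
  have := ler_normB (G a - G b) (G a - G b - (a - b)).
  by rewrite opprB addrC subrK; lra.
have cont : {within A, continuous (fun a => `|G a - xi|)}.
  apply/subspace_continuousP => p Ap; apply/cvgrPdist_le => e e0.
  rewrite near_withinE; near=> q => Aq.
  rewrite (le_trans (ler_dist_dist _ _))// opprB addrA subrK.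
  have pq : `|p - q| < e / 2 by near: q; apply: cvgr_dist_lt; rewrite ?divr_gt0.
  have := Glip p q Ap Aq.
  have := ler_normD (G p - G q - (p - q)) (p - q); rewrite subrK.
  by have := normr_ge0 (p - q); lra.
have [p /set_mem Ap pmin] := compact_EVT_min (ex_intro _ 0 A0) cA cont.
have p0 := pmin 0 (mem_set A0).
have pb : `|p| <= 4 * `|xi - G 0|.
  have := expand p 0 Ap A0; rewrite subr0.
  have := ler_normD (G p - xi) (xi - G 0); rewrite addrA subrK.
  by move: p0; rewrite (distrC (G 0)); lra.
have Gp : G p = xi.
  apply/eqP; rewrite -subr_eq0 -normr_eq0; apply/negPn/negP => res0.
  set N := `|G p - xi| in res0.
  have N0 : 0 < N by rewrite lt_def res0 normr_ge0.
  pose s := Num.min 1 ((rho - `|p|) / N).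
  have s0 : 0 < s by rewrite lt_min ltr01 divr_gt0// subr_gt0; lra.
  have s1 : s <= 1 by rewrite ge_min lexx.
  pose q := p - s *: (G p - xi).
  have qp : q - p = - (s *: (G p - xi)) by rewrite /q addrC addKr.
  have Nqp : `|q - p| = s * N by rewrite qp normrN normrZ gtr0_norm.
  have Aq : A q.
    rewrite /A /= -(subrK p q) (le_trans (ler_normD _ _))// Nqp -lerBrDr.
    by rewrite -ler_pdivlMr// ge_min lexx orbT.
  have := pmin q (mem_set Aq); rewrite -/N leNgt => /negP; apply.
  have -> : G q - xi = (G q - G p - (q - p)) + (1 - s) *: (G p - xi).
    rewrite qp scalerBl scale1r opprK; set u := s *: _.
    by rewrite -addrA [u + _]addrC subrK addrA subrK.
  rewrite (le_lt_trans (ler_normD _ _))// normrZ -/N ger0_norm ?subr_ge0//.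
  have := Glip q p Aq Ap; rewrite Nqp; nra.
exists p => //.
by have := expand p 0 Ap A0; rewrite subr0 Gp.
Unshelve. all: by end_near. Qed.

(** * Second order expansions of C2 mappings *)

Section MeanValue.
Context {R : realType} {Y Z : finHilbertType R}.

Lemma dot_continuous (V : finHilbertType R) (e : V) : continuous (dotp e).
Proof.
move=> x; apply/cvgrPdist_le => c c0; near=> y.
rewrite -dotBr (le_trans (normr_dot _ _))//.
have : `|x - y| <= c / (`|e| + 1).
  by near: y; apply: cvgr_dist_le; rewrite ?divr_gt0// ltr_wpDl.
rewrite ler_pdivlMr ?ltr_wpDl// => xy.
by rewrite (le_trans _ xy)// mulrC ler_wpM2l// lerDl.
Unshelve. all: by end_near. Qed.

Lemma is_derive_dot_path (f : Y -> Z) (v d : Y) (e : Z) (s : R) :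
  differentiable f (v + s *: d) ->
  is_derive s 1 (fun s => dotp e (f (v + s *: d)))
    (dotp e ('d f (v + s *: d) d)).
Proof.
move=> df; have := @diff_derivable _ _ _ f (v + s *: d) d df.
rewrite -(deriveE _ df) /derive /derivable /= => /cvg_ex[l fl].
rewrite (cvg_lim _ fl)//.
have pl : h^-1 *: (dotp e (f (v + (h *: 1 + s) *: d)) -
    dotp e (f (v + s *: d))) @[h --> (0:R)^'] --> dotp e l.
  apply: cvg_trans (continuous_cvg _ (@dot_continuous _ e l) fl).
  apply: near_eq_cvg; near=> h => /=.
  rewrite dotZr dotBr [h *: 1]mulr1; congr (_ * (dotp e (f _) - _)).
  by rewrite scalerDl addrCA addrA.
split; first by apply/cvg_ex; exists (dotp e l).
by apply: cvg_lim.
Unshelve. all: by end_near. Qed.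

(** The scalar mean value theorem applied to the inner product with the error
    itself gives a bound on its norm without loss. With [b = 0] this is the
    usual mean value inequality. *)
Lemma mean_value_quadratic (f : Y -> Z) (v d : Y) (a b : Z) (M : R) :
  (forall s : R, 0 <= s <= 1 -> differentiable f (v + s *: d)) ->
  (forall s : R, 0 <= s <= 1 -> `|'d f (v + s *: d) d - a - s *: b| <= M) ->
  `|f (v + d) - f v - a - 2^-1 *: b| <= M.
Proof.
move=> df fM; set e := (X in `|X| <= M).
pose p (s : R) := dotp e (f (v + s *: d)) - dotp e a * s
  - 2^-1 * dotp e b * s ^+ 2.
have dp (s : R) : 0 <= s <= 1 ->
    is_derive s 1 p (dotp e ('d f (v + s *: d) d - a - s *: b)).
  move=> /df/(@is_derive_dot_path _ _ _ e) dps.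
  have dl : is_derive s 1 (fun s => dotp e a * s) (dotp e a).
    have := @is_deriveZ R R^o R^o id (dotp e a) s 1 1 (is_derive_id _ _).
    by move=> h; apply: is_derive_eq h _; rewrite [_ *: _]mulr1.
  have dq : is_derive s 1 (fun s => 2^-1 * dotp e b * s ^+ 2) (dotp e b * s).
    have sq : is_derive s 1 (fun s : R^o => s ^+ 2) (s + s).
      have h := @is_deriveX R R^o id 2 s 1 1 (is_derive_id _ _).
      by apply: is_derive_eq h _; rewrite /GRing.scale /= expr1 mulr1; ring.
    have h := @is_deriveZ R R^o R^o _ (2^-1 * dotp e b) s 1 _ sq.
    by apply: is_derive_eq h _; rewrite /GRing.scale/=; field.
  have h1 := @is_deriveB _ _ _ _ _ _ _ _ _ dps dl.
  have h2 := @is_deriveB _ _ _ _ _ _ _ _ _ h1 dq.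
  apply: is_derive_eq h2 _; rewrite !dotBr dotZr; ring.
have cp : {within `[0, 1], continuous p}.
  apply: derivable_within_continuous => s; rewrite in_itv/= => s01.
  by have [] := dp s s01.
have dp' (s : R) : s \in `]0, 1[%R ->
    is_derive s 1 p (dotp e ('d f (v + s *: d) d - a - s *: b)).
  by rewrite in_itv/= => /andP[c0 c1]; apply: dp; rewrite !ltW.
have [c c01] := MVT_segment ler01 dp' cp.
rewrite subr0 mulr1 => pc.
have : dotp e e = dotp e ('d f (v + c *: d) d - a - c *: b).
  rewrite -pc /p !scale1r !scale0r addr0 expr1n expr0n /=.
  by rewrite {2}/e !dotBr dotZr; ring.
have cM : `|'d f (v + c *: d) d - a - c *: b| <= M.
  by apply: fM; move: c01; rewrite in_itv.
move=> ee; have [e0|e0] := eqVneq `|e| 0.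
  by rewrite e0 (le_trans _ cM).
have e1 : 0 < `|e| by rewrite lt_def e0 normr_ge0.
rewrite -(ler_pM2l e1).
rewrite -expr2 -dotp_norm ee (le_trans (dot_le_norm _ _))//.
by rewrite ler_wpM2l.
Qed.

End MeanValue.

Lemma diff_lincomb (R : realType) (Y Z : normedModType R) (f g : Y -> Z)
    (a : R) (x v : Y) : differentiable f x -> differentiable g x ->
  'd (fun x => a *: f x + g x) x v = a *: ('d f x v : Z) + 'd g x v.
Proof.
move=> df dg.
have dh : differentiable (fun x => a *: f x + g x) x.
  exact: differentiableD (differentiableZ a df) dg.
rewrite -(deriveE v dh) -(deriveE v df) -(deriveE v dg).
have fv := @diff_derivable _ _ _ f x v df.
have gv := @diff_derivable _ _ _ g x v dg.
by rewrite [LHS](deriveD (@derivableZ _ _ _ _ a _ _ fv) gv) (@deriveZ _ _ _ _ a _ _ fv).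
Qed.

Section Expansions.
Context {R : realType} {Y Z : finHilbertType R}.
Variables (O : set Y) (Xi : Y -> Z).
Hypotheses (oO : open O) (C2 : smooth_on 2 O Xi).

Let d1 x : O x -> differentiable Xi x.
Proof. by have [] := C2; move=> h _; exact: h. Qed.

Let d2 w x : O x -> differentiable (fun x => 'd Xi x w : Z) x.
Proof. by have [_ /(_ w)[]] := C2; move=> h _; exact: h. Qed.

Let c2 w v x : O x -> {for x, continuous (fun x => 'd (fun x => 'd Xi x w : Z) x v : Z)}.
Proof. by have [_ /(_ w)[_ /(_ v)]] := C2; move=> h; exact: h. Qed.

(** The second argument is the direction in which the first derivative varies,
    the third one the vector to which that derivative is applied. No symmetry
    is involved. *)
Definition hess (x v w : Y) : Z := 'd (fun x => 'd Xi x w : Z) x v.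

Lemma hess_linearl x w : linear (fun v => hess x v w).
Proof. by move=> a v v'; rewrite /hess linearP. Qed.

Lemma hess_linearr x v : O x -> linear (hess x v).
Proof.
move=> Ox a w w'; rewrite /hess.
have -> : (fun x => 'd Xi x (a *: w + w') : Z) =
    (fun x => a *: ('d Xi x w : Z) + ('d Xi x w' : Z)).
  by apply/funext => y /=; rewrite linearP.
exact: (diff_lincomb _ _ (d2 w Ox) (d2 w' Ox)).
Qed.

Lemma hess_bounded x : O x -> exists2 K : R, 0 <= K &
  forall v w, `|hess x v w| <= K * `|v| * `|w|.
Proof.
move=> Ox; have [K K0 HK] := @coord_bounded R Y.
have HB w : exists2 L : R, 0 <= L & forall v, `|hess x v w| <= L * `|v|.
  exact/linear_bounded/hess_linearl.
pose e (i : 'I_(\dim {:Y})) := (vbasis {:Y})`_i.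
have HL' i : exists l : R, 0 <= l /\ forall v, `|hess x v (e i)| <= l * `|v|.
  by have [l] := HB (e i); exists l.
have [L HL] := choice HL'.
exists (K * \sum_i L i).
  by rewrite mulr_ge0// sumr_ge0// => i _; have [] := HL i.
move=> v w.
pose h : {linear Y -> Z} := HB.pack (hess x v)
  (GRing.isLinear.Build _ _ _ _ _ (hess_linearr v Ox)).
rewrite -[hess x v w]/(h w) {1}(coord_vbasis (memvf w)) linear_sum.
rewrite (le_trans (ler_norm_sum _ _ _))// mulr_sumr !mulr_suml ler_sum// => i _.
rewrite linearZ/= normrZ.
have [Li0 Li] := HL i.
rewrite (le_trans (ler_wpM2l _ (Li v)))// (le_trans (ler_wpM2r _ (HK i w)))//.
  by rewrite mulr_ge0.
by rewrite le_eqVlt; apply/orP; left; apply/eqP; ring.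
Qed.

(** Separate continuity on pairs of basis vectors is uniform on bounded pairs
    because coordinates are bounded. *)
Lemma hess_continuous u : O u -> forall e : R, 0 < e ->
  \forall x \near u, forall v w, `|hess x v w - hess u v w| <= e * `|v| * `|w|.
Proof.
move=> Ou e e0; have [K K0 HK] := @coord_bounded R Y.
pose b (i : 'I_(\dim {:Y})) := (vbasis {:Y})`_i.
pose S x := \sum_i \sum_j `|hess x (b i) (b j) - hess u (b i) (b j)|.
have Sc : S x @[x --> u] --> (\sum_(i < \dim {:Y}) \sum_(j < \dim {:Y}) (0 : R)).
  apply: (cvg_big (@add_continuous R)) => i _.
  apply: (cvg_big (@add_continuous R)) => j _.
  rewrite -(normr0 Z) -(subrr (hess u (b i) (b j))).
  by apply: cvg_norm; apply: cvgB; [exact: c2|exact: cvg_cst].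
rewrite big1 in Sc; last by move=> i _; rewrite big1.
have e' : 0 < e / (K ^+ 2 + 1) by rewrite divr_gt0// ltr_wpDl// sqr_ge0.
near=> x => v w.
have Ox : O x by near: x; exact: open_nbhs_nbhs.
have Sx : S x <= e / (K ^+ 2 + 1).
  have : `|0 - S x| <= e / (K ^+ 2 + 1) by near: x; exact: cvgr_dist_le.
  by rewrite sub0r normrN; apply: le_trans; exact: ler_norm.
have hE y : O y -> hess y v w = \sum_i \sum_j
    (coord (vbasis {:Y}) i v * coord (vbasis {:Y}) j w) *: hess y (b i) (b j).
  move=> Oy.
  pose hl (w : Y) : {linear Y -> Z} := HB.pack (fun v => hess y v w)
    (GRing.isLinear.Build _ _ _ _ _ (hess_linearl y w)).
  pose hr v : {linear Y -> Z} := HB.pack (hess y v)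
    (GRing.isLinear.Build _ _ _ _ _ (hess_linearr v Oy)).
  rewrite -[LHS]/(hl w v) {1}(coord_vbasis (memvf v)) linear_sum.
  apply: eq_bigr => i _; rewrite linearZ/= -[X in _ *: X]/(hr (b i) w).
  rewrite {1}(coord_vbasis (memvf w)) linear_sum scaler_sumr.
  by apply: eq_bigr => j _; rewrite linearZ/= scalerA.
rewrite (hE x Ox) (hE u Ou) -sumrB.
under eq_bigr do rewrite -sumrB.
apply: (@le_trans _ _ (K ^+ 2 * `|v| * `|w| * S x)).
  rewrite /S mulr_sumr (le_trans (ler_norm_sum _ _ _))// ler_sum// => i _.
  rewrite mulr_sumr (le_trans (ler_norm_sum _ _ _))// ler_sum// => j _.
  rewrite -scalerBr normrZ ler_wpM2r// normrM.
  have -> : K ^+ 2 * `|v| * `|w| = (K * `|v|) * (K * `|w|) by ring.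
  by rewrite ler_pM.
move: Sx; rewrite ler_pdivlMr ?ltr_wpDl ?sqr_ge0// => Sx.
have S0 : 0 <= S x by rewrite sumr_ge0// => i _; rewrite sumr_ge0.
have -> : K ^+ 2 * `|v| * `|w| * S x = (S x * K ^+ 2) * (`|v| * `|w|) by ring.
rewrite -[leRHS]mulrA ler_wpM2r ?mulr_ge0// (le_trans _ Sx)// ler_wpM2l//.
by rewrite lerDl.
Unshelve. all: by end_near. Qed.

Lemma open_ball_segment (V : normedModType R) (u v v' : V) (r s : R) :
  `|v - u| < r -> `|v' - u| < r -> 0 <= s <= 1 ->
  `|v' + s *: (v - v') - u| < r.
Proof.
move=> vr v'r /andP[s0 s1].
have -> : v' + s *: (v - v') - u = s *: (v - u) + (1 - s) *: (v' - u).
  have -> : v - v' = (v - u) - (v' - u) by rewrite opprB addrA subrK.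
  by rewrite addrAC scalerBr scalerBl scale1r addrCA.
rewrite (le_lt_trans (ler_normD _ _))// !normrZ !ger0_norm ?subr_ge0//.
have [->|s0'] := eqVneq s 0; first by rewrite mul0r add0r subr0 mul1r.
have : s * `|v - u| < s * r by rewrite ltr_pM2l// lt_def s0'.
have : (1 - s) * `|v' - u| <= (1 - s) * r by rewrite ler_wpM2l ?subr_ge0// ltW.
lra.
Qed.

(** Strict differentiability of the derivative comes from the mean value
    inequality for [x |-> 'd Xi x w]; integrating it along the segment once more
    gives the second order expansion, uniformly in both end points. *)
Lemma C2_expansion u : O u -> forall e : R, 0 < e -> exists2 r : R, 0 < r &
  forall v v', `|v - u| < r -> `|v' - u| < r ->
  [/\ O v,
     forall w, `|'d Xi v w - 'd Xi v' w - hess u (v - v') w|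
       <= e * `|v - v'| * `|w|
   & `|Xi v - Xi v' - 'd Xi v' (v - v') - 2^-1 *: hess u (v - v') (v - v')|
       <= e * `|v - v'| ^+ 2].
Proof.
move=> Ou e e0.
have [r r0 hr] : exists2 r : R, 0 < r & forall x, `|x - u| < r -> O x /\
    forall v w, `|hess x v w - hess u v w| <= e * `|v| * `|w|.
  have : \forall x \near u, O x /\
      forall v w, `|hess x v w - hess u v w| <= e * `|v| * `|w|.
    apply: filterI; first exact: open_nbhs_nbhs.
    exact: hess_continuous.
  move=> /nbhs_normP[r /= r0 hr]; exists r => // x xu.
  by apply: hr; rewrite /= distrC.
exists r => // v v' vr v'r.
have T1 x x' w : `|x - u| < r -> `|x' - u| < r ->
    `|'d Xi x w - 'd Xi x' w - hess u (x - x') w| <= e * `|x - x'| * `|w|.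
  move=> xr x'r.
  have := @mean_value_quadratic R Y Z (fun x => 'd Xi x w : Z) x' (x - x')
    (hess u (x - x') w) 0 (e * `|x - x'| * `|w|).
  have -> : x' + (x - x') = x by rewrite addrC subrK.
  rewrite scaler0 subr0; apply => s s01.
    by apply: d2; have [] := hr _ (open_ball_segment xr x'r s01).
  by rewrite scaler0 subr0; exact: (hr _ (open_ball_segment xr x'r s01)).2.
split; [by have [] := hr v vr|by move=> w; exact: T1|].
have := @mean_value_quadratic R Y Z Xi v' (v - v')
    ('d Xi v' (v - v')) (hess u (v - v') (v - v')) (e * `|v - v'| ^+ 2).
have -> : v' + (v - v') = v by rewrite addrC subrK.
apply => s s01.
  by apply: d1; have [] := hr _ (open_ball_segment vr v'r s01).
have := T1 _ v' (v - v') (open_ball_segment vr v'r s01) v'r.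
have -> : v' + s *: (v - v') - v' = s *: (v - v') by rewrite addrC addKr.
have -> : hess u (s *: (v - v')) (v - v') = s *: hess u (v - v') (v - v').
  by rewrite /hess linearZ.
move=> /le_trans; apply; rewrite normrZ expr2.
have /andP[s0 s1] := s01.
rewrite ger0_norm// -!mulrA ler_wpM2l ?(ltW e0)// ler_piMl//.
Qed.

(** Quantitative form of the previous expansions in which the second order
    terms are absorbed in a constant. *)
Lemma C2_bounds u : O u -> exists K r : R, [/\ 0 <= K, 0 < r &
  forall v v', `|v - u| < r -> `|v' - u| < r ->
  [/\ O v, forall w, `|'d Xi v w| <= K * `|w|,
     forall w, `|'d Xi v w - 'd Xi v' w| <= K * `|v - v'| * `|w|,
     `|Xi v - Xi v' - 'd Xi v' (v - v')| <= K * `|v - v'| ^+ 2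
   & `|Xi v - Xi v'| <= K * `|v - v'|]].
Proof.
move=> Ou; have [K K0 HK] := hess_bounded Ou.
have [r r0 hr] := C2_expansion Ou ltr01.
have [L L0 HL] : exists2 L : R, 0 <= L & forall w, `|'d Xi u w| <= L * `|w|.
  by apply: linear_bounded => a x y; rewrite linearP.
pose r1 := Num.min r 1.
exists ((K + 1) * 3 + L), r1; split.
- by rewrite addr_ge0// mulr_ge0// addr_ge0.
- by rewrite lt_min r0 ltr01.
move=> v v'; rewrite !lt_min => /andP[vr v1] /andP[v'r v'1].
have [Ov B1 B2] := hr v v' vr v'r.
have uu : `|u - u| < r by rewrite subrr normr0.
have C1 x x' w : `|x - u| < r -> `|x' - u| < r ->
    `|'d Xi x w - 'd Xi x' w| <= (K + 1) * `|x - x'| * `|w|.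
  move=> xr x'r; have [_ /(_ w) + _] := hr x x' xr x'r.
  have := ler_normD ('d Xi x w - 'd Xi x' w - hess u (x - x') w) (hess u (x - x') w).
  by rewrite subrK; have := HK (x - x') w; lra.
have D1 x w : `|x - u| < r -> `|x - u| < 1 -> `|'d Xi x w| <= (K + 1 + L) * `|w|.
  move=> xr x1; have := C1 x u w xr uu.
  have := ler_normD ('d Xi x w - 'd Xi u w) ('d Xi u w); rewrite subrK.
  have := HL w; have : (K + 1) * `|x - u| * `|w| <= (K + 1) * `|w|.
    by rewrite ler_wpM2r// ler_piMr ?addr_ge0// ltW.
  lra.
have N2 : `|v - v'| <= 2.
  have := ler_normD (v - u) (u - v'); rewrite addrA subrK (distrC u); lra.
have C2' : `|Xi v - Xi v' - 'd Xi v' (v - v')| <= (K + 1) * `|v - v'| ^+ 2.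
  set q := hess u (v - v') (v - v') in B2.
  have := ler_normD (Xi v - Xi v' - 'd Xi v' (v - v') - 2^-1 *: q) (2^-1 *: q).
  rewrite subrK normrZ ger0_norm ?invr_ge0//.
  have := HK (v - v') (v - v'); rewrite -/q -mulrA -expr2.
  have := normr_ge0 q; lra.
have M0 : 0 <= (K + 1) * 3 + L by rewrite addr_ge0// mulr_ge0// addr_ge0.
split => //.
- move=> w; apply: le_trans (D1 v w vr v1) _.
  by rewrite ler_wpM2r//; lra.
- move=> w; apply: le_trans (C1 v v' w vr v'r) _.
  by rewrite !ler_wpM2r//; lra.
- by apply: le_trans C2' _; rewrite ler_wpM2r ?sqr_ge0//; lra.
have := ler_normD (Xi v - Xi v' - 'd Xi v' (v - v')) ('d Xi v' (v - v')).
rewrite subrK; have := D1 v' (v - v') v'r v'1.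
have : (K + 1) * `|v - v'| ^+ 2 <= (K + 1) * (2 * `|v - v'|).
  by rewrite ler_wpM2l ?addr_ge0// expr2 ler_wpM2r.
have := normr_ge0 (v - v'); lra.
Qed.

End Expansions.

(** * Sublinear functions and their linear minorants *)

(** Passage to the limit in an inequality with an error term linear in a small
    parameter; the bound [2^-1] leaves room for conditions like [s <= 1]. *)
Lemma ge0_of_scaled (R : realType) (a c : R) :
  (forall s, 0 < s -> s <= 2^-1 -> - (s * c) <= a) -> 0 <= a.
Proof.
move=> H; rewrite leNgt; apply/negP => a0.
have c1 : 0 < `|c| + 1 by rewrite ltr_wpDl.
pose s := Num.min 2^-1 (- a / (2 * (`|c| + 1))).
have s0 : 0 < s.
  by rewrite lt_min invr_gt0 ltr0n/= divr_gt0 ?mulr_gt0// oppr_gt0.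
have s2 : s <= 2^-1 by rewrite ge_min lexx.
have sc : s * (2 * (`|c| + 1)) <= - a.
  by rewrite -ler_pdivlMr ?mulr_gt0// ge_min lexx orbT.
have := H s s0 s2; have : s * c <= s * `|c| by rewrite ler_wpM2l ?ler_norm// ltW.
have := mulr_ge0 (ltW s0) (normr_ge0 c); lra.
Qed.

Lemma linear_continuous_fd (R : realType) (V : finHilbertType R)
    (W : normedModType R) (f : {linear V -> W}) : continuous f.
Proof.
have [K K0 HK] := @linear_bounded _ _ _ f (fun a x y => linearP f a x y).
apply: (linear_bounded_continuous f).1; apply/linear_boundedP.
near=> r => x; rewrite (le_trans (HK x))// ler_wpM2r//.
Unshelve. all: by end_near. Qed.

Section Sublinear.
Context {R : realType} {Z : finHilbertType R}.
Variable theta : Z -> \bar R.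
Hypotheses (ptheta : proper_fun theta) (ltheta : lower_semicontinuous theta)
  (stheta : sublinear theta).

(** The set of linear minorants of [theta], of which [theta] turns out to be
    the support function; it is the subdifferential of [theta] at the origin. *)
Definition minorants : set Z := [set z | forall x, ((dotp z x)%:E <= theta x)%E].

Local Notation C := minorants.

Lemma theta_gtNy x : (-oo < theta x)%E.
Proof. by have [] := ptheta. Qed.

Lemma thetaZ a x : 0 < a -> theta (a *: x) = (a%:E * theta x)%E.
Proof. by have [_ h _] := stheta; exact: h. Qed.

Lemma thetaD x y : (theta (x + y)%R <= theta x + theta y)%E.
Proof. by have [_ _] := stheta. Qed.

Lemma theta0 : theta 0 = 0%E.
Proof.
have [d0 _ _] := stheta; have := @thetaZ 2 0 (ltr0n _ 2).
rewrite scaler0; have := theta_gtNy 0; move: d0; rewrite /dom/=.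
by case: (theta 0) => // r _ _; rewrite -EFinM => -[rr]; congr EFin; lra.
Qed.

(** By positive homogeneity a lower bound on the unit ball is enough, and it
    exists by lower semicontinuity. *)
Lemma theta_lower_bound : exists2 K : R, 0 <= K &
  forall x, ((- (K * `|x|))%:E <= theta x)%E.
Proof.
pose B := [set x : Z | `|x| <= 1].
have cB : compact B := @compact_norm_le _ _ 1.
have B0 : B 0 by rewrite /B/= normr0.
have [p Bp pm] := lsc_compact_min cB (ex_intro _ 0 B0) ltheta.
have := pm _ B0; rewrite theta0; have := theta_gtNy p.
case: (theta p) pm => // k pm _; rewrite lee_fin => k0.
exists (- k); first lra.
move=> x; have [->|x0] := eqVneq x 0.
  by rewrite theta0 normr0 mulr0 oppr0.
have n0 : 0 < `|x| by rewrite normr_gt0.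
rewrite -[x in theta x](@scale1r R) -(@divff _ `|x|) ?gt_eqF// -scalerA thetaZ//.
rewrite mulNr opprK mulrC EFinM lee_pmul2l ?lte_fin// pm// /B/=.
by rewrite normrZ ger0_norm ?invr_ge0// mulVf ?gt_eqF.
Qed.

(** The proximal point of [v]: optimality in the minimisation of
    [theta x + |x - v|^2 / (2 l)] along rays exhibits a linear minorant that is
    exact at the minimiser. This plays the role of a separation theorem. *)
Lemma proximal_minorant (v : Z) (l : R) : 0 < l -> exists p : Z,
  C (l^-1 *: (v - p)) /\ theta p = (dotp (l^-1 *: (v - p)) p)%:E.
Proof.
move=> l0; have [K K0 HK] := theta_lower_bound.
pose q (x : Z) := (2 * l)^-1 * `|x - v| ^+ 2.
have l2 : 0 < (2 * l)^-1 by rewrite invr_gt0 mulr_gt0.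
have cq : continuous q.
  move=> x; apply: cvgM; first exact: cvg_cst.
  have h : `|y - v| @[y --> x] --> `|x - v|.
    by apply: cvg_norm; apply: cvgB; [exact: cvg_id|exact: cvg_cst].
  by rewrite [`|x - v| ^+ 2]expr2; apply: cvgM.
(* Beyond this radius the objective exceeds its value at the origin. *)
pose M := 2 * `|v| + 2 * l * K.
pose B := [set x : Z | `|x| <= M].
have cB : compact B := @compact_norm_le _ _ M.
have B0 : B 0 by rewrite /B/= normr0 addr_ge0 ?mulr_ge0// ltW.
have [p Bp pm] := lsc_compact_min cB (ex_intro _ 0 B0) (lscD ltheta cq).
have {}pm x : (theta p + (q p)%:E <= theta x + (q x)%:E)%E.
  have [xM|Mx] := leP `|x| M; first exact: pm.
  apply: le_trans (pm 0 B0) _; rewrite theta0 add0e.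
  have := HK x; have := theta_gtNy x.
  case: (theta x) => [r _|_ _|//]; last by rewrite addye// leey.
  rewrite -EFinD !lee_fin => rK; rewrite /q sub0r normrN.
  have nxv : `|x| ^+ 2 - 2 * (`|x| * `|v|) + `|v| ^+ 2 <= `|x - v| ^+ 2.
    rewrite -!dotp_norm !dotE (dotC v x) !dotp_norm.
    by have := dot_le_norm x v; lra.
  have h1 : 2 * l * K * `|x| <= `|x| ^+ 2 - 2 * (`|x| * `|v|).
    rewrite -subr_ge0.
    have -> : `|x| ^+ 2 - 2 * (`|x| * `|v|) - 2 * l * K * `|x| =
      `|x| * (`|x| - M) by rewrite /M; ring.
    by rewrite mulr_ge0// subr_ge0 ltW.
  have h2 : (2 * l)^-1 * (2 * l * K * `|x| + `|v| ^+ 2) <= q x.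
    by rewrite ler_wpM2l ?(ltW l2)//; lra.
  have E : (2 * l)^-1 * (2 * l * K * `|x| + `|v| ^+ 2) =
      K * `|x| + (2 * l)^-1 * `|v| ^+ 2 by field; rewrite gt_eqF.
  by move: h2; rewrite E /q; lra.
have [t tE] : exists t, theta p = t%:E.
  have := pm 0; rewrite theta0 add0e; have := theta_gtNy p.
  case: (theta p) => [t _ _|_|]; [by exists t| |by rewrite ltxx].
  by rewrite addye// leye_eq.
have qE x s : q (p + s *: x) =
    q p - s * dotp (l^-1 *: (v - p)) x + s ^+ 2 * ((2 * l)^-1 * `|x| ^+ 2).
  rewrite /q -!dotp_norm !dotE (dotC x p) (dotC x v) (dotC v p).
  by field; rewrite gt_eqF.
exists p; set z := l^-1 *: (v - p) in qE *.
have zmin : C z.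
  move=> x; have := theta_gtNy x; case E : (theta x) => [r| |]; [move=> _|by rewrite leey|by rewrite ltxx].
  rewrite lee_fin -subr_ge0.
  apply: (@ge0_of_scaled _ _ ((2 * l)^-1 * `|x| ^+ 2)) => s s0 _.
  have := pm (p + s *: x); rewrite tE qE.
  have := thetaD p (s *: x); rewrite thetaZ// E tE -EFinM -EFinD.
  have := theta_gtNy (p + s *: x).
  case: (theta (p + s *: x)) => [a _| |]; [|by rewrite leye_eq|by rewrite ltxx].
  rewrite -!EFinD !lee_fin => h1 h2.
  have : 0 <= s * (r - dotp z x + s * ((2 * l)^-1 * `|x| ^+ 2)) by lra.
  by rewrite pmulr_rge0//; lra.
split => //; apply/eqP; rewrite eq_le zmin andbT tE lee_fin -subr_ge0.
apply: (@ge0_of_scaled _ _ ((2 * l)^-1 * `|p| ^+ 2)) => s s0 s2.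
have := pm (p + (- s) *: p); rewrite qE tE.
have -> : p + - s *: p = (1 - s) *: p by rewrite scalerBl scale1r scaleNr.
rewrite thetaZ; last lra.
rewrite tE -EFinM -!EFinD lee_fin sqrrN => h.
have : 0 <= s * (dotp z p - t + s * ((2 * l)^-1 * `|p| ^+ 2)) by lra.
by rewrite pmulr_rge0//; lra.
Qed.

Lemma minorants_nonempty : C !=set0.
Proof.
by have [p [h _]] := proximal_minorant 0 ltr01; exists (1^-1 *: (0 - p)).
Qed.

(** The largest subspace contained in the set of admissible directions is the
    set of all of them. *)
Lemma minorants_direction : exists U : {vspace Z},
  [/\ forall z z', C z -> C z' -> z - z' \in U,
      forall v, v \in U -> par C v
    & forall x, (forall z z', C z -> C z' -> dotp x (z - z') = 0) ->
        forall v, v \in U -> dotp x v = 0].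
Proof.
have [z0 Cz0] := minorants_nonempty.
have affC z : C z -> aff C z by move=> Cz M [_ CM]; exact: CM.
have aff_line z z' t : aff C z -> aff C z' -> aff C ((1 - t) *: z + t *: z').
  move=> az az' M [Maff CM]; exact: Maff _ _ _ (az M (conj Maff CM)) (az' M (conj Maff CM)).
pose S v := aff C (z0 + v).
have SZ a v : S v -> S (a *: v).
  move=> Sv; have := aff_line _ _ a (affC _ Cz0) Sv; rewrite /S.
  by rewrite scalerDr addrA -scalerDl subrK scale1r.
have SD v w : S v -> S w -> S (v + w).
  move=> Sv Sw; have h := aff_line _ _ 2^-1 Sv Sw.
  have := aff_line _ _ 2 (affC _ Cz0) h; rewrite /S.
  rewrite [2 *: _]scalerDr !scalerA divff ?pnatr_eq0// scale1r.
  have -> : 2 * (1 - 2^-1) = 1 :> R by field.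
  rewrite scale1r => {h}; congr (aff C _).
  have -> : 1 - 2 = -1 :> R by ring.
  have -> : z0 + v + (z0 + w) = z0 + (z0 + (v + w)) by rewrite addrACA -addrA.
  by rewrite scaleN1r addKr.
have S0 : S 0 by rewrite /S addr0; exact: affC.
pose Q n := `[< exists U : {vspace Z}, \dim U = n /\ forall v, v \in U -> S v >].
have exQ : exists n, Q n.
  exists 0%N; apply/asboolP; exists 0%VS; split; first by rewrite dimv0.
  by move=> v; rewrite memv0 => /eqP ->.
have ubQ n : Q n -> (n <= \dim {:Z})%N.
  by move=> /asboolP[U [<- _]]; rewrite dimvS// subvf.
have [n /asboolP[U [dU US]] maxU] := ex_maxnP exQ ubQ.
have SU v : S v -> v \in U.
  move=> Sv; suff -> : U = (U + <[v]>)%VS.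
    by apply: (subvP (addvSr _ _)); rewrite memv_line.
  apply/eqP; rewrite eqEdim addvSl /= dU; apply: maxU; apply/asboolP.
  exists (U + <[v]>)%VS; split => // w /memv_addP[u uU [_ /vlineP[k ->] ->]].
  by apply: SD; [exact: US|exact: SZ].
have CU z : C z -> z - z0 \in U.
  by move=> Cz; apply: SU; rewrite /S addrC subrK; exact: affC.
exists U; split.
- move=> z z' Cz Cz'.
  have -> : z - z' = (z - z0) - (z' - z0) by rewrite opprB addrA subrK.
  by rewrite memvB// CU.
- move=> v vU; exists (z0 + v, z0) => /=; last by rewrite addrC addKr.
  by split => /=; [exact: US|exact: affC].
- move=> x xC v vU.
  have := US v vU [set z | dotp x (z - z0) = 0]; rewrite /= addrC addKr; apply.
  split; last by move=> z Cz /=; exact: xC.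
  move=> z z' t /= zx z'x.
  have -> : (1 - t) *: z + t *: z' - z0 = (1 - t) *: (z - z0) + t *: (z' - z0).
    rewrite !scalerBr addrACA -opprD -scalerDl subrK scale1r.
    by [].
  by rewrite dotDr !dotZr zx z'x !mulr0 addr0.
Qed.

Variable P : {linear Z -> Z}.
Hypotheses (Psym : forall x y, dotp (P x) y = dotp x (P y))
  (PP : forall x, P (P x) = P x)
  (Pdiff : forall z z', C z -> C z' -> P (z - z') = z - z')
  (Pker : forall x, (forall z z', C z -> C z' -> dotp x (z - z') = 0) -> P x = 0).

(** The proximal points of [v] with small parameter produce minorants [w] which
    agree with [z] on [v]; as these points tend to [v], lower semicontinuity
    forbids a jump of [theta] above [<z, v>]. *)
Lemma theta_le_orth z v : C z -> P v = 0 -> (theta v <= (dotp z v)%:E)%E.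
Proof.
move=> Cz Pv; rewrite leNgt; apply/negP => zv.
have [A vA HA] := ltheta zv.
have [r r0 rA] := (nbhs_normP v A).1 vA.
pose l := r / (2 * (`|z| + 1)).
have z1 : 0 < `|z| + 1 by rewrite ltr_wpDl.
have l0 : 0 < l by rewrite divr_gt0// mulr_gt0.
have [p [Cw pE]] := proximal_minorant v l0.
set w := l^-1 *: (v - p) in Cw pE.
have wE : w = l^-1 *: (v - p) by [].
clearbody w.
have wv : dotp w v = dotp z v.
  by apply/eqP; rewrite -subr_eq0 -dotBl -(Pdiff Cw Cz) Psym Pv dot0r.
have vp : v - p = l *: w by rewrite wE scalerA divff ?gt_eqF// scale1r.
have h1 : dotp z (v - p) = dotp w (v - p) + dotp (w - z) p by rewrite !dotE wv; ring.
have h2 : 0 <= dotp (w - z) p by rewrite dotBl subr_ge0 -lee_fin -pE; exact: Cz.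
have h3 : `|v - p| <= l * `|z|.
  have : dotp z (v - p) <= `|z| * `|v - p| by exact: dot_le_norm.
  have -> : dotp z (v - p) = l^-1 * `|v - p| ^+ 2 + dotp (w - z) p.
    by rewrite h1 {1}wE dotZl dotp_norm.
  move=> h; have : `|v - p| ^+ 2 <= l * `|z| * `|v - p|.
    by rewrite -mulrA -ler_pdivrMl//; lra.
  have [->|n0] := eqVneq `|v - p| 0; first by rewrite mulr_ge0// ltW.
  by rewrite expr2 ler_pM2r// lt_def n0 normr_ge0.
have Ap : A p.
  apply: rA; rewrite /= (le_lt_trans h3)// /l mulrAC ltr_pdivrMr ?mulr_gt0//.
  by rewrite ltr_pM2l//; lra.
have := HA p Ap; rewrite pE lte_fin ltNge => /negP; apply.
have : 0 <= dotp w (v - p) by rewrite vp dotZr mulr_ge0 ?dotp_norm ?sqr_ge0// ltW.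
by rewrite dotBr wv; lra.
Qed.

Lemma theta_orth z v : C z -> P v = 0 -> theta v = (dotp z v)%:E.
Proof. by move=> Cz Pv; apply/eqP; rewrite eq_le theta_le_orth//=; exact: Cz. Qed.

Lemma thetaD_orth z x v : C z -> P v = 0 ->
  theta (x + v)%R = (theta x + (dotp z v)%:E)%E.
Proof.
move=> Cz Pv; apply/eqP; rewrite eq_le -(theta_orth Cz Pv) thetaD /=.
have := thetaD (x + v) (- v); rewrite addrK => /(leeD2r (theta v)).
move=> /le_trans; apply.
have PNv : P (- v) = 0 by rewrite linearN Pv oppr0.
rewrite (theta_orth Cz Pv) (theta_orth Cz PNv) dotNr.
by rewrite -addeA -EFinD addNr adde0.
Qed.

Lemma thetaP z x : C z ->
  theta x = (theta (P x) + (dotp z (x - P x))%:E)%E.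
Proof.
move=> Cz; rewrite -(thetaD_orth _ Cz) ?[P x + _]addrC ?subrK//.
by rewrite linearB/= PP subrr.
Qed.

(** Points of the relative interior of the set of minorants, expressed on
    [theta]: the gap with the linear function is sharp along [U]. *)
Definition interior_minorant (z : Z) (e : R) : Prop :=
  0 < e /\ forall x, ((dotp z x + e * `|P x|)%:E <= theta x)%E.

Let compact_sphere : compact [set x : Z | P x = x /\ `|x| = 1].
Proof.
apply: (@compact_of_bounded _ _ _ 1); last by move=> x [_ ->].
have -> : [set x : Z | P x = x /\ `|x| = 1] =
    (fun x => P x - x) @^-1` [set 0] `&` (fun x => `|x|) @^-1` [set 1].
  apply/seteqP; split => x /= [h1 h2]; split => //; first by rewrite h1 subrr.
  by apply/eqP; rewrite -subr_eq0; apply/eqP.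
have closed1 (W : normedModType R) (w : W) : closed [set w].
  exact/accessible_closed_set1/hausdorff_accessible/norm_hausdorff.
apply: closedI; (apply: closed_comp; last exact: closed1) => x _.
  by apply: cvgB; [exact: linear_continuous_fd|exact: cvg_id].
exact: norm_continuous.
Qed.

(** A strict gap on the unit sphere of [U] is bounded below by compactness, and
    homogeneity together with [thetaP] spreads it to the whole space. *)
Lemma interior_of_strict z : C z ->
  (forall x, P x = x -> x != 0 -> ((dotp z x)%:E < theta x)%E) ->
  exists e, interior_minorant z e.
Proof.
move=> Cz pos.
have [K0|] := pselect (exists x : Z, P x = x /\ `|x| = 1); last first.
  move=> noK; exists 1; split => // x; have -> : P x = 0.
    apply/eqP/negPn/negP => Px0; apply: noK; exists (`|P x|^-1 *: P x).
    rewrite linearZ/= PP; split => //.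
    by rewrite normrZ ger0_norm ?invr_ge0// mulVf// normr_eq0.
  by rewrite normr0 mulr0 addr0; exact: Cz.
have cz : continuous (fun x => - dotp z x).
  by move=> x; apply: cvgN; exact: dot_continuous.
have [p [Pp p1] pm] := lsc_compact_min compact_sphere K0 (lscD ltheta cz).
have p0 : p != 0 by rewrite -normr_eq0 p1 oner_eq0.
have [e e0 ep] : exists2 e : R, 0 < e & ((dotp z p + e)%:E <= theta p)%E.
  have := pos p Pp p0; case: (theta p) => [t| |].
  - by rewrite lte_fin => zt; exists (t - dotp z p); rewrite ?subr_gt0// lee_fin; lra.
  - by exists 1 => //; rewrite leey.
  - by rewrite ltNge leNye.
have onS x : P x = x -> `|x| = 1 -> ((dotp z x + e)%:E <= theta x)%E.
  move=> Px x1; have := pm x (conj Px x1).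
  have := theta_gtNy x.
  case: (theta x) => [r _| |]; [|by move=> _ _; rewrite leey|by rewrite ltxx].
  case: (theta p) ep => [t| |]; [by rewrite -!EFinD !lee_fin; lra| |by []].
  by move=> _; rewrite addye// leye_eq.
exists e; split => // x; rewrite (thetaP x Cz).
have [Px0|Px0] := eqVneq (P x) 0.
  by rewrite Px0 normr0 mulr0 theta0 add0e addr0 subr0.
have n0 : 0 < `|P x| by rewrite normr_gt0.
have := onS (`|P x|^-1 *: P x).
rewrite linearZ/= PP => /(_ erefl).
rewrite normrZ ger0_norm ?invr_ge0// mulVf ?gt_eqF// => /(_ erefl).
rewrite thetaZ ?invr_gt0//; case: (theta (P x)) => [t| |].
- rewrite -EFinM -EFinD !lee_fin dotZr => h.
  have : `|P x| * (`|P x|^-1 * dotp z (P x) + e) <= `|P x| * (`|P x|^-1 * t).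
    by rewrite ler_wpM2l.
  by rewrite mulrDr !mulrA divff ?gt_eqF// !mul1r dotBr; lra.
- by move=> _; rewrite addye// leey.
- by rewrite mulrNy gtr0_sg ?invr_gt0// mul1e.
Qed.

Lemma interior_minorantW z e : interior_minorant z e -> C z.
Proof.
move=> [e0 h] x; apply: le_trans (h x); rewrite lee_fin lerDl.
by rewrite mulr_ge0// ltW.
Qed.

(** The sets where a minorant [z] is exact on the unit sphere of [U] decrease
    when minorants are averaged, so if all were nonempty a common point would
    be a direction in [U] orthogonal to [U]. *)
Lemma interior_minorant_exists : exists z e, interior_minorant z e.
Proof.
have cz (z : Z) : continuous (fun x => - dotp z x).
  by move=> x; apply: cvgN; exact: dot_continuous.
pose N z := [set x : Z | (theta x + (- dotp z x)%:E <= 0)%E].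
have NE z x : N z x -> (theta x <= (dotp z x)%:E)%E.
  by rewrite /N/= EFinN sube_le0.
have [H|/existsNP[z /not_implyP[Cz zN]]] :=
    pselect (forall z, C z -> [set x : Z | P x = x /\ `|x| = 1] `&` N z !=set0).
  have [||x [Px x1] xN] :=
      @compact_directed _ _ _ C N compact_sphere minorants_nonempty _ _ H.
  - by move=> z _; exact: (@lsc_sublevel_closed _ _ _ 0%E (lscD ltheta (cz z))).
  - move=> z z' Cz Cz'; exists (2^-1 *: (z + z')).
      move=> x; rewrite dotZl dotDl; have := Cz x; have := Cz' x.
      by case: (theta x) => [t| |]; rewrite ?leey// !lee_fin; lra.
    move=> x /NE; rewrite /N /= dotZl dotDl; have := Cz x; have := Cz' x.
    case: (theta x) => [t| |]; [|by rewrite leye_eq|by []].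
    by rewrite -!EFinD !lee_fin => ? ? ?; split; lra.
  - exfalso.
    have xorth z z' : C z -> C z' -> dotp x (z - z') = 0.
      move=> Cz Cz'; rewrite dotBr ![dotp x _]dotC.
      have := le_trans (Cz x) (NE _ _ (xN _ Cz')).
      have := le_trans (Cz' x) (NE _ _ (xN _ Cz)).
      by rewrite !lee_fin; lra.
    by move: x1; rewrite -Px (Pker xorth) normr0 => /eqP; rewrite eq_sym oner_eq0.
exists z; apply: interior_of_strict => // x Px x0; rewrite ltNge; apply/negP => h.
apply: zN; exists (`|x|^-1 *: x).
have n0 : 0 < `|x| by rewrite normr_gt0.
split; first by rewrite /= linearZ/= Px normrZ ger0_norm ?invr_ge0// mulVf ?gt_eqF.
rewrite /N /= EFinN sube_le0 thetaZ ?invr_gt0// dotZr EFinM.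
by rewrite lee_pmul2l ?lte_fin ?invr_gt0.
Qed.

End Sublinear.

(** * Tangents and normals of epigraphs *)

Section Filters.
Context {R : realType}.

Lemma at_right0P (A : set R) :
  (0 : R)^'+ A <-> exists2 d : R, 0 < d & forall t, 0 < t -> t < d -> A t.
Proof.
split.
  rewrite /at_right /within /= => /nbhs_normP[d /= d0 dA].
  by exists d => // t t0 td; apply: dA => //=; rewrite sub0r normrN gtr0_norm.
move=> [d d0 dA]; rewrite /at_right /within /=; apply/nbhs_normP; exists d => //=.
move=> t /=; rewrite sub0r normrN => td t0; apply: dA => //.
by rewrite (le_lt_trans (ler_norm t)).
Qed.

Lemma nbhs_pairP (X1 X2 : normedModType R) (x1 : X1) (x2 : X2) (A : set (X1 * X2)) :
  nbhs (x1, x2) A <-> exists2 d : R, 0 < d &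
    forall y1 y2, `|y1 - x1| < d -> `|y2 - x2| < d -> A (y1, y2).
Proof.
split.
  move=> [[B1 B2] /= [/nbhs_normP[d1 /= d10 h1] /nbhs_normP[d2 /= d20 h2]] BA].
  exists (Num.min d1 d2); first by rewrite lt_min d10.
  move=> y1 y2; rewrite !lt_min => /andP[a1 _] /andP[_ a2].
  by apply: BA; split => /=; [apply: h1|apply: h2]; rewrite /= distrC.
move=> [d d0 dA].
exists ([set y | `|y - x1| < d], [set y | `|y - x2| < d]) => /=.
  by split; apply/nbhs_normP; exists d => //= y /=; rewrite distrC.
by move=> [y1 y2] /= [h1 h2]; exact: dA.
Qed.

End Filters.

Section FirstOrder.
Context {R : realType} {Y : finHilbertType R}.
Variable f : Y -> \bar R.

Lemma tangent_dirP (x w : Y) (a b : R) :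
  tangent_cone (epi f) (x, a) (w, b) <->
  forall e : R, 0 < e -> exists t x' a', [/\ 0 < t, t < e, (f x' <= a'%:E)%E,
    `|t^-1 *: (x' - x) - w| < e & `|t^-1 * (a' - a) - b| < e].
Proof.
split.
  move=> T e e0.
  have V : nbhs (w, b) [set q : Y * R | `|q.1 - w| < e /\ `|q.2 - b| < e].
    by apply/nbhs_pairP; exists e.
  have A : (0 : R)^'+ [set t | 0 < t /\ t < e] by apply/at_right0P; exists e.
  have [t [t0 te] [q [[[x' a'] /= fx' <-] /= [h1 h2]]]] := T _ V _ A.
  by exists t, x', a'.
move=> H V /nbhs_pairP[d d0 dV] A /at_right0P[r r0 rA].
have [|t [x' [a' [t0 te fx' h1 h2]]]] := H (Num.min d r).
  by rewrite lt_min d0.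
move: te h1 h2; rewrite !lt_min => /andP[td tr] /andP[h1 _] /andP[h2 _].
exists t; first exact: rA.
exists (t^-1 *: (x' - x), t^-1 * (a' - a)); split; last exact: dV.
by exists (x', a').
Qed.

(** A first order minorisation makes the downward normal direction regular. *)
Lemma subdiff_of_growth (x v : Y) (a : R) : f x = a%:E ->
  (forall e : R, 0 < e -> exists2 d : R, 0 < d & forall u, `|u - x| < d ->
     ((a + dotp v (u - x) - e * `|u - x|)%:E <= f u)%E) ->
  subdiff f x v.
Proof.
move=> fx grow; split; first by rewrite fx.
exists (fun=> (x, a)), (fun=> (v, -1)); rewrite fx /=.
split; [move=> _|exact: cvg_cst|exact: cvg_cst].
split; first by rewrite /epi/= fx.
move=> [w b] /tangent_dirP T; rewrite /dotpR /= mulN1r subr_le0 -subr_ge0.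
apply: (@ge0_of_scaled _ _ (`|v| + `|w| + 2)) => s s0 s2.
have [d d0 dP] := grow s s0.
have w1 : 0 < `|w| + 1 by rewrite ltr_wpDl.
have [|t [x' [a' [t0 te fx' h1 h2]]]] := T (Num.min s (d / (`|w| + 1))).
  by rewrite lt_min s0 divr_gt0.
move: te h1 h2; rewrite !lt_min => /andP[ts td] /andP[h1 _] /andP[h2 _].
set q := t^-1 *: (x' - x) in h1.
have x'E : x' - x = t *: q by rewrite scalerA divff ?gt_eqF// scale1r.
have qw : `|q| <= `|w| + 1.
  have := ler_normD (q - w) w; rewrite subrK; lra.
have x'd : `|x' - x| < d.
  rewrite x'E normrZ gtr0_norm// (le_lt_trans (ler_wpM2l (ltW t0) qw))//.
  by rewrite -ltr_pdivlMr.
have := le_trans (dP x' x'd) fx'; rewrite lee_fin x'E normrZ gtr0_norm// dotZr.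
set b' := t^-1 * (a' - a) in h2.
have a'E : a' = a + t * b' by rewrite /b' mulrA divff ?gt_eqF// mul1r addrC subrK.
rewrite a'E => h3.
have h4 : dotp v q - s * `|q| <= b'.
  by rewrite -(ler_pM2l t0); nra.
have h5 : dotp v w - `|v| * s <= dotp v q.
  have -> : dotp v q = dotp v w + dotp v (q - w) by rewrite dotBr; ring.
  have := dot_ge_norm v (q - w).
  have : `|v| * `|q - w| <= `|v| * s by rewrite ler_wpM2l// ltW.
  lra.
have h6 : s * `|q| <= s * (`|w| + 1) by rewrite ler_wpM2l// ltW.
have h7 : b' <= b + s by move: h2; rewrite ltr_norml => /andP[]; lra.
lra.
Qed.

(** Above the graph the vertical direction [(0, -1)] is tangent, which excludes
    downward normals. *)
Lemma regular_normal_graph (x v : Y) (a b : R) :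
  epi f (x, a) -> regular_normal_cone (@dotpR R Y) (epi f) (x, a) (v, b) ->
  b < 0 -> f x = a%:E.
Proof.
rewrite /epi /= => fxa N b0; apply/eqP; rewrite eq_le fxa /= leNgt.
apply/negP => fa.
have [a1 fa1 aa1] : exists2 a1 : R, (f x <= a1%:E)%E & a1 < a.
  case: (f x) fa => [r|//|_]; first by rewrite lte_fin; exists r.
  by exists (a - 1); rewrite ?leNye// ltrBlDr ltrDl.
have : tangent_cone (epi f) (x, a) (0, -1).
  apply/tangent_dirP => e e0; pose t := Num.min (e / 2) (a - a1).
  have t0 : 0 < t by rewrite lt_min divr_gt0//= subr_gt0.
  exists t, x, (a - t); split => //.
  - by rewrite (@le_lt_trans _ _ (e / 2)) ?ge_min ?lexx// ltr_pdivrMr//; lra.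
  - rewrite (le_trans fa1)// lee_fin.
    have : t <= a - a1 by rewrite ge_min lexx orbT.
    lra.
  - by rewrite subrr scaler0 subrr normr0.
  - have -> : a - t - a = - t by ring.
    by rewrite mulrN mulVf ?gt_eqF// subrr normr0.
by move=> /N; rewrite /dotpR /= dot0r; lra.
Qed.

End FirstOrder.

(** A composite representation of [g] together with the orthogonal projection
    [P] onto the subspace parallel to the minorants of [theta]; the last two
    fields characterise its range. *)
Record framed_decomposition (R : realType) (Y Z : finHilbertType R)
    (g : Y -> \bar R) (O : set Y) (theta : Z -> \bar R) (Xi : Y -> Z)
    (P : {linear Z -> Z}) (c : R) : Prop := {
  fd_open : open O;
  fd_smooth : smooth_on 2 O Xi;
  fd_g : forall u, O u -> g u = (c%:E + theta (Xi u))%E;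
  fd_proper : proper_fun theta;
  fd_lsc : lower_semicontinuous theta;
  fd_sublinear : sublinear theta;
  fd_Psym : forall x y, dotp (P x) y = dotp x (P y);
  fd_PP : forall x, P (P x) = P x;
  fd_Pdiff : forall z z', minorants theta z -> minorants theta z' ->
    P (z - z') = z - z';
  fd_Pker : forall x, (forall z z', minorants theta z -> minorants theta z' ->
    dotp x (z - z') = 0) -> P x = 0
}.

Section FramedTheta.
Context {R : realType} {Y Z : finHilbertType R}.
Variables (g : Y -> \bar R) (O : set Y) (theta : Z -> \bar R) (Xi : Y -> Z).
Variables (P : {linear Z -> Z}) (c : R).
Hypothesis fd : framed_decomposition g O theta Xi P c.

Lemma fd_minorants : minorants theta !=set0.
Proof. by case: fd => *; exact: minorants_nonempty. Qed.

Lemma fd_orth z x v : minorants theta z -> P v = 0 ->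
  theta (x + v) = (theta x + (dotp z v)%:E)%E.
Proof. by case: fd => *; exact: thetaD_orth. Qed.

Lemma fd_interior : exists z e, interior_minorant theta P z e.
Proof. by case: fd => *; exact: interior_minorant_exists. Qed.

Lemma fd_strict z : minorants theta z ->
  (forall x, P x = x -> x != 0 -> ((dotp z x)%:E < theta x)%E) ->
  exists e, interior_minorant theta P z e.
Proof. by case: fd => *; exact: interior_of_strict. Qed.

End FramedTheta.

(** The map [P \o Xi] is a submersion at [u]. *)
Definition regular_at (R : realType) (Y Z : finHilbertType R) (O : set Y)
    (Xi : Y -> Z) (P : {linear Z -> Z}) (u : Y) : Prop :=
  O u /\ forall z, exists w, P ('d Xi u w) = P z.

Section RegularPoints.
Context {R : realType} {Y Z : finHilbertType R}.
Variables (g : Y -> \bar R) (O : set Y) (theta : Z -> \bar R) (Xi : Y -> Z).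
Variables (P : {linear Z -> Z}) (c : R).
Hypothesis fd : framed_decomposition g O theta Xi P c.

Local Notation C := (minorants theta).
Local Notation D u := ('d Xi u).

Lemma normP x : `|P x| <= `|x|.
Proof.
have [->|Px0] := eqVneq (P x) 0; first by rewrite normr0.
rewrite -(@ler_pM2r _ `|P x|) ?normr_gt0// -expr2 -dotp_norm (fd_Psym fd) (fd_PP fd).
exact: dot_le_norm.
Qed.

Lemma regular_section u : regular_at O Xi P u -> exists B : {linear Z -> Y},
  (forall z, P (D u (B z)) = P z) /\ exists2 K : R, 0 <= K & forall z, `|B z| <= K * `|z|.
Proof.
move=> [_ surj].
have flin : linear (fun w => P (D u w)) by move=> a x y; rewrite !linearP.
pose f : {linear Y -> Z} := HB.pack (fun w => P (D u w))
  (GRing.isLinear.Build _ _ _ _ _ flin).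
have [B HB] := linear_section f.
have BPlin : linear (fun z => B (P z)) by move=> a x y; rewrite !linearP.
pose BP : {linear Z -> Y} := HB.pack (fun z => B (P z))
  (GRing.isLinear.Build _ _ _ _ _ BPlin).
exists BP; split; last exact: (linear_bounded BPlin).
by move=> z /=; apply: (HB (P z)); exact: surj.
Qed.

(** Solvability of [P (Xi u') = P xi] near a regular point, at a distance
    controlled by the residual, uniformly in the starting point. *)
Lemma regular_solve u0 : regular_at O Xi P u0 -> exists K r : R,
  [/\ 0 <= K, 0 < r & forall u xi, `|u - u0| < r -> `|P (xi - Xi u)| < r ->
    exists2 d : Y, `|d| <= K * `|P (xi - Xi u)| & P (Xi (u + d)) = P xi].
Proof.
move=> reg; have [B [PDB [KB KB0 BK]]] := regular_section reg.
have [K [r [K0 r0 HK]]] := C2_bounds (fd_open fd) (fd_smooth fd) reg.1.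
pose r1 := Num.min r (6 * (K * KB + 1))^-1.
have KK : 0 < K * KB + 1 by rewrite ltr_wpDl// mulr_ge0.
have r10 : 0 < r1 by rewrite lt_min r0 invr_gt0 mulr_gt0.
have r1r : r1 <= r by rewrite ge_min lexx.
have r1K : 6 * (K * KB) * r1 <= 1.
  apply: (@le_trans _ _ (6 * (K * KB + 1) * r1)); first by rewrite ler_wpM2r//; lra.
  by rewrite mulrC -ler_pdivlMr ?mulr_gt0// mul1r ge_min lexx orbT.
pose rho := r1 / (2 * (KB + 1)).
have rho0 : 0 < rho by rewrite divr_gt0// mulr_gt0// ltr_wpDl.
have rhoK : KB * rho < r1 / 2.
  rewrite /rho; have -> : r1 / 2 = (KB + 1) * (r1 / (2 * (KB + 1))) by field; rewrite gt_eqF// ltr_wpDl.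
  by rewrite ltr_pM2r//; lra.
exists (2 * KB), (Num.min (r1 / 2) (rho / 4)); split.
- by rewrite mulr_ge0.
- by rewrite lt_min; apply/andP; split; apply: divr_gt0.
move=> u xi; rewrite !lt_min => /andP[ur _] /andP[_ xir].
(* [B] inverts the derivative of [P \o Xi] on the range of [P]; adding the
   complementary part turns the equation into a perturbation of the identity. *)
pose G eta := P (Xi (u + B eta) - Xi u) + (eta - P eta).
have G0 : G 0 = 0.
  by rewrite /G (linear0 B) addr0 subrr !(linear0 P) subr0 addr0.
have close eta : `|eta| <= rho -> `|u + B eta - u0| < r1.
  move=> he; rewrite addrAC (le_lt_trans (ler_normD _ _))//.
  have : `|B eta| <= KB * rho by rewrite (le_trans (BK _))// ler_wpM2l.
  lra.
have uu : `|u0 - u0| < r by rewrite subrr normr0.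
have Glip a b : `|a| <= rho -> `|b| <= rho ->
    `|G a - G b - (a - b)| <= 2^-1 * `|a - b|.
  move=> /close; set v := u + B a => hv /close; set v' := u + B b => hv'.
  have vE : v - v' = B (a - b) by rewrite linearB opprD addrACA subrr add0r.
  have [_ _ _ T2 _] := HK v v' (lt_le_trans hv r1r) (lt_le_trans hv' r1r).
  have [_ _ /(_ (v - v')) T1 _ _] := HK v' u0 (lt_le_trans hv' r1r) uu.
  have -> : G a - G b - (a - b) = P (Xi v - Xi v' - D u0 (v - v')).
    rewrite [RHS]linearB/= vE PDB /G -/v -/v'.
    by apply: dot_inj => z; rewrite !linearB/= !dotE; ring.
  rewrite (le_trans (normP _))//.
  have -> : Xi v - Xi v' - D u0 (v - v') =
      (Xi v - Xi v' - D v' (v - v')) + (D v' (v - v') - D u0 (v - v')).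
    by rewrite addrA subrK.
  rewrite (le_trans (ler_normD _ _))// (le_trans (lerD T2 T1))//.
  have vv : `|v - v'| <= 2 * r1.
    have := ler_normD (v - u0) (u0 - v'); rewrite addrA subrK (distrC u0); lra.
  have -> : K * `|v - v'| ^+ 2 + K * `|v' - u0| * `|v - v'| =
      K * `|v - v'| * (`|v - v'| + `|v' - u0|) by ring.
  apply: (@le_trans _ _ (K * `|v - v'| * (3 * r1))).
    by rewrite ler_wpM2l ?mulr_ge0//; lra.
  apply: (@le_trans _ _ (K * (KB * `|a - b|) * (3 * r1))).
    by rewrite ler_wpM2r ?mulr_ge0 ?(ltW r10)// ler_wpM2l// vE BK.
  have -> : K * (KB * `|a - b|) * (3 * r1) =
      2^-1 * (6 * (K * KB) * r1) * `|a - b| by field.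
  by rewrite ler_wpM2r//; lra.
have res : 4 * `|P (xi - Xi u) - G 0| < rho by rewrite G0 subr0; lra.
have [eta] := perturbed_identity_solve Glip res.
rewrite G0 subr0 => eta_le Geta; exists (B eta).
  by rewrite (le_trans (BK _))// [2 * KB]mulrC -mulrA ler_wpM2l.
have := congr1 P Geta; rewrite /G linearD (linearB P eta)/= !(fd_PP fd) subrr addr0.
by rewrite !linearB/= => /addIr.
Qed.

(** The same correction for the derivatives at neighbouring points, with a
    uniform bound; in particular regularity is an open condition. *)
Lemma regular_solve_linear u0 : regular_at O Xi P u0 -> exists K r : R,
  [/\ 0 <= K, 0 < r & forall u z, `|u - u0| < r ->
    exists2 d : Y, `|d| <= K * `|P z| & P (D u d) = P z].
Proof.
move=> reg; have [B [PDB [KB KB0 BK]]] := regular_section reg.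
have [K [r [K0 r0 HK]]] := C2_bounds (fd_open fd) (fd_smooth fd) reg.1.
have KK : 0 < 2 * (K * KB + 1) by rewrite mulr_gt0// ltr_wpDl// mulr_ge0.
exists (2 * KB), (Num.min r (2 * (K * KB + 1))^-1); split.
- by rewrite mulr_ge0.
- by rewrite lt_min r0 invr_gt0.
move=> u z; rewrite lt_min => /andP[ur uK].
have {}uK : K * KB * `|u - u0| <= 2^-1.
  have : (2 * (K * KB + 1)) * `|u - u0| <= 1.
    by rewrite mulrC -ler_pdivlMr// mul1r ltW.
  by have := normr_ge0 (u - u0); nra.
have uu : `|u0 - u0| < r by rewrite subrr normr0.
pose G eta := P (D u (B eta)) + (eta - P eta).
have G0 : G 0 = 0 by rewrite /G (linear0 B) !linear0 ?subr0 !addr0.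
have Glip a b : `|a| <= 4 * `|P z| + 1 -> `|b| <= 4 * `|P z| + 1 ->
    `|G a - G b - (a - b)| <= 2^-1 * `|a - b|.
  move=> _ _; have [_ _ /(_ (B (a - b))) T1 _ _] := HK u u0 ur uu.
  have -> : G a - G b - (a - b) = P (D u (B (a - b)) - D u0 (B (a - b))).
    rewrite [RHS]linearB/= PDB /G.
    by apply: dot_inj => x; rewrite !linearB/= !dotE; ring.
  rewrite (le_trans (normP _))// (le_trans T1)//.
  apply: (@le_trans _ _ (K * `|u - u0| * (KB * `|a - b|))).
    by rewrite ler_wpM2l ?mulr_ge0.
  have -> : K * `|u - u0| * (KB * `|a - b|) = K * KB * `|u - u0| * `|a - b| by ring.
  by rewrite ler_wpM2r.
have res : 4 * `|P z - G 0| < 4 * `|P z| + 1 by rewrite G0 subr0; lra.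
have [eta] := perturbed_identity_solve Glip res.
rewrite G0 subr0 => eta_le Geta; exists (B eta).
  by rewrite (le_trans (BK _))// [2 * KB]mulrC -mulrA ler_wpM2l.
have := congr1 P Geta; rewrite /G linearD (linearB P eta)/= !(fd_PP fd).
by rewrite subrr addr0.
Qed.

Lemma regular_near u0 : regular_at O Xi P u0 ->
  \forall u \near u0, regular_at O Xi P u.
Proof.
move=> reg; have [K [r [_ r0 HK]]] := regular_solve_linear reg.
near=> u; split; first by near: u; exact: open_nbhs_nbhs (conj (fd_open fd) reg.1).
move=> z; have [|d _ hd] := HK u z; last by exists d.
near: u; apply/nbhs_normP; exists r => //= u /=.
by rewrite distrC.
Unshelve. all: by end_near. Qed.

End RegularPoints.

(** * Chain rule for the subdifferential *)
Section TangentCurves.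
Context {R : realType} {Y Z : finHilbertType R}.
Variables (g : Y -> \bar R) (O : set Y) (theta : Z -> \bar R) (Xi : Y -> Z).
Variables (P : {linear Z -> Z}) (c : R).
Hypothesis fd : framed_decomposition g O theta Xi P c.

Local Notation C := (minorants theta).
Local Notation D u := ('d Xi u).

Lemma dot_adj u z w : dotp (adjoint (D u) z) w = dotp z (D u w).
Proof. exact: adjointP. Qed.

(** A minorant of [theta] exact at [Xi u] minorises [g] to first order at
    [u]. *)
Lemma subdiff_of_minorant u z t : O u -> C z ->
  theta (Xi u) = t%:E -> dotp z (Xi u) = t ->
  subdiff g u (adjoint (D u) z).
Proof.
move=> Ou Cz tE zt; apply: (@subdiff_of_growth _ _ _ _ _ (c + t)).
  by rewrite (fd_g fd)// tE.
move=> e e0; have [K [r [K0 r0 HK]]] := C2_bounds (fd_open fd) (fd_smooth fd) Ou.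
have uu : `|u - u| < r by rewrite subrr normr0.
have zK : 0 < `|z| * K + 1 by rewrite ltr_wpDl// mulr_ge0.
exists (Num.min r (e / (`|z| * K + 1))); first by rewrite lt_min r0 divr_gt0.
move=> v; rewrite lt_min ltr_pdivlMr// => /andP[vr ve].
have [Ov _ _ T _] := HK v u vr uu.
rewrite (fd_g fd)//.
apply: le_trans (leeD2l c%:E (Cz (Xi v))); rewrite lee_fin -zt dot_adj.
have := dot_ge_norm z (Xi v - Xi u - D u (v - u)); rewrite !dotBr.
have : `|z| * `|Xi v - Xi u - D u (v - u)| <= `|z| * (K * `|v - u| ^+ 2).
  by rewrite ler_wpM2l.
have : `|z| * (K * `|v - u| ^+ 2) <= e * `|v - u|.
  have -> : `|z| * (K * `|v - u| ^+ 2) = (`|v - u| * (`|z| * K)) * `|v - u| by ring.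
  by rewrite ler_wpM2r//; have := normr_ge0 (v - u); lra.
lra.
Qed.

(** Feasible curves issued from [u] in the direction [w], obtained by correcting
    the straight line so that the [U]-component of [Xi] moves linearly towards
    that of [x]. *)
Lemma tangent_curve u w x t r z0 : regular_at O Xi P u -> C z0 ->
  theta (Xi u) = t%:E -> theta x = r%:E -> P (D u w) = P (x - Xi u) ->
  tangent_cone (epi g) (u, c + t) (w, r - t + dotp z0 (D u w - (x - Xi u))).
Proof.
move=> reg Cz0 tE rE Pw; apply/tangent_dirP => e e0.
have [K [rK [K0 rK0 HK]]] := C2_bounds (fd_open fd) (fd_smooth fd) reg.1.
have [L [rL [L0 rL0 HL]]] := regular_solve fd reg.
have uu : `|u - u| < rK by rewrite subrr normr0.
have w2 := sqr_ge0 `|w|.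
have Kw : 0 <= K * `|w| ^+ 2 by rewrite mulr_ge0.
pose M := L * (K * `|w| ^+ 2).
have M0 : 0 <= M by rewrite mulr_ge0.
pose N := K * (`|w| + M) ^+ 2 + K * M.
have wM0 : 0 <= `|w| + M by rewrite addr_ge0.
have N0 : 0 <= N by rewrite addr_ge0// mulr_ge0// sqr_ge0.
have p1 : 0 < `|w| + M + 1 by rewrite ltr_wpDl.
have p2 : 0 < `|w| + K * `|w| ^+ 2 + 1 by rewrite ltr_wpDl// addr_ge0.
have p3 : 0 < M + 1 by rewrite ltr_wpDl.
have p4 : 0 < `|z0| * N + 1 by rewrite ltr_wpDl// mulr_ge0.
near (0 : R)^'+ => s.
have s0 : 0 < s by [].
have s1' : s < 1 by near: s; apply: nbhs_right_lt.
have s1 := ltW s1'.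
have se : s < e by near: s; apply: nbhs_right_lt.
have swK : s * (`|w| + M + 1) < rK.
  by rewrite -ltr_pdivlMr//; near: s; apply: nbhs_right_lt; rewrite divr_gt0.
have swL : s * (`|w| + K * `|w| ^+ 2 + 1) < rL.
  by rewrite -ltr_pdivlMr//; near: s; apply: nbhs_right_lt; rewrite divr_gt0.
have sM : s * (M + 1) < e.
  by rewrite -ltr_pdivlMr//; near: s; apply: nbhs_right_lt; rewrite divr_gt0.
have sN : s * (`|z0| * N + 1) < e.
  by rewrite -ltr_pdivlMr//; near: s; apply: nbhs_right_lt; rewrite divr_gt0.
pose xi := Xi u + s *: (x - Xi u).
have nsw : `|u + s *: w - u| = s * `|w| by rewrite addrC addKr normrZ gtr0_norm.
have s2 : s ^+ 2 <= s by rewrite expr2 ler_piMr// ltW.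
have nw := normr_ge0 w.
have swrK : `|u + s *: w - u| < rK by rewrite nsw; nra.
have res : `|P (xi - Xi (u + s *: w))| <= s ^+ 2 * (K * `|w| ^+ 2).
  have [_ _ _ T _] := HK (u + s *: w) u swrK uu.
  have -> : P (xi - Xi (u + s *: w)) =
      - P (Xi (u + s *: w) - Xi u - D u (u + s *: w - u)).
    rewrite [u + _ - u]addrC addKr linearZ/= !linearB/= linearZ/= Pw /xi.
    rewrite linearD linearZ/= !linearB/=.
    by apply: dot_inj => y; rewrite !dotE; ring.
  rewrite normrN (le_trans (normP fd _))// (le_trans T)// nsw.
  by rewrite le_eqVlt; apply/orP; left; apply/eqP; ring.
have [||d dle Pd] := HL (u + s *: w) xi.
- by rewrite nsw; nra.
- by apply: le_lt_trans res _; nra.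
have {}dle : `|d| <= s ^+ 2 * M.
  apply: le_trans dle _; apply: le_trans (ler_wpM2l L0 res) _.
  by rewrite le_eqVlt; apply/orP; left; apply/eqP; rewrite /M; ring.
have dsM : `|d| <= s * M by apply: le_trans dle _; rewrite ler_wpM2r.
pose u' := u + s *: w + d.
have u'u : u' - u = s *: w + d by rewrite /u' -(addrA u) [LHS]addrC addKr.
have nu' : `|u' - u| <= s * (`|w| + M).
  by rewrite u'u (le_trans (ler_normD _ _))// normrZ gtr0_norm// mulrDr lerD.
have u'rK : `|u' - u| < rK by apply: le_lt_trans nu' _; nra.
have [Ou' _ _ T _] := HK u' u u'rK uu.
have [_ /(_ d) Td _ _ _] := HK u u uu uu.
pose al := (1 - s) * t + s * r + dotp z0 (Xi u' - xi).
exists s, u', (c + al); split => //.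
- rewrite (fd_g fd)// EFinD leeD2l//.
  have -> : Xi u' = xi + (Xi u' - xi) by rewrite addrC subrK.
  rewrite (fd_orth fd _ Cz0); last by rewrite linearB/= -/u' in Pd *; rewrite Pd subrr.
  rewrite /al EFinD leeD2r//.
  have -> : xi = (1 - s) *: Xi u + s *: x.
    by apply: dot_inj => y; rewrite /xi !dotE; ring.
  apply: le_trans (thetaD (fd_sublinear fd) _ _) _.
  by rewrite !(thetaZ (fd_sublinear fd)) ?subr_gt0// tE rE -!EFinM -EFinD.
- rewrite u'u scalerDr scalerA mulVf ?gt_eqF// scale1r addrAC subrr add0r.
  rewrite normrZ gtr0_norm ?invr_gt0// mulrC ltr_pdivrMr//.
  by apply: le_lt_trans dle _; nra.
- have -> : s^-1 * (c + al - (c + t)) - (r - t + dotp z0 (D u w - (x - Xi u))) =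
      s^-1 * dotp z0 (Xi u' - Xi u - D u (u' - u) + D u d).
    have -> : D u (u' - u) = s *: D u w + D u d by rewrite u'u linearD linearZ.
    rewrite /al /xi !dotE.
    by field; rewrite gt_eqF.
  rewrite normrM gtr0_norm ?invr_gt0// mulrC ltr_pdivrMr//.
  apply: le_lt_trans (normr_dot _ _) _.
  have h : `|Xi u' - Xi u - D u (u' - u) + D u d| <= s ^+ 2 * N.
    rewrite (le_trans (ler_normD _ _))//.
    have -> : s ^+ 2 * N = K * (s * (`|w| + M)) ^+ 2 + K * (s ^+ 2 * M).
      by rewrite /N; ring.
    apply: lerD; last by apply: le_trans Td _; rewrite ler_wpM2l.
    by apply: le_trans T _; rewrite ler_wpM2l// lerXn2r ?nnegrE// mulr_ge0// ?addr_ge0// ltW.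
  apply: le_lt_trans (ler_wpM2l (normr_ge0 z0) h) _.
  have zN : 0 <= `|z0| * N by rewrite mulr_ge0.
  have -> : `|z0| * (s ^+ 2 * N) = s * (s * (`|z0| * N)) by ring.
  by rewrite mulrC ltr_pM2r//; lra.
Unshelve. all: by end_near. Qed.

End TangentCurves.

Lemma cvg_of_dist (R : realType) (V : normedModType R) (a : nat -> V) (l : V)
    (b : nat -> R) : (\forall k \near \oo, `|a k - l| <= b k) ->
  b k @[k --> \oo] --> (0 : R) -> a k @[k --> \oo] --> l.
Proof.
move=> ab b0; apply/cvgrPdist_lt => e e0; near=> k; rewrite distrC.
apply: (@le_lt_trans _ _ (b k)); first by near: k.
rewrite (le_lt_trans (ler_norm _))// -[b k]opprK normrN -[- b k]sub0r.
by near: k; apply: cvgr_dist_lt.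
Unshelve. all: by end_near. Qed.

Section ChainRule.
Context {R : realType} {Y Z : finHilbertType R}.
Variables (g : Y -> \bar R) (O : set Y) (theta : Z -> \bar R) (Xi : Y -> Z).
Variables (P : {linear Z -> Z}) (c : R).
Hypothesis fd : framed_decomposition g O theta Xi P c.

Local Notation C := (minorants theta).
Local Notation D u := ('d Xi u).

Lemma cvg_differential (u w : Y) (us ws : nat -> Y) : O u ->
  us k @[k --> \oo] --> u -> ws k @[k --> \oo] --> w ->
  D (us k) (ws k) @[k --> \oo] --> (D u w : Z).
Proof.
move=> Ou usu wsw.
have [K [r [K0 r0 HK]]] := C2_bounds (fd_open fd) (fd_smooth fd) Ou.
have uu : `|u - u| < r by rewrite subrr normr0.
apply: (@cvg_of_dist _ _ _ _
    (fun k => K * `|us k - u| * `|ws k| + K * `|ws k - w|)).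
  near=> k; have ur : `|us k - u| < r.
    by rewrite distrC; near: k; apply: cvgr_dist_lt.
  have [_ _ /(_ (ws k)) T1 _ _] := HK _ _ ur uu.
  have [_ /(_ (ws k - w)) T2 _ _ _] := HK _ _ uu uu.
  have -> : (D (us k) (ws k) : Z) - D u w =
      (D (us k) (ws k) - D u (ws k)) + D u (ws k - w).
    by rewrite linearB addrA subrK.
  by rewrite (le_trans (ler_normD _ _))// lerD.
have zero (V : normedModType R) (x : V) (xs : nat -> V) :
    xs k @[k --> \oo] --> x -> `|xs k - x| @[k --> \oo] --> (0 : R).
  move=> h; rewrite -(normr0 V) -(subrr x).
  by apply: cvg_norm; apply: cvgB => //; exact: cvg_cst.
have -> : (0 : R) = K * 0 * `|w| + K * 0 by rewrite !mulr0 mul0r addr0.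
apply: cvgD; last by apply: cvgM; [exact: cvg_cst|exact: zero].
apply: cvgM; last exact: cvg_norm.
by apply: cvgM; [exact: cvg_cst|exact: zero].
Unshelve. all: by end_near. Qed.

(** The inequality between a regular normal and the tangent curves is stable
    under limits since the directions can be corrected continuously. *)
Lemma subdiff_curve_le u y w x t r z0 : regular_at O Xi P u -> subdiff g u y ->
  C z0 -> theta (Xi u) = t%:E -> theta x = r%:E -> P (D u w) = P (x - Xi u) ->
  dotp y w <= r - t + dotp z0 (D u w - (x - Xi u)).
Proof.
move=> reg [gfin [xs [vs [xvs xsx vsy]]]] Cz0 tE rE Pw.
have gE : fine (g u) = c + t by rewrite (fd_g fd reg.1) tE.
rewrite gE {gE gfin} in xsx.
have u_cvg : (xs k).1 @[k --> \oo] --> u by apply: cvg_comp xsx _; exact: cvg_fst.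
have a_cvg : (xs k).2 @[k --> \oo] --> c + t by apply: cvg_comp xsx _; exact: cvg_snd.
have v_cvg : (vs k).1 @[k --> \oo] --> y by apply: cvg_comp vsy _; exact: cvg_fst.
have b_cvg : (vs k).2 @[k --> \oo] --> (-1 : R) by apply: cvg_comp vsy _; exact: cvg_snd.
have [L [rL [L0 rL0 HL]]] := regular_solve_linear fd reg.
have Hd u' : exists d, `|u' - u| < rL -> `|d| <= L * `|P (x - Xi u' - D u' w)|
    /\ P (D u' d) = P (x - Xi u' - D u' w).
  have [ur|nur] := pselect (`|u' - u| < rL); last by exists 0 => /nur.
  by have [d d1 d2] := HL u' (x - Xi u' - D u' w) ur; exists d.
have [d Hd'] := choice Hd.
have Xi_cvg : Xi (xs k).1 @[k --> \oo] --> Xi u.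
  apply: continuous_cvg u_cvg; apply: differentiable_continuous.
  by have [h _] := fd_smooth fd; apply: h; exact: reg.1.
have near_u : \forall k \near \oo, `|(xs k).1 - u| < rL.
  by near=> k; rewrite distrC; near: k; apply: cvgr_dist_lt.
have d_cvg : d (xs k).1 @[k --> \oo] --> (0 : Y).
  apply: (@cvg_of_dist _ _ _ _
      (fun k => L * `|P (x - Xi (xs k).1 - D (xs k).1 w)|)).
    by apply: filterS near_u => k /Hd'[]; rewrite subr0.
  have -> : (0 : R) = L * `|P (x - Xi u - D u w)|.
    by rewrite linearB/= -Pw subrr normr0 mulr0.
  apply: cvgM; first exact: cvg_cst.
  apply: cvg_norm; apply: continuous_cvg; first exact: linear_continuous_fd.
  apply: cvgB; first by apply: cvgB => //; exact: cvg_cst.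
  by apply: cvg_differential; [exact: reg.1|by []|exact: cvg_cst].
have w_cvg : w + d (xs k).1 @[k --> \oo] --> w.
  by rewrite -[X in _ --> X]addr0; apply: cvgD => //; exact: cvg_cst.
have Dw_cvg := cvg_differential reg.1 u_cvg w_cvg.
have lhs_cvg : dotp (vs k).1 (w + d (xs k).1) @[k --> \oo] --> dotp y w.
  apply: (@cvg_of_dist _ R^o _ _ (fun k => `|(vs k).1 - y| * `|w + d (xs k).1|
      + `|y| * `|d (xs k).1|)).
    near=> k.
    have -> : dotp (vs k).1 (w + d (xs k).1) - dotp y w =
        dotp ((vs k).1 - y) (w + d (xs k).1) + dotp y (d (xs k).1).
      by rewrite !dotE; ring.
    by rewrite (le_trans (ler_normD _ _))// lerD// normr_dot.
  have -> : (0 : R) = `|y - y| * `|w| + `|y| * `|0 : Y|.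
    by rewrite subrr !normr0 mul0r mulr0 addr0.
  apply: cvgD; apply: cvgM.
  - by apply: cvg_norm; apply: cvgB => //; exact: cvg_cst.
  - exact: cvg_norm.
  - exact: cvg_cst.
  - exact: cvg_norm.
have rhs_cvg : (vs k).2 * (r - ((xs k).2 - c) +
      dotp z0 (D (xs k).1 (w + d (xs k).1) - (x - Xi (xs k).1))) @[k --> \oo]
    --> -1 * (r - (c + t - c) + dotp z0 (D u w - (x - Xi u))).
  apply: cvgM => //; apply: cvgD.
    by apply: cvgB; [exact: cvg_cst|apply: cvgB => //; exact: cvg_cst].
  apply: continuous_cvg; first exact: dot_continuous.
  by apply: cvgB => //; apply: cvgB => //; exact: cvg_cst.
have tot := cvgD lhs_cvg rhs_cvg.
suff : dotp y w + -1 * (r - (c + t - c) + dotp z0 (D u w - (x - Xi u))) <= 0 by lra.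
apply: (@ler_cvg_to _ _ _ R _ (fun=> 0) _ _ (tot _) (cvg_cst _)).
near=> k.
rewrite -[X in X <= _]/(dotp (vs k).1 (w + d (xs k).1) + (vs k).2 *
  (r - ((xs k).2 - c) +
   dotp z0 (D (xs k).1 (w + d (xs k).1) - (x - Xi (xs k).1)))).
have uk : regular_at O Xi P (xs k).1.
  by near: k; apply: u_cvg; exact: regular_near fd _ reg.
have bk : (vs k).2 < 0 by near: k; apply: (cvgr_lt _ b_cvg); rewrite oppr_lt0.
have ur : `|(xs k).1 - u| < rL by near: k; exact: near_u.
have [_ Pd] := Hd' _ ur; have := xvs k => {ur}.
case: (xs k) (vs k) uk bk Pd => [uk ak] [vk bk] /= reguk bk0 Pd [ek nk].
have gk := regular_normal_graph ek nk bk0.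
have tk : theta (Xi uk) = (ak - c)%:E.
  move: gk; rewrite (fd_g fd reguk.1); case: (theta (Xi uk)) => // s.
  by rewrite -EFinD => -[<-]; congr EFin; ring.
have Pwk : P (D uk (w + d uk)) = P (x - Xi uk).
  by rewrite linearD linearD/= Pd [P (_ - _ - _)]linearB/= addrC subrK.
have := tangent_curve fd reguk Cz0 tk rE Pwk.
have -> : c + (ak - c) = ak by ring.
by move=> /nk; rewrite /dotpR.
Unshelve. all: by end_near. Qed.

(** The orthogonal of the kernel of [P \o 'd Xi u] is the range of its
    adjoint. *)
Lemma ker_annihilator u (h : Y) : regular_at O Xi P u ->
  (forall v, P (D u v) = 0 -> dotp h v = 0) ->
  exists2 l : Z, P l = l & forall v, dotp h v = dotp l (D u v).
Proof.
move=> reg hker; have [B [PDB _]] := regular_section reg.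
have llin : linear (fun x => dotp h (B x) : R^o).
  by move=> a x x'; rewrite linearD linearZ/= dotDr dotZr.
pose ll : {linear Z -> R^o} := HB.pack (fun x => dotp h (B x) : R^o)
  (GRing.isLinear.Build _ _ _ _ _ llin).
have [l lE] := riesz ll.
have {}lE x : dotp l x = dotp h (B x) by rewrite -lE.
have lP x : dotp l (P x) = dotp l x.
  apply/eqP; rewrite -subr_eq0 -dotBr lE hker//.
  by rewrite PDB linearB/= (fd_PP fd) subrr.
exists l; first by apply: dot_inj => x; rewrite (fd_Psym fd).
move=> v; rewrite lE; apply/eqP; rewrite -subr_eq0 -dotBr hker//.
have DB : D u (v - B (D u v)) = (D u v : Z) - D u (B (D u v)) by rewrite linearB.
by rewrite DB linearB/= PDB subrr.
Qed.

(** Along kernel directions the curve inequality can be reversed, so [y] differs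
    from the pull-back of a fixed minorant [z0] by the pull-back of some [p] in
    [U]. Along the other directions it says that [z0 + p] is a subgradient of
    [theta] at [Xi u]. *)
Lemma minorant_of_subdiff u y : regular_at O Xi P u -> subdiff g u y ->
  exists z t, [/\ C z, theta (Xi u) = t%:E, dotp z (Xi u) = t
    & y = adjoint (D u) z].
Proof.
move=> reg sub; have [z0 Cz0] := fd_minorants fd.
have [t tE] : exists t, theta (Xi u) = t%:E.
  have [] := sub; rewrite (fd_g fd reg.1); case: (theta (Xi u)) => // t _ _.
  by exists t.
have key x r w := @subdiff_curve_le u y w x t r z0 reg sub Cz0 tE.
have ker w : P (D u w) = 0 -> dotp y w = dotp z0 (D u w).
  move=> Dw0.
  have half w' : P (D u w') = 0 -> dotp y w' <= dotp z0 (D u w').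
    move=> h; have := key (Xi u) t w' tE.
    by rewrite subrr linear0 h subr0 subrr add0r; exact.
  apply/eqP; rewrite eq_le half//=.
  have DN : D u (- w) = - D u w by rewrite linearN.
  have := half (- w); rewrite DN (linearN P)/= Dw0 oppr0 !dotNr.
  by move=> /(_ erefl); rewrite lerN2.
have [|p Pp pE] := @ker_annihilator u (y - adjoint (D u) z0) reg.
  by move=> v /ker yv; rewrite dotBl dot_adj yv subrr.
have pP x : dotp p x = dotp p (P x) by rewrite -(fd_Psym fd) Pp.
have [B [PDB _]] := regular_section reg.
have yE w : dotp y w = dotp (z0 + p) (D u w).
  by rewrite dotDl -pE dotBl dot_adj addrC subrK.
have ineq x r : theta x = r%:E -> dotp (z0 + p) (x - Xi u) <= r - t.
  move=> rE; have := key x r (B (x - Xi u)) rE.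
  rewrite PDB yE => /(_ erefl).
  move: (x - Xi u) => d.
  have e : dotp p (D u (B d)) = dotp p d by rewrite (pP (D u _)) PDB -pP.
  by rewrite !(dotDl z0) dotBr e; lra.
have t0 := theta0 (fd_proper fd) (fd_sublinear fd).
(* Homogeneity: testing at [0] and at [2 *: Xi u] separates the two parts of
   the subgradient inequality. *)
have le1 := ineq 0 0 t0.
have le2 : dotp (z0 + p) (2 *: Xi u - Xi u) <= 2 * t - t.
  by apply: ineq; rewrite (thetaZ (fd_sublinear fd))// tE.
rewrite sub0r dotNr in le1; rewrite dotBr dotZr in le2.
have zt : dotp (z0 + p) (Xi u) = t by lra.
exists (z0 + p), t; split => //; last by apply: dot_inj => w; rewrite dot_adj.
move=> x; have := theta_gtNy (fd_proper fd) x.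
case E : (theta x) => [r| |] => [_| |]; [|by rewrite leey|by rewrite ltxx].
have := ineq x r E; rewrite dotBr zt lee_fin; lra.
Qed.

End ChainRule.

(** * The graph of the subdifferential near an interior multiplier *)

Section LocalStructure.
Context {R : realType} {Y Z : finHilbertType R}.
Variables (g : Y -> \bar R) (O : set Y) (theta : Z -> \bar R) (Xi : Y -> Z).
Variables (P : {linear Z -> Z}) (c : R).
Hypothesis fd : framed_decomposition g O theta Xi P c.

Local Notation C := (minorants theta).
Local Notation D u := ('d Xi u).
Local Notation interior := (interior_minorant theta P).

Lemma adjointD u z z' : adjoint (D u) (z + z') = adjoint (D u) z + adjoint (D u) z'.
Proof. by apply: dot_inj => w; rewrite dotDl !dot_adj dotDl. Qed.

Lemma adjointZ u (a : R) z : adjoint (D u) (a *: z) = a *: adjoint (D u) z.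
Proof. by apply: dot_inj => w; rewrite dotZl !dot_adj dotZl. Qed.

Lemma adjointB u z z' : adjoint (D u) (z - z') = adjoint (D u) z - adjoint (D u) z'.
Proof. by rewrite -scaleN1r adjointD adjointZ scaleN1r. Qed.

(** Multipliers depend on subgradients in a Lipschitz way: this is the dual form
    of [regular_solve_linear]. *)
Lemma adj_lower u0 : regular_at O Xi P u0 -> exists K r : R, [/\ 0 <= K, 0 < r &
  forall u p, `|u - u0| < r -> P p = p -> `|p| <= K * `|adjoint (D u) p|].
Proof.
move=> reg; have [K [r [K0 r0 HK]]] := regular_solve_linear fd reg.
exists K, r; split => // u p ur Pp; apply: norm_le_dot; first by rewrite mulr_ge0.
move=> x; have [d dle Pd] := HK u x ur.
have -> : dotp p x = dotp (adjoint (D u) p) d.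
  by rewrite dot_adj -Pp !(fd_Psym fd) Pd.
rewrite (le_trans (dot_le_norm _ _))//.
have -> : K * `|adjoint (D u) p| * `|x| = `|adjoint (D u) p| * (K * `|x|) by ring.
by rewrite ler_wpM2l// (le_trans dle)// ler_wpM2l// (normP fd).
Qed.

Lemma adj_bounds u0 : O u0 -> exists K r : R, [/\ 0 <= K, 0 < r &
  forall u v z, `|u - u0| < r -> `|v - u0| < r ->
    `|adjoint (D u) z| <= K * `|z| /\
    `|adjoint (D u) z - adjoint (D v) z| <= K * `|u - v| * `|z|].
Proof.
move=> Ou0; have [K [r [K0 r0 HK]]] := C2_bounds (fd_open fd) (fd_smooth fd) Ou0.
exists K, r; split => // u v z ur vr; have [_ T1 T2 _ _] := HK u v ur vr.
split; apply: norm_le_dot; rewrite ?mulr_ge0// => w.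
  rewrite dot_adj (le_trans (dot_le_norm _ _))//.
  have -> : K * `|z| * `|w| = `|z| * (K * `|w|) by ring.
  by rewrite ler_wpM2l.
rewrite dotBl !dot_adj -dotBr (le_trans (dot_le_norm _ _))//.
have -> : K * `|u - v| * `|z| * `|w| = `|z| * (K * `|u - v| * `|w|) by ring.
by rewrite ler_wpM2l.
Qed.

Lemma theta_ker u z : C z -> P (Xi u) = 0 -> theta (Xi u) = (dotp z (Xi u))%:E.
Proof.
move=> Cz PX; have := fd_orth fd 0 Cz PX.
by rewrite add0r (theta0 (fd_proper fd) (fd_sublinear fd)) add0e.
Qed.

Lemma subdiff_ker u z : O u -> C z -> P (Xi u) = 0 -> subdiff g u (adjoint (D u) z).
Proof. by move=> Ou Cz PX; apply: (subdiff_of_minorant fd Ou Cz (theta_ker Cz PX)). Qed.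

Lemma interior_perturb z z' e : interior z e -> P (z' - z) = z' - z ->
  `|z' - z| <= e / 2 -> interior z' (e / 2).
Proof.
move=> [e0 He] Pz ze; split; first by rewrite divr_gt0.
move=> x; apply: le_trans (He x); rewrite lee_fin.
have -> : dotp z' x = dotp z x + dotp (z' - z) (P x).
  by rewrite -(fd_Psym fd) Pz dotBl; ring.
have := dot_le_norm (z' - z) (P x).
have : `|z' - z| * `|P x| <= e / 2 * `|P x| by rewrite ler_wpM2r.
lra.
Qed.

Lemma interior_exact_ker z e x : interior z e -> theta x = (dotp z x)%:E -> P x = 0.
Proof.
move=> [e0 He] tx; have := He x; rewrite tx lee_fin => h.
apply/eqP; rewrite -normr_le0 -(@pmulr_rle0 _ e)//; lra.
Qed.

(** Near a base point whose multiplier is interior, the graph of the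
    subdifferential is a smooth manifold parametrised by the zero set of
    [P \o Xi] and by the multipliers. *)
Lemma subdiff_graph_near u0 z0 e : regular_at O Xi P u0 -> interior z0 e ->
  forall e' : R, 0 < e' -> exists2 r : R, 0 < r &
  forall u y, `|u - u0| < r -> `|y - adjoint (D u0) z0| < r -> subdiff g u y ->
  exists z, [/\ regular_at O Xi P u, P (Xi u) = 0, interior z (e / 2),
    `|z - z0| < e' & y = adjoint (D u) z].
Proof.
move=> reg intz0 e' e'0; have Cz0 := interior_minorantW intz0.
have [K [r [K0 r0 HK]]] := adj_lower reg.
have [L [s [L0 s0 HL]]] := adj_bounds reg.1.
have [q q0 Hq] := (nbhs_normP _ _).1 (regular_near fd reg).
have e0 := intz0.1.
pose d := Num.min e' (e / 2).
have d0 : 0 < d by rewrite lt_min e'0 divr_gt0.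
have M0 : 0 < K * (1 + L * `|z0|) + 1 by rewrite ltr_wpDl// mulr_ge0// addr_ge0// mulr_ge0.
exists (Num.min (Num.min r s) (Num.min q (d / (K * (1 + L * `|z0|) + 1)))).
  by rewrite !lt_min r0 s0 divr_gt0// q0.
move=> u y; rewrite !lt_min => /andP[/andP[ur us] /andP[uq ud]].
move=> /andP[_ /andP[_ yd]] suby.
have regu : regular_at O Xi P u by apply: Hq; rewrite /= distrC.
have [z [t [Cz tE zt yE]]] := minorant_of_subdiff fd regu suby.
have zz0 := fd_Pdiff fd Cz Cz0.
have zle : `|z - z0| < d.
  apply: le_lt_trans (HK u _ ur zz0) _; rewrite adjointB -yE.
  have u00 : `|u0 - u0| < s by rewrite subrr normr0.
  have [_ T] := HL u u0 z0 us u00.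
  have := ler_normB (y - adjoint (D u0) z0) (adjoint (D u) z0 - adjoint (D u0) z0).
  rewrite opprB addrA subrK => h.
  move: ud yd; set m := d / _ => ud yd.
  have m0 : 0 < m by rewrite divr_gt0.
  have : `|y - adjoint (D u) z0| <= m * (1 + L * `|z0|).
    apply: le_trans h _; rewrite mulrDr mulr1; apply: lerD; first exact: ltW.
    by apply: le_trans T _; rewrite mulrA [m * L]mulrC ler_wpM2r// ler_wpM2l// ltW.
  move=> /(ler_wpM2l K0) /le_lt_trans; apply.
  have -> : d = m * (K * (1 + L * `|z0|) + 1) by rewrite /m divfK// gt_eqF.
  by rewrite mulrCA ltr_pM2l// ltrDl.
move: zle; rewrite lt_min => /andP[ze' ze].
have intz : interior z (e / 2) by apply: interior_perturb intz0 zz0 (ltW ze).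
exists z; split => //; apply: interior_exact_ker intz _.
by rewrite tE zt.
Qed.

(** Nearby points of the affine hull of the subdifferential are pull-backs of
    nearby multipliers, which are still minorants. *)
Lemma ri_of_interior u0 z0 e : regular_at O Xi P u0 -> Xi u0 = 0 ->
  interior z0 e -> ri (subdiff g u0) (adjoint (D u0) z0).
Proof.
move=> reg X0 int0; have Cz0 := interior_minorantW int0.
have PX0 : P (Xi u0) = 0 by rewrite X0 linear0.
have sub0 := subdiff_ker reg.1 Cz0 PX0.
split; first by move=> M [_ SM]; exact: SM.
have [K [r [K0 r0 HK]]] := adj_lower reg.
have e0 := int0.1.
have M0 : 0 < 2 * (K + 1) by rewrite mulr_gt0// ltr_wpDl.
exists [set y | `|y - adjoint (D u0) z0| < e / (2 * (K + 1))].
  by apply/nbhs_normP; exists (e / (2 * (K + 1))); rewrite /= ?divr_gt0// => y /=; rewrite distrC.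
move=> y [/= ylt yaff].
have [z Pz yE] : exists2 z, P (z - z0) = z - z0 & y = adjoint (D u0) z.
  apply: (yaff [set y | exists2 z, P (z - z0) = z - z0 & y = adjoint (D u0) z]).
  split.
    move=> _ _ t [z Pz ->] [z' Pz' ->].
    exists ((1 - t) *: z + t *: z'); last by rewrite adjointD !adjointZ.
    have -> : (1 - t) *: z + t *: z' - z0 = (1 - t) *: (z - z0) + t *: (z' - z0).
      by apply: dot_inj => x; rewrite !dotE; ring.
    by rewrite linearD !linearZ/= Pz Pz'.
  move=> y' /(minorant_of_subdiff fd reg)[z [t [Cz _ _ ->]]].
  by exists z => //; exact: fd_Pdiff fd _ _ Cz Cz0.
have uu : `|u0 - u0| < r by rewrite subrr normr0.
have zle : `|z - z0| <= e / 2.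
  apply: le_trans (HK _ _ uu Pz) _; rewrite adjointB -yE.
  have : (K + 1) * `|y - adjoint (D u0) z0| <= e / 2.
    move: ylt; rewrite ltr_pdivlMr// => ylt; lra.
  by apply: le_trans; rewrite ler_wpM2r// lerDl.
have Cz := interior_minorantW (interior_perturb int0 Pz zle).
by rewrite yE; exact: subdiff_ker reg.1 Cz PX0.
Qed.

(** If [x] in [U] is normal to the minorants at [z0], the segment from an
    interior minorant to [z0] cannot be prolonged beyond [z0] among minorants,
    although relative interiority allows it for subgradients. *)
Lemma interior_of_ri u0 z0 : regular_at O Xi P u0 -> Xi u0 = 0 -> C z0 ->
  ri (subdiff g u0) (adjoint (D u0) z0) -> exists e, interior z0 e.
Proof.
move=> reg X0 Cz0 [_ [V V0 VS]]; apply: (fd_strict fd) => // x Px x0.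
rewrite ltNge; apply/negP => thx.
have PX0 : P (Xi u0) = 0 by rewrite X0 linear0.
have [z1 [e int1]] := fd_interior fd; have Cz1 := interior_minorantW int1.
have [e0 He] := int1.
have lt1 : dotp (z1 - z0) x < 0.
  have := le_trans (He x) thx; rewrite lee_fin dotBl Px.
  have : 0 < e * `|x| by rewrite mulr_gt0// normr_gt0.
  lra.
pose y s := adjoint (D u0) (z0 - s *: (z1 - z0)).
have y_aff s : aff (subdiff g u0) (y s).
  move=> M [Maff SM].
  have := Maff _ _ (- s) (SM _ (subdiff_ker reg.1 Cz0 PX0))
    (SM _ (subdiff_ker reg.1 Cz1 PX0)).
  rewrite -!adjointZ -adjointD; congr (M (adjoint _ _)).
  by apply: dot_inj => w; rewrite !dotE; ring.
have [d /= d0 dV] := (nbhs_normP _ _).1 V0.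
pose N := `|adjoint (D u0) (z1 - z0)|.
have N1 : 0 < N + 1 by rewrite ltr_wpDl// /N.
pose s := d / (2 * (N + 1)).
have s0 : 0 < s by rewrite divr_gt0// mulr_gt0.
have yV : V (y s).
  apply: dV; rewrite /= /y adjointB adjointZ opprB addrCA subrr addr0 normrZ gtr0_norm//.
  rewrite -/N /s mulrAC ltr_pdivrMr ?mulr_gt0// ltr_pM2l//.
  by rewrite mulrDr mulr1 (@le_lt_trans _ _ (2 * N)) ?ltrDl// ler_peMl// ?ler1n// normr_ge0.
have [z [t [Cz _ _ yE]]] := minorant_of_subdiff fd reg (VS _ (conj yV (y_aff s))).
have [K [r [_ r0 HK]]] := adj_lower reg.
have uu : `|u0 - u0| < r by rewrite subrr normr0.
have zE : z = z0 - s *: (z1 - z0).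
  apply/eqP; rewrite -subr_eq0 -normr_le0.
  have Pz : P (z - (z0 - s *: (z1 - z0))) = z - (z0 - s *: (z1 - z0)).
    have -> : z - (z0 - s *: (z1 - z0)) = (z - z0) + s *: (z1 - z0).
      by apply: dot_inj => w; rewrite !dotE; ring.
    by rewrite linearD linearZ/= (fd_Pdiff fd Cz Cz0) (fd_Pdiff fd Cz1 Cz0).
  by have := HK _ _ uu Pz; rewrite adjointB -yE subrr normr0 mulr0.
have := le_trans (Cz x) thx; rewrite zE lee_fin dotBl dotZl.
have : s * dotp (z1 - z0) x < 0 by rewrite pmulr_rlt0.
lra.
Qed.

End LocalStructure.

(** * Uniform expansions along moving rays *)

Lemma ray_in_ball (R : realType) (V : normedModType R) (u u0 w w' : V) (t r : R) :
  `|u - u0| < r / (`|w| + 2) -> 0 < t -> t < r / (`|w| + 2) -> `|w' - w| <= 1 ->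
  [/\ `|u - u0| < r, `|u + t *: w' - u0| < r & `|w'| <= `|w| + 1].
Proof.
have n1 : 0 < `|w| + 2 by rewrite ltr_wpDl.
have rr : r / (`|w| + 2) * (`|w| + 2) = r by rewrite divfK// gt_eqF.
move: (r / _) rr => k rr uk t0 tk w1; have k0 := lt_trans t0 tk.
have w'w : `|w'| <= `|w| + 1.
  by have := ler_normD (w' - w) w; rewrite subrK; lra.
have tw' : `|t *: w'| <= t * (`|w| + 1) by rewrite normrZ gtr0_norm// ler_wpM2l// ltW.
have tkw : t * (`|w| + 1) <= k * (`|w| + 1) by rewrite ler_wpM2r ?addr_ge0// ltW.
have kw := mulr_ge0 (ltW k0) (normr_ge0 w).
split => //; first lra.
by rewrite addrAC (le_lt_trans (ler_normD _ _))//; lra.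
Qed.

Section SecondOrder.
Context {R : realType} {Y Z : finHilbertType R}.
Variables (g : Y -> \bar R) (O : set Y) (theta : Z -> \bar R) (Xi : Y -> Z).
Variables (P : {linear Z -> Z}) (c : R).
Hypothesis fd : framed_decomposition g O theta Xi P c.

Local Notation C := (minorants theta).
Local Notation D u := ('d Xi u).
Local Notation interior := (interior_minorant theta P).

(** Base point, step and direction all vary; [s] measures the admitted variation
    of the direction and controls the relative error. *)
Lemma first_order_estimate (u0 w : Y) : O u0 -> exists2 M : R, 0 <= M &
  forall s : R, 0 < s -> s <= 1 -> exists2 rho : R, 0 < rho &
  forall (u : Y) (t : R) (w' : Y), `|u - u0| < rho -> 0 < t -> t < rho -> `|w' - w| <= s ->
  `|Xi (u + t *: w') - Xi u - t *: (D u0 w : Z)| <= t * (s * M).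
Proof.
move=> Ou0; have [K [r [K0 r0 HK]]] := C2_bounds (fd_open fd) (fd_smooth fd) Ou0.
have n1 : 0 < `|w| + 2 by rewrite ltr_wpDl.
exists (K * (`|w| + 1) ^+ 2 + K * (`|w| + 1) + K).
  by rewrite addr_ge0// addr_ge0// mulr_ge0// ?sqr_ge0// addr_ge0.
move=> s s0 s1; exists (Num.min s (r / (`|w| + 2))).
  by rewrite lt_min s0 divr_gt0.
move=> u t w'; rewrite !lt_min => /andP[us ur] t0 /andP[ts tr] w's.
have [ur' vr w'w] := ray_in_ball ur t0 tr (le_trans w's s1).
have tw' : `|t *: w'| <= t * (`|w| + 1) by rewrite normrZ gtr0_norm// ler_wpM2l// ltW.
have [_ _ _ T _] := HK _ _ vr ur'.
have u00 : `|u0 - u0| < r by rewrite subrr normr0.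
have [_ _ /(_ w') T2 _ _] := HK u u0 ur' u00.
have [_ /(_ (w' - w)) T3 _ _ _] := HK u0 u0 u00 u00.
have vu : u + t *: w' - u = t *: w' by rewrite addrAC subrr add0r.
rewrite vu in T.
have -> : Xi (u + t *: w') - Xi u - t *: (D u0 w : Z) =
    (Xi (u + t *: w') - Xi u - D u (t *: w')) + t *: ((D u w' : Z) - D u0 w')
    + t *: (D u0 (w' - w) : Z).
  have -> : D u (t *: w') = t *: (D u w' : Z) by rewrite linearZ.
  have -> : D u0 (w' - w) = (D u0 w' : Z) - D u0 w by rewrite linearB.
  by apply: dot_inj => x; rewrite !dotE; ring.
apply: le_trans (ler_normD _ _) _; apply: le_trans (lerD (ler_normD _ _) (lexx _)) _.
rewrite !normrZ !gtr0_norm//.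
have h1 : `|Xi (u + t *: w') - Xi u - D u (t *: w')| <= t * (s * (K * (`|w| + 1) ^+ 2)).
  apply: le_trans T _.
  have -> : t * (s * (K * (`|w| + 1) ^+ 2)) = K * ((t * (`|w| + 1)) * (s * (`|w| + 1))) by ring.
  rewrite ler_wpM2l// expr2 ler_pM//.
  by apply: le_trans tw' _; rewrite ler_wpM2r ?addr_ge0// ltW.
have h2 : `|(D u w' : Z) - D u0 w'| <= s * (K * (`|w| + 1)).
  apply: le_trans T2 _.
  have -> : s * (K * (`|w| + 1)) = K * s * (`|w| + 1) by ring.
  by apply: ler_pM => //; [rewrite mulr_ge0|rewrite ler_wpM2l// ltW].
have h3 : `|(D u0 (w' - w) : Z)| <= s * K.
  by apply: le_trans T3 _; rewrite mulrC ler_wpM2r.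
have -> : t * (s * (K * (`|w| + 1) ^+ 2 + K * (`|w| + 1) + K)) =
  t * (s * (K * (`|w| + 1) ^+ 2)) + t * (s * (K * (`|w| + 1))) + t * (s * K) by ring.
by apply: lerD; [apply: lerD => //|]; rewrite ler_wpM2l// ltW.
Qed.

(** The limit of the smooth part of the second order difference quotients, where
    the multiplier varies as well. *)
Lemma second_order_estimate (u0 : Y) (z0 : Z) (w : Y) : O u0 -> exists2 M : R, 0 <= M &
  forall s : R, 0 < s -> s <= 1 -> exists2 rho : R, 0 < rho &
  forall (u : Y) (t : R) (w' : Y) (z : Z), `|u - u0| < rho -> 0 < t -> t < rho -> `|w' - w| <= s ->
  `|z - z0| <= s -> [/\ O u, O (u + t *: w') &
  `|dotp z (Xi (u + t *: w') - Xi u - t *: (D u w' : Z))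
     - 2^-1 * t ^+ 2 * dotp z0 (hess Xi u0 w w)| <= 2^-1 * t ^+ 2 * (s * M)].
Proof.
move=> Ou0; have [B B0 HB] := hess_bounded (fd_smooth fd) Ou0.
have n1 : 0 < `|w| + 2 by rewrite ltr_wpDl.
have m1 : 0 <= `|w| + 1 by rewrite addr_ge0.
have k1 : 0 <= `|z0| + 1 by rewrite addr_ge0.
exists (2 * (`|z0| + 1) * (`|w| + 1) ^+ 2 + B * (`|w| + 1) ^+ 2
        + `|z0| * (B * (`|w| + 1) + B * `|w|)).
  by rewrite !addr_ge0// !mulr_ge0// ?sqr_ge0// !addr_ge0// mulr_ge0.
move=> s s0 s1.
have [r r0 Hr] := C2_expansion (fd_open fd) (fd_smooth fd) Ou0 s0.
exists (r / (`|w| + 2)); first by rewrite divr_gt0.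
move=> u t w' z ur t0 tr w's zs.
have zz : `|z| <= `|z0| + 1.
  have := ler_normD (z - z0) z0; rewrite subrK; lra.
have [ur' vr w'w] := ray_in_ball ur t0 tr (le_trans w's s1).
have tw' : `|t *: w'| <= t * (`|w| + 1) by rewrite normrZ gtr0_norm// ler_wpM2l// ltW.
have [Ov _ T] := Hr _ _ vr ur'.
have [Ou _ _] := Hr _ _ ur' ur'.
split => //.
have vu : u + t *: w' - u = t *: w' by rewrite addrAC subrr add0r.
rewrite vu in T.
set H := hess Xi u0 in HB T *.
have Hl w1 : exists f : {linear Y -> Z}, forall v, H v w1 = f v.
  by exists (HB.pack (fun v => H v w1)
    (GRing.isLinear.Build _ _ _ _ _ (hess_linearl Xi u0 w1)) : {linear Y -> Z}).
have Hr2 v : exists f : {linear Y -> Z}, forall w1, H v w1 = f w1.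
  by exists (HB.pack (H v)
    (GRing.isLinear.Build _ _ _ _ _ (hess_linearr (fd_smooth fd) v Ou0)) : {linear Y -> Z}).
have hZ : H (t *: w') (t *: w') = t ^+ 2 *: H w' w'.
  have [f fE] := Hl (t *: w'); have [h hE] := Hr2 w'.
  by rewrite fE linearZ/= -fE !hE linearZ/= scalerA expr2.
set X := Xi (u + t *: w') - Xi u - t *: (D u w' : Z).
have XE : `|X - 2^-1 *: (t ^+ 2 *: H w' w')| <= s * (t ^+ 2 * (`|w| + 1) ^+ 2).
  rewrite -hZ /X -linearZ/=; apply: le_trans T _; rewrite ler_wpM2l ?(ltW s0)//.
  by rewrite -exprMn; apply: lerXn2r => //; rewrite nnegrE// mulr_ge0// ltW.
have HE : `|H w' w' - H w w| <= s * (B * (`|w| + 1) + B * `|w|).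
  have -> : H w' w' - H w w = H (w' - w) w' + H w (w' - w).
    have [f fE] := Hl w'; have [h hE] := Hr2 w.
    by rewrite !fE !hE !linearB/= -!fE -!hE addrA subrK.
  apply: le_trans (ler_normD _ _) _.
  have h1 := HB (w' - w) w'; have h2 := HB w (w' - w).
  have : B * `|w' - w| * `|w'| <= B * s * (`|w| + 1).
    by apply: ler_pM => //; [rewrite mulr_ge0|rewrite ler_wpM2l].
  have : B * `|w| * `|w' - w| <= B * `|w| * s by rewrite ler_wpM2l ?mulr_ge0.
  move: h1 h2; move: `|H _ _| `|H w _| => a b; lra.
have -> : dotp z X - 2^-1 * t ^+ 2 * dotp z0 (H w w) =
   dotp z (X - 2^-1 *: (t ^+ 2 *: H w' w'))
   + 2^-1 * t ^+ 2 * (dotp (z - z0) (H w' w') + dotp z0 (H w' w' - H w w)).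
  by rewrite !dotE; field.
have t2 : 0 <= 2^-1 * t ^+ 2 by rewrite mulr_ge0// ?invr_ge0// sqr_ge0.
apply: le_trans (ler_normD _ _) _; rewrite normrM (ger0_norm t2).
have -> : 2^-1 * t ^+ 2 * (s * (2 * (`|z0| + 1) * (`|w| + 1) ^+ 2 + B * (`|w| + 1) ^+ 2
        + `|z0| * (B * (`|w| + 1) + B * `|w|))) =
  (`|z0| + 1) * (s * (t ^+ 2 * (`|w| + 1) ^+ 2)) +
  2^-1 * t ^+ 2 * (s * (B * (`|w| + 1) ^+ 2) + `|z0| * (s * (B * (`|w| + 1) + B * `|w|))).
  by field.
apply: lerD.
  by apply: le_trans (normr_dot _ _) _; apply: ler_pM.
rewrite ler_wpM2l//; apply: le_trans (ler_normD _ _) _; apply: lerD.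
  apply: le_trans (normr_dot _ _) _; apply: ler_pM => //.
  apply: le_trans (HB _ _) _; rewrite -mulrA ler_wpM2l// expr2.
  exact: ler_pM.
by apply: le_trans (normr_dot _ _) _; rewrite ler_wpM2l.
Qed.

End SecondOrder.

(** * Interior multipliers give strict twice epi-differentiability *)

Section AttentiveFilter.
Context {R : realType} {Y : finHilbertType R}.
Variable f : Y -> \bar R.

Lemma attentive_ball (x v : Y) (r : R) : 0 < r ->
  attentive_nbhs f x v [set p | [/\ subdiff f p.1 p.2, `|p.1 - x| < r & `|p.2 - v| < r]].
Proof.
move=> r0; exists [set q | `|q.1.1 - x| < r /\ `|q.1.2 - v| < r].
  have h : nbhs (x, v) [set q : Y * Y | `|q.1 - x| < r /\ `|q.2 - v| < r].
    by apply/nbhs_pairP; exists r.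
  exists ([set q : Y * Y | `|q.1 - x| < r /\ `|q.2 - v| < r], setT).
    by split => //=; exact: filterT.
  by move=> q [].
by move=> p fp [h1 h2]; split.
Qed.

(** The base point itself is a point of the graph at which the value of [f] is
    attained, hence it may be kept fixed in attentive neighbourhoods. *)
Lemma filter_prod_attentive (x v : Y) (A : set (R * (Y * Y))) :
  filter_prod (0 : R)^'+ (attentive_nbhs f x v) A ->
  exists2 r : R, 0 < r & forall t y, 0 < t -> t < r -> `|y - v| < r ->
    subdiff f x y -> A (t, (x, y)).
Proof.
move=> [[A1 A2] /= [/at_right0P[r1 r10 rA1] [B nB BA2]] AA].
have [[B1 B2] /= [nB1 nB2] BB] := nB.
have [r2 r20 rB1] := (nbhs_pairP _ _ _).1 nB1.
exists (Num.min r1 r2); first by rewrite lt_min r10.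
move=> t y t0; rewrite !lt_min => /andP[tr1 _] /andP[_ yr2] sub.
apply: AA; split => /=; first exact: rA1.
apply: BA2 => //=; apply: BB; split => /=.
  by apply: rB1; rewrite // subrr normr0.
exact: nbhs_singleton.
Qed.

End AttentiveFilter.

Section EpiDifferentiability.
Context {R : realType} {Y Z : finHilbertType R}.
Variables (g : Y -> \bar R) (O : set Y) (theta : Z -> \bar R) (Xi : Y -> Z).
Variables (P : {linear Z -> Z}) (c : R).
Hypothesis fd : framed_decomposition g O theta Xi P c.

Local Notation C := (minorants theta).
Local Notation D u := ('d Xi u).
Local Notation interior := (interior_minorant theta P).

(** On the zero set of [P \o Xi] every minorant is exact, so the quotient compares
    [theta] with the linearisation for the multiplier [z]. *)
Lemma second_diff_quotient_le (u w : Y) (z : Z) (t a : R) : O u -> O (u + t *: w) -> C z ->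
  P (Xi u) = 0 -> 0 < t ->
  (second_diff_quotient g u (adjoint (D u) z) t w <= a%:E)%E =
  (theta (Xi (u + t *: w)%R) <=
    (dotp z (Xi u) + t * dotp z (D u w) + 2^-1 * t ^+ 2 * a)%:E)%E.
Proof.
move=> Ou Ov Cz PX t0; rewrite /second_diff_quotient !(fd_g fd)//.
rewrite (theta_ker fd Cz PX) dot_adj.
have k0 : 0 < (2^-1 * t ^+ 2)^-1 by rewrite invr_gt0 mulr_gt0// exprn_gt0.
have := theta_gtNy (fd_proper fd) (Xi (u + t *: w)).
case: (theta (Xi (u + t *: w))) => [b _| _|]; [|  |by rewrite ltxx].
  rewrite -!EFinD -EFinM !lee_fin.
  rewrite ler_pdivrMr ?mulr_gt0 ?exprn_gt0//.
  by rewrite (mulrC a); apply/idP/idP; lra.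
rewrite addey// -EFinD addye// ?addye//.
by rewrite gt0_mulye ?lte_fin// !leye_eq.
Qed.

Lemma quotient_lower (u w : Y) (z : Z) (t a e : R) : O u -> O (u + t *: w) ->
  interior z e -> P (Xi u) = 0 -> 0 < t ->
  (second_diff_quotient g u (adjoint (D u) z) t w <= a%:E)%E ->
  dotp z (Xi (u + t *: w) - Xi u - t *: (D u w : Z))
    + e * `|P (Xi (u + t *: w))| <= 2^-1 * t ^+ 2 * a.
Proof.
move=> Ou Ov intz PX t0; have Cz := interior_minorantW intz.
rewrite second_diff_quotient_le// => h.
have := le_trans (intz.2 _) h; rewrite lee_fin !dotBr dotZr.
set p := `|P _|; lra.
Qed.

Lemma quotient_upper (u w : Y) (z : Z) (t a : R) : O u -> O (u + t *: w) ->
  C z -> P (Xi u) = 0 -> 0 < t -> P (Xi (u + t *: w)) = 0 ->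
  dotp z (Xi (u + t *: w) - Xi u - t *: (D u w : Z)) <= 2^-1 * t ^+ 2 * a ->
  (second_diff_quotient g u (adjoint (D u) z) t w <= a%:E)%E.
Proof.
move=> Ou Ov Cz PX t0 PXv; rewrite second_diff_quotient_le// (theta_ker fd Cz PXv).
rewrite lee_fin !dotBr dotZr; lra.
Qed.

(** The limit of the second order difference quotients: the curvature of the
    Lagrangian along the tangent space of the zero set of [P \o Xi]. *)
Definition epi_limit (u0 : Y) (z0 : Z) (w : Y) : \bar R :=
  if P (D u0 w) == 0 then (dotp z0 (hess Xi u0 w w))%:E else +oo%E.

(** For a direction [w] leaving the tangent space, [P (Xi _)] grows linearly in
    [t], and the gap of the interior multiplier makes the quotients grow like
    [1 / t]. Otherwise only the smooth part matters. *)
Lemma epi_limit_lower u0 z0 e w a : regular_at O Xi P u0 -> interior z0 e ->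
  (forall s : R, 0 < s -> exists u t w' z a', [/\ P (Xi u) = 0, interior z (e / 2),
     (second_diff_quotient g u (adjoint (D u) z) t w' <= a'%:E)%E,
     [/\ `|u - u0| < s, `|z - z0| < s, 0 < t & t < s] &
     `|w' - w| < s /\ `|a' - a| < s]) ->
  (epi_limit u0 z0 w <= a%:E)%E.
Proof.
move=> reg [e0 _] H.
have [M1 M10 HM1] := first_order_estimate fd w reg.1.
have [M2 M20 HM2] := second_order_estimate fd z0 w reg.1.
have approx s : 0 < s -> s <= 1 -> exists u t w' z a', [/\ P (Xi u) = 0,
    interior z (e / 2), [/\ 0 < t, t < s & a' <= a + s],
    `|Xi (u + t *: w') - Xi u - t *: (D u0 w : Z)| <= t * (s * M1) &
    2^-1 * t ^+ 2 * (dotp z0 (hess Xi u0 w w) - s * M2)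
      + e / 2 * `|P (Xi (u + t *: w'))| <= 2^-1 * t ^+ 2 * a'].
  move=> s0 s1; have [r1 r10 Hr1] := HM1 s s0 s1; have [r2 r20 Hr2] := HM2 s s0 s1.
  have [|u [t [w' [z [a' [PX intz q [us zs t0 ts] [ws as_]]]]]]] :=
    H (Num.min s (Num.min r1 r2)); first by rewrite !lt_min s0 r10.
  move: us zs ts ws as_; rewrite !lt_min.
  move=> /and3P[us ur1 ur2] /and3P[zs _ _] /and3P[ts tr1 tr2] /and3P[ws _ _] /and3P[as_ _ _].
  exists u, t, w', z, a'; have [Ou Ov T] := Hr2 u t w' z ur2 t0 tr2 (ltW ws) (ltW zs).
  split => //.
  - by split => //; move: as_; rewrite ltr_norml => /andP[_]; lra.
  - by apply: Hr1 => //; exact: ltW.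
  have := quotient_lower Ou Ov intz PX t0 q; move: T; rewrite ler_norml => /andP[T _].
  move: T; move: (dotp z _) `|P _| => A B; lra.
rewrite /epi_limit; case: ifPn => [_|nz].
  rewrite lee_fin -subr_ge0; apply: (@ge0_of_scaled _ _ (1 + M2)) => s s0 s2.
  have [|u [t [w' [z [a' [_ _ [t0 _ aa] _]]]]]] := approx s s0; first lra.
  move=> h; have : 2^-1 * t ^+ 2 * (dotp z0 (hess Xi u0 w w) - s * M2) <= 2^-1 * t ^+ 2 * a'.
    apply: le_trans h; rewrite lerDl mulr_ge0//; lra.
  rewrite ler_pM2l ?mulr_gt0 ?exprn_gt0//; lra.
exfalso.
(* The inequalities for all small [s] force the positive slope [e / 2 * eta]
   to vanish. *)
set eta := `|P (D u0 w)|; have eta0 : 0 < eta by rewrite normr_gt0.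
pose q0 := dotp z0 (hess Xi u0 w w).
suff : 0 <= - (e / 2 * eta) by have := mulr_gt0 e0 eta0; lra.
apply: (@ge0_of_scaled _ _ (e / 2 * M1 + (`|a| + 1 + `|q0| + M2))) => s s0 s2.
have [|u [t [w' [z [a' [PX _ [t0 ts aa] T h]]]]]] := approx s s0; first lra.
have lowP : t * (eta - s * M1) <= `|P (Xi (u + t *: w'))|.
  have -> : P (Xi (u + t *: w')) =
      t *: P (D u0 w) + P (Xi (u + t *: w') - Xi u - t *: (D u0 w : Z)).
    have PZ : P (t *: (D u0 w : Z)) = t *: P (D u0 w) by rewrite linearZ.
    by rewrite (linearB P)/= (linearB P)/= PX PZ subr0 [RHS]addrC subrK.
  have := ler_normB (t *: P (D u0 w) + P (Xi (u + t *: w') - Xi u - t *: (D u0 w : Z)))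
    (P (Xi (u + t *: w') - Xi u - t *: (D u0 w : Z))).
  rewrite addrK normrZ gtr0_norm// -/eta.
  have := le_trans (normP fd _) T.
  move: `|P _| `|_ + _| => A B; lra.
have h2 : e / 2 * (t * (eta - s * M1)) <= e / 2 * `|P (Xi (u + t *: w'))|.
  by rewrite ler_wpM2l//; lra.
have h3 : 2^-1 * t ^+ 2 * (a' - q0 + s * M2) <= t * (s * (`|a| + 1 + `|q0| + M2)).
  have -> : 2^-1 * t ^+ 2 * (a' - q0 + s * M2) = t * (2^-1 * t * (a' - q0 + s * M2)) by ring.
  rewrite ler_wpM2l ?(ltW t0)//.
  apply: (@le_trans _ _ (2^-1 * t * (`|a| + 1 + `|q0| + M2))).
    rewrite ler_wpM2l ?mulr_ge0 ?(ltW t0)//.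
    have := ler_norm a; have := ler_norm (- q0); rewrite normrN.
    have : s * M2 <= M2 by rewrite ler_piMl//; lra.
    lra.
  rewrite ler_wpM2r ?addr_ge0//; lra.
have h4 : t * (e / 2 * (eta - s * M1)) <= t * (s * (`|a| + 1 + `|q0| + M2)).
  move: h; rewrite -/q0; move: h2 h3; move: `|P _| => B; lra.
rewrite ler_pM2l// in h4; lra.
Qed.

(** Recovery directions: a tangent direction is corrected so that the moving
    point stays in the zero set of [P \o Xi], where the gap vanishes. *)
Lemma epi_limit_upper u0 z0 w a s : regular_at O Xi P u0 -> 0 < s ->
  (epi_limit u0 z0 w <= a%:E)%E -> exists2 rho : R, 0 < rho &
  forall u t z, `|u - u0| < rho -> 0 < t -> t < rho -> C z -> `|z - z0| < rho ->
    P (Xi u) = 0 -> exists w', [/\ `|w' - w| < s, O u, O (u + t *: w') ,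
      P (Xi (u + t *: w')) = 0 &
      dotp z (Xi (u + t *: w') - Xi u - t *: (D u w' : Z)) <= 2^-1 * t ^+ 2 * (a + s)].
Proof.
move=> reg s0; rewrite /epi_limit; case: eqP => [PDw|]; last by rewrite leye_eq.
rewrite lee_fin => q0a.
have [M1 M10 HM1] := first_order_estimate fd w reg.1.
have [M2 M20 HM2] := second_order_estimate fd z0 w reg.1.
have [L [rL [L0 rL0 HL]]] := regular_solve fd reg.
pose s1 := Num.min 1 (s / (2 * (M2 + 1))).
have m2 : 0 < 2 * (M2 + 1) by rewrite mulr_gt0// ltr_wpDl.
have s10 : 0 < s1 by rewrite lt_min ltr01 divr_gt0.
have s11 : s1 <= 1 by rewrite ge_min lexx.
have s1M : s1 * M2 <= s.
  have : s1 * (2 * (M2 + 1)) <= s by rewrite -ler_pdivlMr// ge_min lexx orbT.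
  have := mulr_ge0 (ltW s10) M20; lra.
clearbody s1.
pose d := Num.min s s1; have d0 : 0 < d by rewrite lt_min s0.
have lm : 0 < L * M1 + 1 by rewrite ltr_wpDl// mulr_ge0.
pose s2 := Num.min 1 (d / (2 * (L * M1 + 1))).
have s20 : 0 < s2 by rewrite lt_min ltr01 divr_gt0// mulr_gt0.
have s21 : s2 <= 1 by rewrite ge_min lexx.
have s2d : L * (s2 * M1) < d.
  have : s2 * (2 * (L * M1 + 1)) <= d by rewrite -ler_pdivlMr ?mulr_gt0// ge_min lexx orbT.
  have -> : L * (s2 * M1) = s2 * (L * M1) by ring.
  have := mulr_ge0 (ltW s20) (mulr_ge0 L0 M10); lra.
clearbody s2.
have [r1 r10 Hr1] := HM1 s2 s20 s21; have [r2 r20 Hr2] := HM2 s1 s10 s11.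
have n1 : 0 < `|w| + M1 + 1 by rewrite ltr_wpDl// addr_ge0.
pose rho := Num.min (Num.min r1 r2) (Num.min s1 (rL / (2 * (`|w| + M1 + 1)))).
exists rho; first by rewrite !lt_min r10 r20 s10 divr_gt0// mulr_gt0.
move=> u t z; rewrite !lt_min => /andP[/andP[ur1 ur2] /andP[_ urL]] t0.
move=> /andP[/andP[tr1 tr2] /andP[_ trL]] Cz /andP[_ /andP[zs _]] PX.
have T1 := Hr1 u t w ur1 t0 tr1.
rewrite subrr normr0 in T1; have {}T1 := T1 (ltW s20).
have PT : P (0 - Xi (u + t *: w)) = - P (Xi (u + t *: w) - Xi u - t *: (D u0 w : Z)).
  have PZ : P (t *: (D u0 w : Z)) = 0 by rewrite linearZ/= PDw scaler0.
  by rewrite !(linearB P)/= PX PZ (linear0 P) !subr0 sub0r.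
have res : `|P (0 - Xi (u + t *: w))| <= t * (s2 * M1).
  by rewrite PT normrN (le_trans (normP fd _)).
have kL : rL / (2 * (`|w| + M1 + 1)) * (2 * (`|w| + M1 + 1)) = rL.
  by rewrite divfK// gt_eqF// mulr_gt0.
set k := rL / _ in kL urL trL.
have k0 : 0 < k by rewrite divr_gt0// mulr_gt0.
have kw : k * `|w| + k * M1 + k + k <= rL.
  by rewrite -kL; have := normr_ge0 w; nra.
have [||dd dle Pd] := HL (u + t *: w) 0.
- rewrite addrAC; apply: le_lt_trans (ler_normD _ _) _; rewrite normrZ gtr0_norm//.
  have : t * `|w| <= k * `|w| by rewrite ler_wpM2r// ltW.
  have := mulr_ge0 (ltW k0) M10; lra.
- apply: le_lt_trans res _.
  have : t * (s2 * M1) <= k * (1 * M1).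
    by apply: ler_pM; rewrite ?(ltW t0) ?(ltW trL)// ?mulr_ge0 ?(ltW s20)// ler_wpM2r.
  have := mulr_ge0 (ltW k0) (normr_ge0 w); lra.
pose w' := w + t^-1 *: dd.
have w'E : t *: w' = t *: w + dd by rewrite scalerDr scalerA divff ?gt_eqF// scale1r.
have ww : `|w' - w| < d.
  rewrite addrAC subrr add0r normrZ gtr0_norm ?invr_gt0//.
  rewrite mulrC ltr_pdivrMr//; apply: le_lt_trans dle _.
  apply: le_lt_trans (ler_wpM2l L0 res) _.
  have -> : L * (t * (s2 * M1)) = L * (s2 * M1) * t by ring.
  by rewrite ltr_pM2r.
move: (ww); rewrite lt_min => /andP[wws wws1].
have [Ou Ov T2] := Hr2 u t w' z ur2 t0 tr2 (ltW wws1) (ltW zs).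
exists w'; split => //; first by rewrite w'E addrA Pd linear0.
move: T2; rewrite ler_norml => /andP[_ T2].
have t2 : 0 <= 2^-1 * t ^+ 2 by rewrite mulr_ge0 ?sqr_ge0.
have : 2^-1 * t ^+ 2 * (dotp z0 (hess Xi u0 w w) + s1 * M2) <= 2^-1 * t ^+ 2 * (a + s).
  by rewrite ler_wpM2l// lerD.
move: T2; move: (dotp z _) => A; lra.
Qed.

Lemma strictly_twice_epi_of_interior u0 z0 e : regular_at O Xi P u0 ->
  P (Xi u0) = 0 -> interior z0 e ->
  strictly_twice_epi_differentiable g u0 (adjoint (D u0) z0).
Proof.
move=> reg PX0 int0; have Cz0 := interior_minorantW int0.
exists (epi_limit u0 z0) => F E.
have sub0 := subdiff_ker fd reg.1 Cz0 PX0.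
have inf_sup : PK_liminf F E `<=` PK_limsup F E.
  move=> q qinf V Vq A FA.
  have [r1 r10 h1] := filter_prod_attentive FA.
  have [r2 r20 h2] := filter_prod_attentive (qinf V Vq).
  have mm : 0 < Num.min r1 r2 by rewrite lt_min r10.
  have m0 : 0 < Num.min r1 r2 / 2 by rewrite divr_gt0.
  have m1 : Num.min r1 r2 / 2 < Num.min r1 r2.
    by rewrite ltr_pdivrMr// ltr_pMr// ltr1n.
  move: (m1); rewrite lt_min => /andP[l1 l2].
  exists (Num.min r1 r2 / 2, (u0, adjoint (D u0) z0)).
    by apply: h1; rewrite ?subrr ?normr0.
  by apply: h2; rewrite ?subrr ?normr0.
have sup_epi : PK_limsup F E `<=` epi (epi_limit u0 z0).
  move=> [w a] wa; apply: (epi_limit_lower reg int0) => s s0.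
  have [r r0 Hr] := subdiff_graph_near fd reg int0 s0.
  have V : nbhs (w, a) [set q : Y * R | `|q.1 - w| < s /\ `|q.2 - a| < s].
    by apply/nbhs_pairP; exists s.
  have FA : F [set q | [/\ 0 < q.1, q.1 < s & [/\ subdiff g q.2.1 q.2.2,
      `|q.2.1 - u0| < Num.min r s & `|q.2.2 - adjoint (D u0) z0| < Num.min r s]]].
    exists ([set t | 0 < t /\ t < s], [set p | [/\ subdiff g p.1 p.2,
      `|p.1 - u0| < Num.min r s & `|p.2 - adjoint (D u0) z0| < Num.min r s]]) => /=.
      split; first by apply/at_right0P; exists s.
      by apply: attentive_ball; rewrite lt_min r0.
    by move=> [t p] /= [[]].
  have [[t [u y]] /= [t0 ts [suby us ys]] [[w' a'] [/= E' [h1 h2]]]] := wa _ V _ FA.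
  move: us ys; rewrite !lt_min => /andP[ur us] /andP[yr _].
  have [z [regu PXu intz zs yE]] := Hr u y ur yr suby.
  by exists u, t, w', z, a'; split => //; rewrite -yE.
have epi_inf : epi (epi_limit u0 z0) `<=` PK_liminf F E.
  move=> [w a] /= wa V /nbhs_pairP[s s0 sV].
  have s20 : 0 < s / 2 by rewrite divr_gt0.
  have ss : s / 2 < s by rewrite ltr_pdivrMr//; lra.
  have [rho rho0 Hrho] := epi_limit_upper reg s20 wa.
  have [r r0 Hr] := subdiff_graph_near fd reg int0 rho0.
  exists ([set t | 0 < t /\ t < rho], [set p | [/\ subdiff g p.1 p.2,
      `|p.1 - u0| < Num.min r rho & `|p.2 - adjoint (D u0) z0| < Num.min r rho]]) => /=.
    split; first by apply/at_right0P; exists rho.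
    by apply: attentive_ball; rewrite lt_min r0.
  move=> [t [u y]] /= [[t0 trho] [suby]].
  rewrite !lt_min => /andP[ur urho] /andP[yr _].
  have [z [regu PXu intz zrho yE]] := Hr u y ur yr suby.
  have Cz := interior_minorantW intz.
  have [w' [ws Ou Ov PXv q]] := Hrho u t z urho t0 trho Cz zrho PXu.
  exists (w', a + s / 2); split; last first.
    apply: sV; first exact: lt_trans ws ss.
    by rewrite addrAC subrr add0r gtr0_norm.
  by rewrite /E /epi /= yE; exact: quotient_upper.
split; apply/seteqP; split => //.
- exact: subset_trans epi_inf inf_sup.
- exact: subset_trans inf_sup sup_epi.
Qed.

End EpiDifferentiability.

(** * Interior multipliers give strict proto-differentiability *)

Section MovingBase.
Context {R : realType} {X1 X2 : normedModType R}.
Implicit Type Omega : set (X1 * X2).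

Lemma moving_baseP Omega (x1 : X1) (x2 : X2) (A : set ((X1 * X2) * R)) :
  moving_base Omega (x1, x2) A <-> exists2 r : R, 0 < r & forall y1 y2 t,
    Omega (y1, y2) -> `|y1 - x1| < r -> `|y2 - x2| < r -> 0 < t -> t < r ->
    A ((y1, y2), t).
Proof.
split.
  move=> [[A1 A2] /= [/nbhs_pairP[r1 r10 rA1] /at_right0P[r2 r20 rA2]] AA].
  exists (Num.min r1 r2); first by rewrite lt_min r10.
  move=> y1 y2 t Oy; rewrite !lt_min => /andP[h1 _] /andP[h2 _] t0 /andP[_ h3].
  by apply: AA; split => /=; [exact: rA1|exact: rA2].
move=> [r r0 rA].
exists ([set y | [/\ Omega y, `|y.1 - x1| < r & `|y.2 - x2| < r]],
   [set t | 0 < t /\ t < r]) => /=.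
  split; last by apply/at_right0P; exists r.
  by apply/nbhs_pairP; exists r.
by move=> [[y1 y2] t] /= [[Oy h1 h2] [t0 tr]]; exact: rA.
Qed.

Lemma paratingentP Omega x1 x2 w1 w2 :
  paratingent_cone Omega (x1, x2) (w1, w2) <-> forall s : R, 0 < s ->
  exists y1 y2 t z1 z2, [/\ Omega (y1, y2), `|y1 - x1| < s, `|y2 - x2| < s,
    0 < t /\ t < s & [/\ Omega (z1, z2), `|t^-1 *: (z1 - y1) - w1| < s
      & `|t^-1 *: (z2 - y2) - w2| < s]].
Proof.
split.
  move=> H s s0.
  have V : nbhs (w1, w2) [set q : X1 * X2 | `|q.1 - w1| < s /\ `|q.2 - w2| < s].
    by apply/nbhs_pairP; exists s.
  have A : moving_base Omega (x1, x2) [set p | [/\ Omega p.1, `|p.1.1 - x1| < s,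
      `|p.1.2 - x2| < s & 0 < p.2 /\ p.2 < s]].
    by apply/moving_baseP; exists s.
  have [[[y1 y2] t] /= [Oy h1 h2 h3] [q [/= [[z1 z2] Oz <-] /= [h4 h5]]]] := H _ V _ A.
  by exists y1, y2, t, z1, z2.
move=> H V /nbhs_pairP[s s0 sV] A /moving_baseP[r r0 rA].
have [|y1 [y2 [t [z1 [z2 [Oy h1 h2 [t0 h3] [Oz h4 h5]]]]]]] := H (Num.min s r).
  by rewrite lt_min s0.
move: h1 h2 h3 h4 h5; rewrite !lt_min.
move=> /andP[_ h1] /andP[_ h2] /andP[_ h3] /andP[h4 _] /andP[h5 _].
exists ((y1, y2), t); first exact: rA.
exists (t^-1 *: (z1 - y1), t^-1 *: (z2 - y2)); split; last exact: sV.
by exists (z1, z2).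
Qed.

Lemma regular_tangentP Omega x1 x2 w1 w2 :
  regular_tangent_cone Omega (x1, x2) (w1, w2) <-> forall s : R, 0 < s ->
  exists2 r : R, 0 < r & forall y1 y2 t, Omega (y1, y2) -> `|y1 - x1| < r ->
    `|y2 - x2| < r -> 0 < t -> t < r -> exists z1 z2, [/\ Omega (z1, z2),
      `|t^-1 *: (z1 - y1) - w1| < s & `|t^-1 *: (z2 - y2) - w2| < s].
Proof.
split.
  move=> H s s0.
  have V : nbhs (w1, w2) [set q : X1 * X2 | `|q.1 - w1| < s /\ `|q.2 - w2| < s].
    by apply/nbhs_pairP; exists s.
  have [r r0 Hr] := (moving_baseP _ _ _ _).1 (H _ V); exists r => //.
  move=> y1 y2 t Oy h1 h2 t0 tr.
  have [q [/= [[z1 z2] Oz <-] /= [h4 h5]]] := Hr y1 y2 t Oy h1 h2 t0 tr.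
  by exists z1, z2.
move=> H V /nbhs_pairP[s s0 sV]; apply/moving_baseP.
have [r r0 Hr] := H s s0; exists r => // y1 y2 t Oy h1 h2 t0 tr.
have [z1 [z2 [Oz h4 h5]]] := Hr y1 y2 t Oy h1 h2 t0 tr.
exists (t^-1 *: (z1 - y1), t^-1 *: (z2 - y2)); split; last exact: sV.
by exists (z1, z2).
Qed.

Lemma regular_tangent_sub_paratingent Omega x1 x2 : Omega (x1, x2) ->
  regular_tangent_cone Omega (x1, x2) `<=` paratingent_cone Omega (x1, x2).
Proof.
move=> Ox [w1 w2] /regular_tangentP H; apply/paratingentP => s s0.
have [r r0 Hr] := H s s0.
have m0 : 0 < Num.min r s by rewrite lt_min r0.
have : Num.min r s / 2 < Num.min r s by rewrite ltr_pdivrMr// ltr_pMr// ltr1n.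
rewrite lt_min => /andP[mr ms].
have m20 : 0 < Num.min r s / 2 by rewrite divr_gt0.
have [||z1 [z2 [Oz h1 h2]]] := Hr x1 x2 (Num.min r s / 2) Ox _ _ m20 mr.
- by rewrite subrr normr0.
- by rewrite subrr normr0.
by exists x1, x2, (Num.min r s / 2), z1, z2; split => //; rewrite subrr normr0.
Qed.

End MovingBase.

Section ProtoDifferentiability.
Context {R : realType} {Y Z : finHilbertType R}.
Variables (g : Y -> \bar R) (O : set Y) (theta : Z -> \bar R) (Xi : Y -> Z).
Variables (P : {linear Z -> Z}) (c : R).
Hypothesis fd : framed_decomposition g O theta Xi P c.

Local Notation C := (minorants theta).
Local Notation D u := ('d Xi u).
Local Notation interior := (interior_minorant theta P).

(** Difference quotients of the derivative, paired with a varying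
    multiplier. *)
Lemma derivative_estimate (u0 : Y) (z0 : Z) (w : Y) : O u0 -> exists2 M : R, 0 <= M &
  forall s : R, 0 < s -> s <= 1 -> exists2 rho : R, 0 < rho &
  forall (u : Y) (t : R) (w' : Y) (z : Z) (v : Y), `|u - u0| < rho -> 0 < t -> t < rho ->
  `|w' - w| <= s -> `|z - z0| <= s ->
  `|dotp z ((D (u + t *: w') v : Z) - D u v) - t * dotp z0 (hess Xi u0 w v)|
    <= t * (s * M * `|v|).
Proof.
move=> Ou0; have [B B0 HB] := hess_bounded (fd_smooth fd) Ou0.
have n1 : 0 < `|w| + 2 by rewrite ltr_wpDl.
have m1 : 0 <= `|w| + 1 by rewrite addr_ge0.
have k1 : 0 <= `|z0| + 1 by rewrite addr_ge0.
exists ((`|z0| + 1) * (`|w| + 1) + B * (`|w| + 1) + `|z0| * B).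
  by rewrite !addr_ge0// mulr_ge0.
move=> s s0 s1.
have [r r0 Hr] := C2_expansion (fd_open fd) (fd_smooth fd) Ou0 s0.
exists (r / (`|w| + 2)); first by rewrite divr_gt0.
move=> u t w' z v ur t0 tr w's zs.
have zz : `|z| <= `|z0| + 1.
  have := ler_normD (z - z0) z0; rewrite subrK; lra.
have [ur' vr w'w] := ray_in_ball ur t0 tr (le_trans w's s1).
have [_ /(_ v) T _] := Hr _ _ vr ur'.
have vu : u + t *: w' - u = t *: w' by rewrite addrAC subrr add0r.
rewrite vu in T.
set H := hess Xi u0 in HB T *.
have HZ a : H (t *: a) v = t *: H a v by rewrite /H /hess linearZ.
have HBl a b : H (a - b) v = H a v - H b v by rewrite /H /hess linearB.
rewrite HZ in T; set X := (D (u + t *: w') v : Z) - D u v in T *.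
have -> : dotp z X - t * dotp z0 (H w v) =
    dotp z (X - t *: H w' v) + t * (dotp (z - z0) (H w' v) + dotp z0 (H (w' - w) v)).
  by rewrite HBl !dotE; ring.
apply: le_trans (ler_normD _ _) _; rewrite normrM gtr0_norm//.
have -> : t * (s * ((`|z0| + 1) * (`|w| + 1) + B * (`|w| + 1) + `|z0| * B) * `|v|) =
  (`|z0| + 1) * (s * (t * (`|w| + 1)) * `|v|) +
  t * (s * (B * (`|w| + 1) * `|v|) + `|z0| * (B * s * `|v|)) by ring.
apply: lerD.
  apply: le_trans (normr_dot _ _) _; apply: ler_pM => //; apply: le_trans T _.
  by rewrite ler_wpM2r// ler_wpM2l ?(ltW s0)// normrZ gtr0_norm// ler_wpM2l// ltW.
rewrite ler_wpM2l ?(ltW t0)//; apply: le_trans (ler_normD _ _) _; apply: lerD.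
  apply: le_trans (normr_dot _ _) _; apply: ler_pM => //.
  by apply: le_trans (HB _ _) _; rewrite ler_wpM2r// ler_wpM2l.
apply: le_trans (normr_dot _ _) _; rewrite ler_wpM2l//.
by apply: le_trans (HB _ _) _; rewrite ler_wpM2r// ler_wpM2l.
Qed.

(** The gradient of [u |-> <z0, 'd Xi u v>] in the direction [w], as a vector. *)
Lemma hess_gradient (u0 : Y) (z0 : Z) (w : Y) : O u0 ->
  exists h : Y, forall v, dotp h v = dotp z0 (hess Xi u0 w v).
Proof.
move=> Ou0.
have llin : linear (fun v => dotp z0 (hess Xi u0 w v) : R^o).
  by move=> a x x'; rewrite (hess_linearr (fd_smooth fd) w Ou0) dotDr dotZr.
pose ll : {linear Y -> R^o} := HB.pack (fun v => dotp z0 (hess Xi u0 w v) : R^o)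
  (GRing.isLinear.Build _ _ _ _ _ llin).
by have [h hE] := riesz ll; exists h => v; rewrite -hE.
Qed.

(** The vectors [(w, q)] found here form the tangent space of the graph seen as
    a manifold. The variation of the multiplier between two points of the graph
    is invisible on the kernel at the first point, which is why [v] is first
    corrected into that kernel. *)
Lemma paratingent_graph u0 z0 e w q h : regular_at O Xi P u0 -> P (Xi u0) = 0 ->
  interior z0 e -> (forall v, dotp h v = dotp z0 (hess Xi u0 w v)) ->
  paratingent_cone (gph (subdiff g)) (u0, adjoint (D u0) z0) (w, q) ->
  P (D u0 w) = 0 /\ forall v, P (D u0 v) = 0 -> dotp (q - h) v = 0.
Proof.
move=> reg PX0 int0 hE /paratingentP H.
have [M1 M10 HM1] := first_order_estimate fd w reg.1.
have [M2 M20 HM2] := derivative_estimate z0 w reg.1.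
have approx s : 0 < s -> s <= 1 -> exists u t w' q' z z', [/\ `|u - u0| < s, 0 < t,
   P (Xi u) = 0 /\ P (Xi (u + t *: w')) = 0,
   [/\ P (z' - z) = z' - z, `|q' - q| < s &
     t *: q' = adjoint (D (u + t *: w')) z' - adjoint (D u) z] &
   `|Xi (u + t *: w') - Xi u - t *: (D u0 w : Z)| <= t * (s * M1) /\
   forall v, `|dotp z' ((D (u + t *: w') v : Z) - D u v) - t * dotp h v|
      <= t * (s * M2 * `|v|)].
  move=> s0 s1; have [r1 r10 Hr1] := HM1 s s0 s1; have [r2 r20 Hr2] := HM2 s s0 s1.
  have [r3 r30 Hr3] := subdiff_graph_near fd reg int0 s0.
  have k1 : 0 < `|w| + `|q| + 3 by rewrite ltr_wpDl// addr_ge0.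
  pose rho := Num.min (Num.min s (r3 / (`|w| + `|q| + 3))) (Num.min r1 r2).
  have [|u [y [t [u' [y' [suby us ys [t0 ts] [suby' ws qs]]]]]]] := H rho.
    by rewrite !lt_min s0 r10 r20 divr_gt0.
  move: us ys ts ws qs; rewrite !lt_min.
  move=> /andP[/andP[us u3] /andP[ur1 ur2]] /andP[/andP[_ y3] _].
  move=> /andP[/andP[_ t3] /andP[tr1 tr2]] /andP[/andP[ws _] _] /andP[/andP[qs _] _].
  set w' := t^-1 *: (u' - u) in ws; set q' := t^-1 *: (y' - y) in qs.
  have u'E : u' = u + t *: w' by rewrite scalerA divff ?gt_eqF// scale1r addrC subrK.
  have y'E : y' = y + t *: q' by rewrite scalerA divff ?gt_eqF// scale1r addrC subrK.
  have kk : r3 / (`|w| + `|q| + 3) * (`|w| + `|q| + 3) = r3 by rewrite divfK// gt_eqF.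
  set k := r3 / _ in kk u3 y3 t3.
  have k0 : 0 < k by rewrite divr_gt0.
  clearbody k w' q'.
  have w'w : `|w'| <= `|w| + 1 by have := ler_normD (w' - w) w; rewrite subrK; lra.
  have q'q : `|q'| <= `|q| + 1 by have := ler_normD (q' - q) q; rewrite subrK; lra.
  have kr3 : k <= r3 by rewrite -kk ler_peMr ?(ltW k0)//; have := normr_ge0 w; have := normr_ge0 q; lra.
  have kw := mulr_ge0 (ltW k0) (normr_ge0 w); have kq := mulr_ge0 (ltW k0) (normr_ge0 q).
  have u'3 : `|u' - u0| < r3.
    rewrite u'E addrAC; apply: le_lt_trans (ler_normD _ _) _; rewrite normrZ gtr0_norm//.
    have : t * `|w'| <= k * (`|w| + 1) by apply: ler_pM; rewrite // ltW.
    move: kk u3 kw kq; move: `|u - u0| `|w| `|q| => A B B'; clear -fd k0; lra.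
  have y'3 : `|y' - adjoint (D u0) z0| < r3.
    rewrite y'E addrAC; apply: le_lt_trans (ler_normD _ _) _; rewrite normrZ gtr0_norm//.
    have : t * `|q'| <= k * (`|q| + 1) by apply: ler_pM; rewrite // ltW.
    move: kk y3 kw kq; move: `|y - _| `|w| `|q| => A B B'; clear -fd k0; lra.
  have [z [regu PXu intz zs yE]] := Hr3 u y (lt_le_trans u3 kr3) (lt_le_trans y3 kr3) suby.
  have [z' [regu' PXu' intz' zs' yE']] := Hr3 u' y' u'3 y'3 suby'.
  exists u, t, w', q', z, z'; rewrite -u'E -yE -yE' y'E; split => //.
  - split; [|by []|by rewrite addrC addKr].
    exact: fd_Pdiff fd _ _ (interior_minorantW intz') (interior_minorantW intz).
  - split; first by rewrite u'E; apply: Hr1 => //; exact: ltW.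
    by move=> v; rewrite u'E hE; apply: Hr2 => //; exact: ltW.
split.
  apply/eqP; rewrite -normr_le0 -oppr_ge0.
  apply: (@ge0_of_scaled _ _ M1) => s s0 s2; rewrite lerN2.
  have [|u [t [w' [q' [z [z' [_ t0 [PXu PXu'] _ [T _]]]]]]]] := approx s s0; first lra.
  have := le_trans (normP fd _) T.
  have PZ : P (t *: (D u0 w : Z)) = t *: P (D u0 w) by rewrite linearZ.
  by rewrite !(linearB P)/= PXu PXu' PZ subrr sub0r normrN normrZ gtr0_norm// ler_pM2l.
move=> v Pv; apply/eqP; rewrite -normr_le0 -oppr_ge0.
have [L [rL [L0 rL0 HL]]] := regular_solve_linear fd reg.
have [K [rK [K0 rK0 HK]]] := C2_bounds (fd_open fd) (fd_smooth fd) reg.1.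
have LK : 0 <= L * (K * `|v|) by rewrite !mulr_ge0.
apply: (@ge0_of_scaled _ _ ((M2 + 1) * (`|v| + L * (K * `|v|)) +
    `|q - h| * (L * (K * `|v|)))) => s s0 s2; rewrite lerN2.
pose s' := Num.min s (Num.min rL rK).
have s'0 : 0 < s' by rewrite !lt_min s0 rL0.
have s's : s' <= s by rewrite ge_min lexx.
have [|u [t [w' [q' [z [z' [us t0 _ [Pzz qs tq] [_ T]]]]]]]] := approx s' s'0; first lra.
move: us; rewrite !lt_min => /and3P[us urL urK].
have u00 : `|u0 - u0| < rK by rewrite subrr normr0.
have [_ _ /(_ v) T2 _ _] := HK u u0 urK u00.
have [d dle Pd] := HL u (- D u v) urL.
have {}dle : `|d| <= s * (L * (K * `|v|)).
  apply: le_trans dle _.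
  have -> : P (- D u v) = - P ((D u v : Z) - D u0 v) by rewrite linearN linearB/= Pv subr0.
  rewrite normrN; apply: le_trans (ler_wpM2l L0 (le_trans (normP fd _) T2)) _.
  have -> : s * (L * (K * `|v|)) = L * (K * s * `|v|) by ring.
  by rewrite ler_wpM2l// ler_wpM2r// ler_wpM2l// ltW.
pose vu := v + d.
have PDvu : P (D u vu) = 0.
  have -> : D u vu = (D u v : Z) + D u d by rewrite /vu linearD.
  by rewrite linearD/= Pd linearN subrr.
have tqv : t * dotp q' vu = dotp z' ((D (u + t *: w') vu : Z) - D u vu).
  rewrite -dotZl tq dotBl !dot_adj dotBr.
  have : dotp (z' - z) (D u vu) = 0 by rewrite -Pzz (fd_Psym fd) PDvu dot0r.
  by rewrite dotBl; move: (dotp z' (D u vu)) (dotp z (D u vu)) => a b; clear -fd; lra.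
have vul : `|vu| <= `|v| + L * (K * `|v|).
  rewrite /vu; apply: le_trans (ler_normD _ _) _; rewrite lerD2l; apply: le_trans dle _.
  by rewrite ler_piMl// (le_trans s2)// invf_le1// ler1n.
have T3 : `|dotp (q' - h) vu| <= s * M2 * `|vu|.
  have := T vu; rewrite -tqv -mulrBr normrM gtr0_norm// ler_pM2l// -dotBl.
  by move=> /le_trans; apply; rewrite ler_wpM2r// ler_wpM2r.
have -> : dotp (q - h) v = dotp (q' - h) vu - dotp (q' - q) vu - dotp (q - h) d.
  by rewrite /vu !dotE; ring.
apply: le_trans (ler_normB _ _) _; apply: le_trans (lerD (ler_normB _ _) (lexx _)) _.
have T4 : `|dotp (q' - q) vu| <= s * `|vu|.
  apply: le_trans (normr_dot _ _) _; rewrite ler_wpM2r// (le_trans (ltW qs))//.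
have T5 : `|dotp (q - h) d| <= `|q - h| * (s * (L * (K * `|v|))).
  by apply: le_trans (normr_dot _ _) _; rewrite ler_wpM2l.
have T6 : s * ((M2 + 1) * `|vu|) <= s * ((M2 + 1) * (`|v| + L * (K * `|v|))).
  by rewrite ler_wpM2l ?(ltW s0)// ler_wpM2l// addr_ge0.
move: T3 T4 T5 T6; move: `|dotp (q' - h) _| `|dotp (q' - q) _| `|dotp (q - h) _|.
by move: `|vu| `|q - h| (L * _) => a1 a2 a3 a4 a5 a6; clear -fd; lra.
Qed.

(** Conversely, from any point of the graph one moves along the zero set of
    [P \o Xi] in the direction [w] while the multiplier moves along [l]. *)
Lemma regular_tangent_graph u0 z0 e w q h : regular_at O Xi P u0 -> P (Xi u0) = 0 ->
  interior z0 e -> (forall v, dotp h v = dotp z0 (hess Xi u0 w v)) ->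
  P (D u0 w) = 0 -> (forall v, P (D u0 v) = 0 -> dotp (q - h) v = 0) ->
  regular_tangent_cone (gph (subdiff g)) (u0, adjoint (D u0) z0) (w, q).
Proof.
move=> reg PX0 int0 hE PDw qh; apply/regular_tangentP => s s0.
have [l Pl lE] := ker_annihilator fd reg qh.
have [M2 M20 HM2] := derivative_estimate z0 w reg.1.
have [K [rK [K0 rK0 HK]]] := C2_bounds (fd_open fd) (fd_smooth fd) reg.1.
have e0 := int0.1.
have m2 : 0 < 2 * (M2 + 1) by rewrite mulr_gt0// ltr_wpDl.
pose s1 := Num.min 1 (Num.min s (s / (2 * (M2 + 1)))).
have s10 : 0 < s1 by rewrite !lt_min ltr01 s0 divr_gt0.
have s11 : s1 <= 1 by rewrite ge_min lexx.
have s1s : s1 <= s by rewrite !ge_min lexx !orbT.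
have s1M : s1 * M2 < s / 2.
  have : s1 * (2 * (M2 + 1)) <= s by rewrite -ler_pdivlMr// !ge_min lexx !orbT.
  have := mulr_ge0 (ltW s10) M20; lra.
clearbody s1.
have [r2 r20 Hr2] := HM2 s1 s10 s11.
have wfin : (epi_limit Xi P u0 z0 w <= (dotp z0 (hess Xi u0 w w))%:E)%E.
  by rewrite /epi_limit PDw eqxx.
have [r1 r10 Hr1] := epi_limit_upper fd reg s10 wfin.
have l1 : 0 < `|l| + 1 by rewrite ltr_wpDl.
pose m := Num.min r1 (s1 / 2).
have m0 : 0 < m by rewrite lt_min r10 divr_gt0.
have [r3 r30 Hr3] := subdiff_graph_near fd reg int0 m0.
have lk : 0 < 2 * (`|l| * K + 1) by rewrite mulr_gt0// ltr_wpDl// mulr_ge0.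
pose rho1 := Num.min (Num.min r1 r2) (Num.min r3 rK).
pose rho2 := Num.min (s / (2 * (`|l| * K + 1)))
  (Num.min (e / 4 / (`|l| + 1)) (s1 / 2 / (`|l| + 1))).
exists (Num.min rho1 rho2).
  by rewrite !lt_min r10 r20 r30 rK0 !divr_gt0.
move=> u y t suby; rewrite !lt_min.
move=> /andP[/andP[/andP[ur1 ur2] /andP[ur3 urK]] /and3P[ul _ _]].
move=> /andP[/andP[_ /andP[yr3 _]] _] t0.
move=> /andP[/andP[/andP[tr1 tr2] _] /and3P[_ te ts]].
have [z [regu PXu intz zs yE]] := Hr3 u y ur3 yr3 suby.
move: zs; rewrite lt_min => /andP[zr1 zs].
have Cz := interior_minorantW intz.
have [w' [ws _ Ov PXv _]] := Hr1 u t z ur1 t0 tr1 Cz zr1 PXu.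
have tl : `|t *: l| <= t * (`|l| + 1).
  by rewrite normrZ gtr0_norm// ler_wpM2l ?(ltW t0)// lerDl.
rewrite ltr_pdivlMr// in te; rewrite ltr_pdivlMr// in ts.
have Cz' : C (z + t *: l).
  apply: (@interior_minorantW _ _ _ P _ (e / 2 / 2)).
  have zz : z + t *: l - z = t *: l by rewrite addrC addKr.
  apply: (interior_perturb fd intz); rewrite zz; first by rewrite linearZ/= Pl.
  by move: tl te; move: `|t *: l| => a; clear -fd; lra.
exists (u + t *: w'), (adjoint (D (u + t *: w')) (z + t *: l)); split.
- exact: (subdiff_ker fd Ov Cz' PXv).
- have -> : t^-1 *: (u + t *: w' - u) = w'.
    by rewrite addrAC subrr add0r scalerA mulVf ?gt_eqF// scale1r.
  exact: lt_le_trans ws s1s.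
have zz' : `|z + t *: l - z0| <= s1.
  rewrite addrAC; apply: le_trans (ler_normD _ _) _.
  by move: tl ts zs; move: `|t *: l| `|z - z0| => a b; clear -fd; lra.
have u00 : `|u0 - u0| < rK by rewrite subrr normr0.
rewrite ltr_pdivlMr// in ul.
have bnd : `|l| * (K * `|u - u0|) + s1 * M2 < s.
  have := mulr_ge0 (normr_ge0 l) (mulr_ge0 K0 (normr_ge0 (u - u0))).
  have := normr_ge0 (u - u0).
  by move: ul s1M; move: `|u - u0| `|l| (s1 * M2) => a b d; clear -fd; lra.
apply: le_lt_trans bnd; apply: norm_le_dot.
  by rewrite addr_ge0// ?mulr_ge0// ltW.
move=> v; have [_ _ /(_ v) T2 _ _] := HK u u0 urK u00.
have := Hr2 u t w' (z + t *: l) v ur2 t0 tr2 (ltW ws) zz'.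
rewrite -hE => T.
have -> : dotp (t^-1 *: (adjoint (D (u + t *: w')) (z + t *: l) - y) - q) v =
    t^-1 * (dotp (z + t *: l) ((D (u + t *: w') v : Z) - D u v) - t * dotp h v)
    + dotp l ((D u v : Z) - D u0 v).
  rewrite yE dotBl dotZl (dotBl (adjoint _ _)) !dot_adj.
  rewrite !dotBr -lE dotBl !(dotDl z) !dotZl.
  by field; rewrite gt_eqF.
have A1 : t^-1 * (dotp (z + t *: l) ((D (u + t *: w') v : Z) - D u v) - t * dotp h v)
    <= s1 * M2 * `|v|.
  by rewrite ler_pdivrMl//; exact: le_trans (ler_norm _) T.
have A2 : dotp l ((D u v : Z) - D u0 v) <= `|l| * (K * `|u - u0| * `|v|).
  by apply: le_trans (dot_le_norm _ _) _; rewrite ler_wpM2l.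
by move: A1 A2; move: (t^-1 * _) (dotp l _) => a b; clear -fd; lra.
Qed.

Lemma strictly_proto_of_interior u0 z0 e : regular_at O Xi P u0 ->
  P (Xi u0) = 0 -> interior z0 e ->
  strictly_proto_differentiable (subdiff g) u0 (adjoint (D u0) z0).
Proof.
move=> reg PX0 int0; have Cz0 := interior_minorantW int0.
apply/seteqP; split.
  exact: regular_tangent_sub_paratingent (subdiff_ker fd reg.1 Cz0 PX0).
move=> [w q] wq; have [h hE] := hess_gradient z0 w reg.1.
have [PDw qh] := paratingent_graph reg PX0 int0 hE wq.
exact: regular_tangent_graph reg PX0 int0 hE PDw qh.
Qed.

End ProtoDifferentiability.

(** * Necessity of an interior multiplier *)

Section Necessity.
Context {R : realType} {Y Z : finHilbertType R}.
Variables (g : Y -> \bar R) (O : set Y) (theta : Z -> \bar R) (Xi : Y -> Z).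
Variables (P : {linear Z -> Z}) (c : R).
Hypothesis fd : framed_decomposition g O theta Xi P c.

Local Notation C := (minorants theta).
Local Notation D u := ('d Xi u).
Local Notation interior := (interior_minorant theta P).

(** Curves from [u0] on which [P (Xi _)] moves at constant speed [x]. *)
Lemma ray_solve u0 w x s : regular_at O Xi P u0 -> P (Xi u0) = 0 ->
  P (D u0 w) = x -> P x = x -> 0 < s -> exists2 rho : R, 0 < rho & forall t,
  0 < t -> t < rho -> exists2 w', `|w' - w| < s & P (Xi (u0 + t *: w')) = t *: x.
Proof.
move=> reg PX0 PDw Px s0.
have [M1 M10 HM1] := first_order_estimate fd w reg.1.
have [L [rL [L0 rL0 HL]]] := regular_solve fd reg.
have lm : 0 < L * M1 + 1 by rewrite ltr_wpDl// mulr_ge0.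
pose s2 := Num.min 1 (s / (L * M1 + 1)).
have s20 : 0 < s2 by rewrite lt_min ltr01 divr_gt0.
have s21 : s2 <= 1 by rewrite ge_min lexx.
have s2s : L * (s2 * M1) < s.
  have : s2 * (L * M1 + 1) <= s by rewrite -ler_pdivlMr// ge_min lexx orbT.
  have -> : L * (s2 * M1) = s2 * (L * M1) by ring.
  rewrite mulrDr mulr1; lra.
clearbody s2.
have [r1 r10 Hr1] := HM1 s2 s20 s21.
have n1 : 0 < `|w| + M1 + 1 by rewrite ltr_wpDl// addr_ge0.
exists (Num.min r1 (rL / (`|w| + M1 + 1))); first by rewrite lt_min r10 divr_gt0.
move=> t t0; rewrite lt_min ltr_pdivlMr// => /andP[tr1 trL].
have u00 : `|u0 - u0| < r1 by rewrite subrr normr0.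
have ww : `|w - w| <= s2 by rewrite subrr normr0 ltW.
have T := Hr1 u0 t w u00 t0 tr1 ww.
have res : `|P (t *: x - Xi (u0 + t *: w))| <= t * (s2 * M1).
  have -> : P (t *: x - Xi (u0 + t *: w)) = - P (Xi (u0 + t *: w) - Xi u0 - t *: (D u0 w : Z)).
    have PZ : P (t *: (D u0 w : Z)) = t *: x by rewrite linearZ/= PDw.
    have PZ2 : P (t *: x) = t *: x by rewrite linearZ/= Px.
    by rewrite !(linearB P)/= PX0 PZ PZ2 subr0 opprB.
  by rewrite normrN (le_trans (normP fd _)).
have tw0 := mulr_ge0 (ltW t0) (normr_ge0 w); have tM0 := mulr_ge0 (ltW t0) M10.
have [||d dle Pd] := HL (u0 + t *: w) (t *: x).
- by rewrite addrAC subrr add0r normrZ gtr0_norm//; move: trL tw0 tM0; move: `|w| => a; clear -fd t0; lra.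
- apply: le_lt_trans res _.
  have : t * (s2 * M1) <= t * M1 by rewrite ler_wpM2l ?(ltW t0)// ler_piMl.
  move: trL tw0 tM0; move: `|w| => a; clear -fd t0; lra.
exists (w + t^-1 *: d).
  rewrite addrAC subrr add0r normrZ gtr0_norm ?invr_gt0// ltr_pdivrMl//.
  apply: le_lt_trans dle _; apply: le_lt_trans (ler_wpM2l L0 res) _.
  have -> : L * (t * (s2 * M1)) = t * (L * (s2 * M1)) by ring.
  by rewrite ltr_pM2l.
by rewrite scalerDr scalerA divff ?gt_eqF// scale1r addrA Pd linearZ/= Px.
Qed.

(** [Xi v] and [t *: x] differ by a vector orthogonal to [U], on which [theta]
    and all minorants agree. *)
Lemma theta_ray z x v t : C z -> (theta x <= (dotp z x)%:E)%E -> 0 < t ->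
  P (Xi v) = t *: x -> theta (Xi v) = (dotp z (Xi v))%:E.
Proof.
move=> Cz thx t0 PXv; apply/eqP; rewrite eq_le Cz andbT.
have -> : Xi v = t *: x + (Xi v - t *: x) by rewrite addrC subrK.
rewrite (fd_orth fd _ Cz); last by rewrite -PXv linearB/= (fd_PP fd) subrr.
rewrite (thetaZ (fd_sublinear fd))// (dotDr (t *: x)) EFinD leeD2r// dotZr EFinM.
by rewrite lee_pmul2l.
Qed.

Lemma interior_segment z0 z1 e (tau : R) : C z0 -> interior z1 e -> 0 < tau -> tau < 1 ->
  interior (z0 + tau *: (z1 - z0)) (tau * e).
Proof.
move=> Cz0 [e0 He] t0 t1; split; first by rewrite mulr_gt0.
move=> x; have h0 := Cz0 x; have h1 := He x.
case: (theta x) h0 h1 => [r| |]; [|by move=> _ _; rewrite leey|by []].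
rewrite !lee_fin => h0 h1; rewrite !dotE.
have : (1 - tau) * dotp z0 x <= (1 - tau) * r by rewrite ler_wpM2l// subr_ge0 ltW.
have : tau * (dotp z1 x + e * `|P x|) <= tau * r by rewrite ler_wpM2l// ltW.
move: (dotp _ _) (dotp _ _) `|P x| => a b d; lra.
Qed.

Lemma adj_segment_near u0 z0 z1 (r : R) : 0 < r -> exists tau : R, [/\ 0 < tau, tau < 1 &
  `|adjoint (D u0) (z0 + tau *: (z1 - z0)) - adjoint (D u0) z0| < r].
Proof.
move=> r0; have N1 : 0 < `|adjoint (D u0) (z1 - z0)| + 1 by rewrite ltr_wpDl.
have m0 : 0 < Num.min 1 (r / (`|adjoint (D u0) (z1 - z0)| + 1)) by rewrite lt_min ltr01 divr_gt0.
exists (Num.min 1 (r / (`|adjoint (D u0) (z1 - z0)| + 1)) / 2).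
set m := Num.min _ _ in m0 *.
have m2 : 0 < m / 2 by rewrite divr_gt0.
have mm : m / 2 < m by rewrite ltr_pdivrMr// ltr_pMr// ltr1n.
split => //; first by rewrite (lt_le_trans mm)// ge_min lexx.
rewrite adjointD adjointZ addrC addKr normrZ gtr0_norm//.
have : m / 2 * (`|adjoint (D u0) (z1 - z0)| + 1) < r.
  by rewrite -ltr_pdivlMr// (lt_le_trans mm)// ge_min lexx orbT.
by apply: le_lt_trans; rewrite ler_wpM2l ?(ltW m2)// lerDl.
Qed.

Lemma interior_by_contra z0 : C z0 ->
  (forall x, P x = x -> x != 0 -> (theta x <= (dotp z0 x)%:E)%E -> False) ->
  exists e, interior z0 e.
Proof.
move=> Cz0 H; apply: (fd_strict fd) => // x Px x0.
by rewrite ltNge; apply/negP => h; exact: H Px x0 h.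
Qed.

(** If a direction [x] of [U] is normal to the minorants at [z0], the second
    order quotients along a curve with [P (Xi _) = t *: x] stay bounded at
    [z0], whereas they blow up for the interior multipliers close to [z0]. *)
Lemma interior_of_strictly_twice_epi u0 z0 : regular_at O Xi P u0 ->
  P (Xi u0) = 0 -> C z0 ->
  strictly_twice_epi_differentiable g u0 (adjoint (D u0) z0) ->
  exists e, interior z0 e.
Proof.
move=> reg PX0 Cz0 [h [sup_eq inf_eq]].
apply: interior_by_contra => // x Px x0 thx.
have [z1 [e1 int1]] := fd_interior fd; have e10 := int1.1.
have [B [PDB _]] := regular_section reg.
pose w := B x; have PDw : P (D u0 w) = x by rewrite /w PDB.
have [M1 M10 HM1] := first_order_estimate fd w reg.1.
have [M2 M20 HM2] := second_order_estimate fd z0 w reg.1.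
have sub0 := subdiff_ker fd reg.1 Cz0 PX0.
have nx : 0 < `|x| by rewrite normr_gt0.
pose a := dotp z0 (hess Xi u0 w w) + M2.
have wa_sup : PK_limsup (filter_prod (0 : R)^'+ (attentive_nbhs g u0 (adjoint (D u0) z0)))
    (fun q => epi (second_diff_quotient g q.2.1 q.2.2 q.1)) (w, a).
  move=> V /nbhs_pairP[d d0 dV] A FA.
  have [r r0 Hr] := filter_prod_attentive FA.
  have s0 : 0 < Num.min d 1 by rewrite lt_min d0 ltr01.
  have [r1 r10 Hr1] := ray_solve reg PX0 PDw Px s0.
  have [r2 r20 Hr2] := HM2 1 ltr01 (lexx _).
  have m0 : 0 < Num.min r (Num.min r1 r2) by rewrite !lt_min r0 r10.
  have mm : Num.min r (Num.min r1 r2) / 2 < Num.min r (Num.min r1 r2).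
    by rewrite ltr_pdivrMr// ltr_pMr// ltr1n.
  have t0 : 0 < Num.min r (Num.min r1 r2) / 2 by rewrite divr_gt0.
  move: mm t0; set t := _ / 2; rewrite !lt_min => /and3P[tr tr1 tr2] t0.
  have [w' + PXv] := Hr1 t t0 tr1; rewrite lt_min => /andP[wd w1].
  exists (t, (u0, adjoint (D u0) z0)).
    by apply: Hr => //; rewrite subrr normr0.
  have u00 : `|u0 - u0| < r2 by rewrite subrr normr0.
  have z00 : `|z0 - z0| <= 1 by rewrite subrr normr0.
  have [_ Ov T] := Hr2 u0 t w' z0 u00 t0 tr2 (ltW w1) z00.
  exists (w', a); split; last by apply: dV => //; rewrite subrr normr0.
  rewrite /epi /= (second_diff_quotient_le fd)//; last exact: reg.1.
  rewrite (theta_ray Cz0 thx t0 PXv) lee_fin.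
  move: T; rewrite ler_norml !dotBr dotZr /a => /andP[_].
  move: (dotp z0 (Xi _)) (dotp z0 (Xi _)) (dotp z0 (hess _ _ _ _)) => a1 a2 a3.
  by move: (dotp z0 _) => a4; clear -fd; lra.
have wa_inf := wa_sup; rewrite sup_eq -inf_eq in wa_inf.
(* This variation of the direction keeps half of the speed [x]. *)
pose s1 := Num.min 1 (`|x| / (2 * (M1 + 1))).
have m1 : 0 < 2 * (M1 + 1) by rewrite mulr_gt0// ltr_wpDl.
have s10 : 0 < s1 by rewrite lt_min ltr01 divr_gt0.
have s11 : s1 <= 1 by rewrite ge_min lexx.
have s1M : s1 * M1 <= `|x| / 2.
  have : s1 * (2 * (M1 + 1)) <= `|x| by rewrite -ler_pdivlMr// ge_min lexx orbT.
  move: `|x| => b; lra.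
clearbody s1.
have V : nbhs (w, a) [set q : Y * R | `|q.1 - w| < s1 /\ `|q.2 - a| < 1].
  apply/nbhs_pairP; exists s1 => // y1 y2 h1 h2; split => //=.
  exact: lt_le_trans h2 s11.
have [r r0 Hr] := filter_prod_attentive (wa_inf _ V).
have [tau [tau0 tau1 ytau]] := adj_segment_near u0 z0 z1 r0.
set z := z0 + tau *: (z1 - z0) in ytau.
have intz : interior z (tau * e1) by apply: interior_segment.
have Cz := interior_minorantW intz.
have subz := subdiff_ker fd reg.1 Cz PX0.
have [N2 N20 HN2] := second_order_estimate fd z w reg.1.
have [r1 r10 Hr1] := HM1 s1 s10 s11; have [r2 r20 Hr2] := HN2 s1 s10 s11.
pose q := dotp z (hess Xi u0 w w).
pose b := `|a + 1 - q + s1 * N2|.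
have : 0 <= - (tau * e1 * `|x|); last first.
  by have := mulr_gt0 (mulr_gt0 tau0 e10) nx; move: (_ * _ * `|x|) => A; clear -fd; lra.
apply: (@ge0_of_scaled _ _ b) => s s0 _; rewrite lerN2.
have m0 : 0 < Num.min (Num.min s r) (Num.min r1 r2) by rewrite !lt_min s0 r0 r10.
have mm : Num.min (Num.min s r) (Num.min r1 r2) / 2 < Num.min (Num.min s r) (Num.min r1 r2).
  by rewrite ltr_pdivrMr// ltr_pMr// ltr1n.
have t0 : 0 < Num.min (Num.min s r) (Num.min r1 r2) / 2 by rewrite divr_gt0.
move: mm t0; set t := _ / 2; rewrite !lt_min => /andP[/andP[ts tr] /andP[tr1 tr2]] t0.
have [[w' a'] [/= quo [ws a's]]] := Hr t _ t0 tr ytau subz.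
have u01 : `|u0 - u0| < r1 by rewrite subrr normr0.
have u02 : `|u0 - u0| < r2 by rewrite subrr normr0.
have zz : `|z - z| <= s1 by rewrite subrr normr0 ltW.
have T1 := Hr1 u0 t w' u01 t0 tr1 (ltW ws).
have [_ Ov T2] := Hr2 u0 t w' z u02 t0 tr2 (ltW ws) zz.
have /= low := quotient_lower fd reg.1 Ov intz PX0 t0 quo.
have lowP : t * (`|x| / 2) <= `|P (Xi (u0 + t *: w'))|.
  have -> : P (Xi (u0 + t *: w')) =
      t *: x + P (Xi (u0 + t *: w') - Xi u0 - t *: (D u0 w : Z)).
    have PZ : P (t *: (D u0 w : Z)) = t *: x by rewrite linearZ/= PDw.
    by rewrite (linearB P)/= (linearB P)/= PX0 PZ subr0 [RHS]addrC subrK.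
  have := ler_normB (t *: x + P (Xi (u0 + t *: w') - Xi u0 - t *: (D u0 w : Z)))
    (P (Xi (u0 + t *: w') - Xi u0 - t *: (D u0 w : Z))).
  rewrite addrK normrZ gtr0_norm//.
  have := le_trans (normP fd _) T1.
  have : t * (s1 * M1) <= t * (`|x| / 2) by rewrite ler_wpM2l// ltW.
  move: `|P _| `|_ + _| `|x| => A1 A2 A3; clear -fd; lra.
have h1 : tau * e1 * (t * (`|x| / 2)) <= tau * e1 * `|P (Xi (u0 + t *: w'))|.
  by rewrite ler_wpM2l// ltW// mulr_gt0.
have h2 : tau * e1 * (t * (`|x| / 2)) <= 2^-1 * t ^+ 2 * (a' - q + s1 * N2).
  move: T2; rewrite ler_norml -/q => /andP[T2 _].
  by move: h1 low T2; move: (dotp z _) (tau * e1 * _) (tau * e1 * _) => A1 A2 A3; clear -fd; lra.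
have h3 : t * (tau * e1 * `|x|) <= t * (t * (a' - q + s1 * N2)).
  by move: h2; move: `|x| => A; clear -fd; lra.
rewrite ler_pM2l// in h3; apply: le_trans h3 _.
apply: (@le_trans _ _ (t * b)); last by rewrite /b ler_wpM2r// ltW.
rewrite ler_wpM2l ?(ltW t0)// /b (le_trans _ (ler_norm _))//.
by move: a's; rewrite ltr_norml => /andP[_]; clear -fd; lra.
Qed.

(** With such a direction [x], the vertical vector [- (D u0)^* x] is
    paratingent at the base point because the relative interior is close by;
    were it regularly tangent, moving from a point with [P (Xi _) = t *: x]
    would contradict the monotonicity of the subdifferential of [theta]. *)
Lemma interior_of_strictly_proto u0 z0 : regular_at O Xi P u0 ->
  P (Xi u0) = 0 -> C z0 ->
  strictly_proto_differentiable (subdiff g) u0 (adjoint (D u0) z0) ->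
  exists e, interior z0 e.
Proof.
move=> reg PX0 Cz0 proto; apply: interior_by_contra => // x Px x0 thx.
have [z1 [e1 int1]] := fd_interior fd; have e10 := int1.1.
have nx : 0 < `|x| by rewrite normr_gt0.
have para : paratingent_cone (gph (subdiff g)) (u0, adjoint (D u0) z0)
    (0, - adjoint (D u0) x).
  apply/paratingentP => s s0.
  have [tau [tau0 tau1 ytau]] := adj_segment_near u0 z0 z1 s0.
  set z := z0 + tau *: (z1 - z0) in ytau.
  have intz : interior z (tau * e1) by apply: interior_segment.
  have te : 0 < tau * e1 / 2 / `|x| by rewrite !divr_gt0// mulr_gt0.
  have m0 : 0 < Num.min s (tau * e1 / 2 / `|x|) by rewrite lt_min s0.
  have mm : Num.min s (tau * e1 / 2 / `|x|) / 2 < Num.min s (tau * e1 / 2 / `|x|).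
    by rewrite ltr_pdivrMr// ltr_pMr// ltr1n.
  have t0 : 0 < Num.min s (tau * e1 / 2 / `|x|) / 2 by rewrite divr_gt0.
  move: mm t0; set t := _ / 2; rewrite lt_min ltr_pdivlMr// => /andP[ts tx] t0.
  have Cz' : C (z - t *: x).
    apply: (@interior_minorantW _ _ _ P _ (tau * e1 / 2)).
    have E : z - t *: x - z = - (t *: x) by rewrite addrC addKr.
    apply: (interior_perturb fd intz); rewrite E.
      by rewrite linearN linearZ/= Px.
    by rewrite normrN normrZ gtr0_norm// ltW.
  have subz := subdiff_ker fd reg.1 (interior_minorantW intz) PX0.
  have subz' := subdiff_ker fd reg.1 Cz' PX0.
  exists u0, (adjoint (D u0) z), t, u0, (adjoint (D u0) (z - t *: x)); split => //.
    by rewrite subrr normr0.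
  split => //; first by rewrite subrr scaler0 subrr normr0.
  rewrite adjointB adjointZ addrAC subrr add0r scalerN scalerA mulVf ?gt_eqF// scale1r.
  by rewrite subrr normr0.
rewrite -proto in para; move/regular_tangentP in para.
have [B [PDB _]] := regular_section reg.
pose w := B x; have PDw : P (D u0 w) = x by rewrite /w PDB.
have [K [rK [K0 rK0 HK]]] := C2_bounds (fd_open fd) (fd_smooth fd) reg.1.
have [L [rL [L0 rL0 HL]]] := adj_bounds fd reg.1.
have [N [rN [N0 rN0 HN]]] := adj_lower fd reg.
have [rR /= rR0 HR] := (nbhs_normP _ _).1 (regular_near fd reg).
have [rW rW0 HW] := ray_solve reg PX0 PDw Px ltr01.
have w1 : 0 < `|w| + 1 by rewrite ltr_wpDl.
have w2 : 0 < `|w| + 2 by rewrite ltr_wpDl.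
pose Q := N * (1 + L * `|z0| + L * `|x|).
have Q0 : 0 <= Q by rewrite mulr_ge0// addr_ge0 ?mulr_ge0// addr_ge0// mulr_ge0.
have : 0 <= - `|x| ^+ 2; last first.
  by have := exprn_gt0 2 nx; move: (`|x| ^+ 2) => A; clear -fd; lra.
apply: (@ge0_of_scaled _ _ (Q * (`|x| + K) + `|x| * K)) => s s0 s2.
have s1 : s <= 1 by lra.
have [r r0 Hr] := para s s0.
pose rho := Num.min s (Num.min (Num.min r rK) (Num.min (Num.min rL rN) rR)).
have rho0 : 0 < rho by rewrite !lt_min s0 r0 rK0 rL0 rN0.
have lz1 : 0 < L * (`|w| + 1) * `|z0| + 1 by rewrite ltr_wpDl// !mulr_ge0// ltW.
pose tm := Num.min (Num.min r rW) (Num.min (rho / (`|w| + 2)) (r / (L * (`|w| + 1) * `|z0| + 1))).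
have tm0 : 0 < tm by rewrite !lt_min r0 rW0 !divr_gt0.
have tmm : tm / 2 < tm by rewrite ltr_pdivrMr// ltr_pMr// ltr1n.
have t0 : 0 < tm / 2 by rewrite divr_gt0.
move: tmm t0; set t := tm / 2; clearbody t; rewrite /tm 3!lt_min.
rewrite !ltr_pdivlMr// => /andP[/andP[tr trW] /andP[trho tz]] t0.
clear tm tm0.
have [w' ww PXv] := HW t t0 trW.
set v := u0 + t *: w' in PXv.
have w'w : `|w'| <= `|w| + 1.
  have := ler_normD (w' - w) w; rewrite subrK; move: ww.
  by move: `|w' - w| `|w'| `|w| => A1 A2 A3; clear -fd; lra.
have vu : `|v - u0| <= t * (`|w| + 1).
  by rewrite /v addrAC subrr add0r normrZ gtr0_norm// ler_wpM2l// ltW.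
have vrho : `|v - u0| < rho.
  by apply: le_lt_trans vu _; apply: le_lt_trans trho; rewrite ler_wpM2l ?(ltW t0)// lerD2l ler1n.
have far y : `|y - v| < t * s -> `|y - u0| < rho.
  move=> yv; have := ler_normD (y - v) (v - u0); rewrite addrA subrK.
  have : t * s <= t by rewrite ler_piMr// ltW.
  move: trho vu yv; move: `|y - v| `|v - u0| `|y - u0| `|w| => A1 A2 A3 A4.
  by clear -fd; lra.
move: (vrho); rewrite 5!lt_min => /and3P[_ /andP[vr vK] /andP[/andP[vL _] vR]].
have u0L : `|u0 - u0| < rL by rewrite subrr normr0.
have yv : subdiff g v (adjoint (D v) z0).
  have [Ov _ _ _ _] := HK v v vK vK.
  exact: (subdiff_of_minorant fd Ov Cz0 (theta_ray Cz0 thx t0 PXv) erefl).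
have yr : `|adjoint (D v) z0 - adjoint (D u0) z0| < r.
  have [_ T] := HL v u0 z0 vL u0L; apply: le_lt_trans T _.
  apply: le_lt_trans tz; rewrite mulrDr mulr1.
  apply: (@le_trans _ _ (L * (t * (`|w| + 1)) * `|z0|)).
    by rewrite ler_wpM2r// ler_wpM2l.
  have -> : t * (L * (`|w| + 1) * `|z0|) = L * (t * (`|w| + 1)) * `|z0| by ring.
  by rewrite lerDl ltW.
have [v' [y' [suby' v's y's]]] := Hr v _ t yv vr yr t0 tr.
rewrite subr0 in v's; rewrite opprK in y's.
have {}v's : `|v' - v| < t * s.
  by move: v's; rewrite normrZ gtr0_norm ?invr_gt0// ltr_pdivrMl.
have v'rho := far _ v's.
move: (v'rho); rewrite 5!lt_min => /and3P[v'us /andP[_ v'K] /andP[/andP[v'L v'N] v'R]].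
have regv' : regular_at O Xi P v' by apply: HR; rewrite /= distrC.
have [z' [b [Cz' bE zb y'E]]] := minorant_of_subdiff fd regv' suby'.
pose p := z' - z0; have Pp : P p = p by exact: fd_Pdiff fd _ _ Cz' Cz0.
(* Monotonicity: both [z'] and [z0] are minorants and [z'] is exact at [Xi v']. *)
have pos : 0 <= dotp p (P (Xi v')).
  by rewrite -(fd_Psym fd) Pp /p dotBl subr_ge0 zb -lee_fin -bE; exact: Cz0.
(* Yet the regular tangent vector forces [p] to be close to [- t *: x], while
   [P (Xi v')] is close to [t *: x]. *)
have ptx : `|p + t *: x| <= t * (s * Q).
  have Ptx : P (p + t *: x) = p + t *: x by rewrite linearD linearZ/= Pp Px.
  apply: le_trans (HN v' _ v'N Ptx) _.
  have -> : adjoint (D v') (p + t *: x) =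
      t *: (t^-1 *: (y' - adjoint (D v) z0) + adjoint (D u0) x)
      + (adjoint (D v) z0 - adjoint (D v') z0)
      + t *: (adjoint (D v') x - adjoint (D u0) x).
    rewrite scalerDr scalerA divff ?gt_eqF// scale1r.
    rewrite adjointD adjointZ adjointB -y'E.
    move: (adjoint (D v') z0) (adjoint (D v') x) (adjoint (D v) z0) (adjoint (D u0) x).
    by clear -fd => k1 k2 k3 k4; apply: dot_inj => k; rewrite !dotE; ring.
  have [_ T1] := HL v v' z0 vL v'L; have [_ T2] := HL v' u0 x v'L u0L.
  have -> : t * (s * Q) = N * (t * s + t * (s * (L * `|z0|)) + t * (s * (L * `|x|))).
    by rewrite /Q; ring.
  rewrite ler_wpM2l//; apply: le_trans (ler_normD _ _) _; apply: lerD.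
    apply: le_trans (ler_normD _ _) _; apply: lerD.
      by rewrite normrZ gtr0_norm// ler_wpM2l ?(ltW t0)// ltW.
    apply: le_trans T1 _; rewrite distrC.
    have -> : t * (s * (L * `|z0|)) = L * (t * s) * `|z0| by ring.
    by rewrite ler_wpM2r// ler_wpM2l// ltW.
  rewrite normrZ gtr0_norm// ler_wpM2l ?(ltW t0)//; apply: le_trans T2 _.
  have -> : s * (L * `|x|) = L * s * `|x| by ring.
  by rewrite ler_wpM2r// ler_wpM2l// ltW.
pose del := P (Xi v') - t *: x.
have del_le : `|del| <= K * (t * s).
  rewrite /del -PXv -linearB; apply: le_trans (normP fd _) _.
  have [_ _ _ _ T] := HK v' v v'K vK; apply: le_trans T _.
  by rewrite ler_wpM2l// ltW.
have PXv' : P (Xi v') = t *: x + del by rewrite /del addrC subrK.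
have E : dotp p (P (Xi v')) = dotp (p + t *: x) (P (Xi v')) - t * dotp x del - t ^+ 2 * `|x| ^+ 2.
  by rewrite PXv' -dotp_norm !(dotDl, dotDr, dotZl, dotZr); ring.
have A1 : dotp (p + t *: x) (P (Xi v')) <= t * (s * Q) * (t * (`|x| + K)).
  apply: le_trans (dot_le_norm _ _) _; apply: ler_pM => //.
  rewrite PXv'; apply: le_trans (ler_normD _ _) _; rewrite mulrDr; apply: lerD.
    by rewrite normrZ gtr0_norm.
  by apply: le_trans del_le _; rewrite mulrC ler_wpM2r// ler_piMr// ltW.
have A2 : - (t * dotp x del) <= t * (`|x| * (K * (t * s))).
  rewrite -mulrN ler_wpM2l ?(ltW t0)// -dotNr; apply: le_trans (dot_le_norm _ _) _.
  by rewrite normrN ler_wpM2l.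
rewrite lerN2.
have t20 : 0 < t ^+ 2 by rewrite exprn_gt0.
rewrite -(ler_pM2l t20).
have -> : t ^+ 2 * (s * (Q * (`|x| + K) + `|x| * K)) =
  t * (s * Q) * (t * (`|x| + K)) + t * (`|x| * (K * (t * s))) by ring.
move: pos; rewrite E; move: A1 A2.
move: (dotp _ _) (t * dotp _ _) (t ^+ 2 * _) => a1 a2 a3.
by move: (t * (s * Q) * _) (t * (`|x| * _)) => a4 a5; clear -fd; lra.
Qed.

End Necessity.

(** * The framed decomposition and the equivalence *)

Section Frame.
Context {R : realType} {Y Z : finHilbertType R}.

Lemma minorant_subdiff (theta : Z -> \bar R) (z : Z) : proper_fun theta ->
  sublinear theta -> minorants theta z -> subdiff theta 0 z.
Proof.
move=> pt st Cz; apply: (@subdiff_of_growth _ _ _ _ _ 0); first exact: theta0.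
move=> e e0; exists 1 => // u _; apply: le_trans (Cz u).
by rewrite lee_fin subr0 add0r lerBlDr lerDl mulr_ge0// ltW.
Qed.

Lemma par_mono (A B : set Z) : A `<=` B -> par A `<=` par B.
Proof.
move=> AB _ [p [A1 A2] <-]; exists p => //.
have aff_mono q : aff A q -> aff B q.
  move=> Aq M [Maff BM]; apply: Aq; split => //; exact: subset_trans BM.
by split; apply: aff_mono.
Qed.

(** Nondegeneracy says that the adjoint derivative is injective on the
    directions of the minorants; dually, the derivative is onto there. *)
Lemma framed_of_reliable (g : Y -> \bar R) u (O : set Y) (theta : Z -> \bar R)
    (Xi : Y -> Z) : C2_decomposition g u O theta Xi -> Defs.nondegenerate u theta Xi ->
  exists (P : {linear Z -> Z}) (c : R), framed_decomposition g O theta Xi P c /\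
    regular_at O Xi P u.
Proof.
move=> [gfin [oO Ou] [pt lt st] [smooth X0] gE]; rewrite /Defs.nondegenerate X0 => nondeg.
have [U [CU Upar Uorth]] := minorants_direction pt lt st.
have [P [PU PK Psym]] := orth_proj U.
exists P, (fine (g u)); split.
  split => //.
  - by move=> v Ov; rewrite gE// fineK.
  - by move=> x; rewrite PK.
  - by move=> z z' Cz Cz'; rewrite PK// CU.
  - by move=> x xC; apply: dot_eq0; rewrite Psym PK// (Uorth x xC).
split=> // z.
have inj x : P x = x -> adjoint ('d Xi u) x = 0 -> x = 0.
  move=> Px ax.
  have : (par (subdiff theta 0) `&` [set z | adjoint ('d Xi u) z = 0]) x.
    split => //; have xU : x \in U by rewrite -Px.
    by apply: par_mono (Upar x xU) => y; exact: minorant_subdiff.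
  by rewrite nondeg.
(* [T] is the identity off [U] and the positive operator built from the
   derivative and its adjoint on [U]; it is injective by nondegeneracy. *)
pose T x : Z := P ('d Xi u (adjoint ('d Xi u) (P x))) + (x - P x).
have Tlin : linear T.
  move=> a x y; rewrite /T linearP adjointD adjointZ.
  have -> : 'd Xi u (a *: adjoint ('d Xi u) (P x) + adjoint ('d Xi u) (P y)) =
     a *: ('d Xi u (adjoint ('d Xi u) (P x)) : Z) + 'd Xi u (adjoint ('d Xi u) (P y)).
    by rewrite linearP.
  rewrite linearP; apply: dot_inj => k; rewrite !dotE; ring.
pose TL : {linear Z -> Z} := HB.pack T (GRing.isLinear.Build _ _ _ _ T Tlin).
have PTE x : P (T x) = P ('d Xi u (adjoint ('d Xi u) (P x))).
  by rewrite /T linearD (linearB P)/= !(PK _ (PU _)) subrr addr0.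
have Tinj x : TL x = 0 -> x = 0.
  move=> Tx; have PTx := PTE x; rewrite -[T x]/(TL x) Tx linear0 in PTx.
  have ax : adjoint ('d Xi u) (P x) = 0.
    apply: dot_eq0; rewrite dot_adj -[X in dotp X _](PK _ (PU x)) Psym -PTx.
    by rewrite dot0r.
  have Px0 := inj _ (PK _ (PU x)) ax.
  by have := Tx; rewrite /TL /= /T -PTx add0r Px0 subr0.
have [x Tx] := linear_inj_surj Tinj (P z).
exists (adjoint ('d Xi u) (P x)); rewrite -PTE -[T x]/(TL x) Tx.
exact: PK.
Qed.

End Frame.

Theorem theorem5p8 (R : realType) (Y : finHilbertType R) (g : Y -> \bar R)
    (ubar ybar : Y)
    (hgph : gph (subdiff g) (ubar, ybar))
    (hdec : exists2 U, nbhs ubar U &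
      forall u, (U `&` dom g) u -> reliably_C2_decomposable g u) :
  [<-> (\forall p \near (ubar, ybar), gph (subdiff g) p ->
          strictly_twice_epi_differentiable g p.1 p.2);
       (\forall p \near (ubar, ybar), gph (subdiff g) p ->
          strictly_proto_differentiable (subdiff g) p.1 p.2);
       ri (subdiff g ubar) ybar].
Proof.
have [V nV dec] := hdec.
have [gfin _] := hgph.
have domu : dom g ubar by rewrite /dom /= ltey_eq gfin.
have [Z [ O [theta [Xi [dcp nondeg]]]]] := dec ubar (conj (nbhs_singleton nV) domu).
have X0 : Xi ubar = 0 by have [_ _ _ [_ h] _] := dcp.
have [P [c [fd reg]]] := framed_of_reliable dcp nondeg.
have [z0 [t [Cz0 _ _ yE]]] :=
  minorant_of_subdiff fd reg (hgph : subdiff g ubar ybar).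
have PX0 : P (Xi ubar) = 0 by rewrite X0 linear0.
subst ybar.
have near_interior (Q : Y -> Y -> Prop) :
    (forall u z e, regular_at O Xi P u -> P (Xi u) = 0 ->
       interior_minorant theta P z e -> Q u (adjoint ('d Xi u) z)) ->
    ri (subdiff g ubar) (adjoint ('d Xi ubar) z0) ->
    \forall p \near (ubar, adjoint ('d Xi ubar) z0), gph (subdiff g) p -> Q p.1 p.2.
  move=> HQ hri; have [e int0] := interior_of_ri fd reg X0 Cz0 hri.
  have [r r0 Hr] := subdiff_graph_near fd reg int0 ltr01.
  apply/nbhs_pairP; exists r => // u y ur yr suby.
  have [z [regu PXu intz _ ->]] := Hr u y ur yr suby.
  exact: (HQ _ _ _ regu PXu intz).
have a_c : (\forall p \near (ubar, adjoint ('d Xi ubar) z0), gph (subdiff g) p ->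
    strictly_twice_epi_differentiable g p.1 p.2) ->
    ri (subdiff g ubar) (adjoint ('d Xi ubar) z0).
  move=> /nbhs_singleton/(_ hgph) epid.
  have [e int0] := interior_of_strictly_twice_epi fd reg PX0 Cz0 epid.
  exact: (ri_of_interior fd reg X0 int0).
tfae.
- move=> /a_c; apply: (near_interior (strictly_proto_differentiable (subdiff g))).
  by move=> u z e regu PXu intz; exact: (strictly_proto_of_interior fd regu PXu intz).
- move=> /nbhs_singleton/(_ hgph) proto.
  have [e int0] := interior_of_strictly_proto fd reg PX0 Cz0 proto.
  exact: (ri_of_interior fd reg X0 int0).
- apply: (near_interior (strictly_twice_epi_differentiable g)).
  by move=> u z e regu PXu intz; exact: (strictly_twice_epi_of_interior fd regu PXu intz).
Qed.
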